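(* Let $\mathcal{CL}_4\subset\mathbb{P}^2_{\mathbb{C}}$ be the arrangement of $11$ lines and one smooth conic given by $f=0$, where $$f(x,y,z)=xyz(x-z)(x+z)(y+z)(y-z)(y-x-z)(y-x+z)(y-x)(x+y)(-x^2+xy-y^2+z^2).$$ Then $\mathcal{CL}_4$ has only ordinary singularities of multiplicity at most $4$, with $n_2=11$, $n_3=2$, $n_4=10$; its total Tjurina number is $109$; $\operatorname{mdr}(f)=5$; and $\mathcal{CL}_4$ is an $\mathscr{M}$-arrangement which is free with exponents $(5,7)$. Moreover, let $\mathcal{L}=\mathcal{CL}_4\setminus\{C\}$ be the arrangement of $11$ lines obtained by deleting the conic $C:\ -x^2+xy-y^2+z^2=0$. Then $\mathcal{L}$ has exactly $7$ double points, $8$ triple points, $4$ quadruple points and no points of higher multiplicity; $\tau(\mathcal{L})=75$ and $\operatorname{mdr}(\mathcal{L})=5$; its Poincaré polynomial is $\mathfrak{P}(\mathcal{L};t)=25t^2+10t+1=(1+5t)^2$; and $\mathcal{L}$ is free with exponents $(5,5)$.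
   Context: Let $S=\mathbb{C}[x,y,z]$. For an arrangement, identified with the reduced curve $\{f=0\}$ that is the union of its members, $n_r$ is the number of points lying on exactly $r$ of its curves; a singular point is ordinary if the curves of the arrangement through it have pairwise distinct tangent lines there. For a reduced homogeneous $f\in S$ of degree $e$, $J_f=\langle\partial_x f,\partial_y f,\partial_z f\rangle$ is the Jacobian ideal, $\deg J_f$ is the degree of the scheme it defines, equal to the total Tjurina number $\tau=\sum_p\tau_p$; $AR(f)=\{(a,b,c)\in S^3: a\,\partial_x f+b\,\partial_y f+c\,\partial_z f=0\}$ is the graded module of Jacobian syzygies (graded by the common degree of $a,b,c$), and $\operatorname{mdr}(f)=\min\{r\ge 0: AR(f)_r\neq 0\}$ (also written $\operatorname{mdr}$ of the curve). The curve $\{f=0\}$ is free if $J_f$ is saturated with respect to $\langle x,y,z\rangle$; then $AR(f)$ is a free $S$-module with generators of degrees $(d_1,d_2)=(\operatorname{mdr}(f),\,e-1-\operatorname{mdr}(f))$, called the exponents. An arrangement of degree $e\geq 5$ with only ordinary singularities of multiplicity at most $4$ is an $\mathscr{M}$-arrangement if it has at least one ordinary quadruple point and $\deg J_f=3m^2-3m+3$ if $e=2m\ge 6$, respectively $\deg J_f=3m^2+1$ if $e=2m+1\geq 5$. The Poincaré polynomial of an arrangement of $d$ lines is $1+(d-1)t+\big(\sum_{r\geq2}(r-1)n_r-d+1\big)t^2$. *)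

(* Defs.v *)
From HB Require Import structures.
From mathcomp Require Import all_boot all_order all_algebra.
From mathcomp Require Import reals complex mpoly.

Set Implicit Arguments.
Unset Strict Implicit.
Unset Printing Implicit Defensive.

Import Order.TTheory GRing.Theory Num.Theory.
Local Open Scope ring_scope.

(** * Points of the projective plane *)

Definition P2 (K : fieldType) : eqType :=
  {U : {vspace 'rV[K]_3} | \dim U == 1%N}.

(* Homogeneous coordinates of p: some nonzero vector of the line p. The notions
   below are applied to homogeneous polynomials only, for which they do not
   depend on the choice of this vector. *)
Definition rep (K : fieldType) (p : P2 K) : 'rV[K]_3 := vpick (sval p).

Definition on_curve (K : fieldType) (g : {mpoly K[3]}) (p : P2 K) : bool :=
  g.@[fun i => rep p 0 i] == 0.

Definition singular (K : fieldType) (g : {mpoly K[3]}) (p : P2 K) : bool :=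
  on_curve g p && [forall i : 'I_3, on_curve g^`M(i) p].

(* The tangent line of {g = 0} at p, as the set of vectors of K^3 orthogonal to
   the gradient of g at p; its dimension is 2 exactly when that gradient is
   nonzero. *)
Definition tangent (K : fieldType) (g : {mpoly K[3]}) (p : P2 K) :
    {vspace 'rV[K]_3} :=
  lker (linfun (mulmxr (\col_(i < 3) (g^`M(i)).@[fun j => rep p 0 j]))).

(** * Arrangements, given as the list of the equations of their members *)

Definition is_line (K : fieldType) (g : {mpoly K[3]}) : Prop :=
  g != 0 /\ g \is 1.-homog.

(* The singular points range over P^2(K), so that this is the geometric notion
   when K is algebraically closed. *)
Definition is_smooth_conic (K : fieldType) (g : {mpoly K[3]}) : Prop :=
  [/\ g != 0, g \is 2.-homog & forall p : P2 K, ~~ singular g p].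

Definition conic_line_arrangement (K : fieldType) (A : seq {mpoly K[3]}) :
    Prop :=
  [/\ uniq A,
      forall g, g \in A -> is_line g \/ is_smooth_conic g
    & forall g h, g \in A -> h \in A -> g <> h -> forall c : K, g <> c *: h].

Definition defpoly (K : fieldType) (A : seq {mpoly K[3]}) : {mpoly K[3]} :=
  \prod_(g <- A) g.

Definition mult_at (K : fieldType) (A : seq {mpoly K[3]}) (p : P2 K) : nat :=
  count (fun g => on_curve g p) A.

(* n_r = k, where n_r counts the points lying on exactly r members of A. *)
Definition n_points (K : fieldType) (A : seq {mpoly K[3]}) (r k : nat) : Prop :=
  exists s : seq (P2 K),
    [/\ uniq s, size s = k & forall p, (p \in s) = (mult_at A p == r)].

(* The members of A through p are smooth at p, with pairwise distinct tangent
   lines. *)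
Definition ordinary_at (K : fieldType) (A : seq {mpoly K[3]}) (p : P2 K) :
    bool :=
  let T := [seq tangent g p | g <- A & on_curve g p] in
  all (fun U => \dim U == 2%N) T && uniq T.

Definition ordinary_mult_le (K : fieldType) (A : seq {mpoly K[3]}) (k : nat) :
    Prop :=
  forall p : P2 K,
    singular (defpoly A) p -> ordinary_at A p /\ (mult_at A p <= k)%N.

Definition deg (K : fieldType) (f : {mpoly K[3]}) : nat := (msize f).-1.

(** * The Jacobian ideal and the degree of the scheme it defines *)

Definition jacobian_ideal (K : fieldType) (f g : {mpoly K[3]}) : Prop :=
  exists a : 'I_3 -> {mpoly K[3]}, g = \sum_(i < 3) a i * f^`M(i).

(* The Hilbert function k |-> dim (S / J_f)_k is eventually equal to d; for each
   large k, b is a family of forms of degree k whose classes are a basis of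
   (S / J_f)_k. *)
Definition deg_jacobian (K : fieldType) (f : {mpoly K[3]}) (d : nat) : Prop :=
  exists k0 : nat, forall k, (k0 <= k)%N ->
    exists b : 'I_d -> {mpoly K[3]},
      [/\ forall i, b i \is k.-homog,
          forall g, g \is k.-homog -> exists c : 'I_d -> K,
            jacobian_ideal f (g - \sum_(i < d) c i *: b i)
        & forall c : 'I_d -> K,
            jacobian_ideal f (\sum_(i < d) c i *: b i) -> forall i, c i = 0].

(** * Tjurina numbers *)

(* A local equation of {f = 0} at p, in the affine chart x_i = 1 given by the
   first nonzero coordinate x_i of p, with p translated to the origin. *)
Definition local_equation (K : fieldType) (f : {mpoly K[3]}) (p : P2 K) :
    {mpoly K[2]} :=
  let a := rep p in
  let i := odflt ord0 [pick i : 'I_3 | a 0 i != 0] in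
  f \mPo [tuple (if unlift i j is Some k then (a 0 j / a 0 i)%:MP + 'X_k else 1)
         | j < 3].

Definition tjurina_ideal (K : fieldType) (g h : {mpoly K[2]}) : Prop :=
  exists (b : {mpoly K[2]}) (a : 'I_2 -> {mpoly K[2]}),
    h = b * g + \sum_(j < 2) a j * g^`M(j).

(* dim_K (O / I O) = k, where O is the local ring of K[u, v] at the origin: its
   elements are the fractions h / t with t(0) != 0, and h / t belongs to I O
   iff s * h belongs to I for some s with s(0) != 0. The classes of the b_i form
   a basis of O / I O; polynomial representatives suffice because O / I O has
   finite dimension. When the origin is an isolated zero of I, replacing O by
   the ring of convergent power series gives the same dimension. *)
Definition local_colength (K : fieldType) (I : {mpoly K[2]} -> Prop) (k : nat) :
    Prop :=
  exists b : 'I_k -> {mpoly K[2]},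
    (forall h t : {mpoly K[2]}, t.@[fun=> 0] != 0 ->
       exists (c : 'I_k -> K) (s : {mpoly K[2]}),
         s.@[fun=> 0] != 0 /\ I (s * (h - t * \sum_(i < k) c i *: b i))) /\
    (forall (c : 'I_k -> K) (s : {mpoly K[2]}), s.@[fun=> 0] != 0 ->
       I (s * \sum_(i < k) c i *: b i) -> forall i, c i = 0).

Definition tjurina_at (K : fieldType) (f : {mpoly K[3]}) (p : P2 K) (k : nat) :
    Prop :=
  local_colength (tjurina_ideal (local_equation f p)) k.

Definition total_tjurina (K : fieldType) (f : {mpoly K[3]}) (t : nat) : Prop :=
  exists (s : seq (P2 K)) (tau : P2 K -> nat),
    [/\ uniq s,
        forall p, (p \in s) = singular f p,
        forall p, p \in s -> tjurina_at f p (tau p)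
      & t = (\sum_(p <- s) tau p)%N].

(** * Jacobian syzygies and freeness *)

Definition syzygy (K : fieldType) (f : {mpoly K[3]})
    (a : 'rV[{mpoly K[3]}]_3) : Prop :=
  \sum_(i < 3) a 0 i * f^`M(i) = 0.

Definition syzygy_deg (K : fieldType) (f : {mpoly K[3]}) (r : nat)
    (a : 'rV[{mpoly K[3]}]_3) : Prop :=
  syzygy f a /\ forall i, a 0 i \is r.-homog.

Definition is_mdr (K : fieldType) (f : {mpoly K[3]}) (r : nat) : Prop :=
  (exists2 a, syzygy_deg f r a & a != 0) /\
  (forall q, (q < r)%N -> forall a, syzygy_deg f q a -> a = 0).

(* J_f is saturated with respect to (x, y, z): if all the monomials of some
   degree N multiply g into J_f, then g lies in J_f. *)
Definition free_curve (K : fieldType) (f : {mpoly K[3]}) : Prop :=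
  forall (g : {mpoly K[3]}) (N : nat),
    (forall m : 'X_{1..3}, mdeg m = N -> jacobian_ideal f ('X_[m] * g)) ->
    jacobian_ideal f g.

Definition free_with_exponents (K : fieldType) (f : {mpoly K[3]})
    (d1 d2 : nat) : Prop :=
  [/\ free_curve f,
      is_mdr f d1,
      d2 = (deg f - 1 - d1)%N
    & exists r1 r2 : 'rV[{mpoly K[3]}]_3,
        [/\ syzygy_deg f d1 r1, syzygy_deg f d2 r2
          & forall a, syzygy f a ->
              exists! u : {mpoly K[3]} * {mpoly K[3]},
                a = u.1 *: r1 + u.2 *: r2]].

(** * M-arrangements *)

Definition M_arrangement (K : fieldType) (A : seq {mpoly K[3]}) : Prop :=
  let e := deg (defpoly A) in
  [/\ (5 <= e)%N,
      ordinary_mult_le A 4,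
      exists p : P2 K, ordinary_at A p /\ mult_at A p = 4%N
    & exists m : nat,
        [/\ e = (2 * m)%N, (6 <= e)%N
          & deg_jacobian (defpoly A) (3 * m ^ 2 - 3 * m + 3)%N]
        \/ (e = (2 * m + 1)%N /\ deg_jacobian (defpoly A) (3 * m ^ 2 + 1)%N)].

(** * The Poincare polynomial of a line arrangement *)

(* A point lies on at most d = size A lines, so the sum over r >= 2 stops at d. *)
Definition is_poincare (K : fieldType) (A : seq {mpoly K[3]})
    (P : {poly int}) : Prop :=
  let d := size A in
  exists n : nat -> nat,
    (forall r, (2 <= r <= d)%N -> n_points A r (n r)) /\
    P = 1 + (d%:Z - 1) *: 'X
        + ((\sum_(2 <= r < d.+1) (r%:Z - 1) * (n r)%:Z) - d%:Z + 1) *: 'X^2.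

(** * The arrangement *)

Section Arrangement.
Variable K : fieldType.

Let x : {mpoly K[3]} := 'X_(@Ordinal 3 0 isT).
Let y : {mpoly K[3]} := 'X_(@Ordinal 3 1 isT).
Let z : {mpoly K[3]} := 'X_(@Ordinal 3 2 isT).

Definition conic4 : {mpoly K[3]} := - x ^+ 2 + x * y - y ^+ 2 + z ^+ 2.

Definition lines4 : seq {mpoly K[3]} :=
  [:: x; y; z; x - z; x + z; y + z; y - z; y - x - z; y - x + z; y - x; x + y].

Definition CL4 : seq {mpoly K[3]} := rcons lines4 conic4.

Definition f4 : {mpoly K[3]} :=
  x * y * z * (x - z) * (x + z) * (y + z) * (y - z) * (y - x - z)
  * (y - x + z) * (y - x) * (x + y) * (- x ^+ 2 + x * y - y ^+ 2 + z ^+ 2).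

End Arrangement.

(* Main.v *)
(** Freeness.  Let r1, r2 be Jacobian syzygies of degrees d1, d2 whose cross product
    is a nonzero multiple of the gradient.  Restrict everything to a line ell = 0 on
    which the gradient has no zero: the restricted partials then contain powers of
    both coordinates, and Cramer's rule shows that every syzygy between them is a
    combination of the restrictions of r1 and r2.  Lifting back, a syzygy is a
    combination of r1 and r2 up to ell times a syzygy of smaller degree, so r1 and r2
    are a basis of AR(f); the same lifting shows that ell is a nonzerodivisor modulo
    the Jacobian ideal, which is therefore saturated.  Counting dimensions in the
    resolution so obtained gives (d1 + d2)^2 - d1 d2 for the degree of the Jacobian
    scheme.

    Tjurina numbers.  At an ordinary point of multiplicity r <= 4 the local equation is
    P + (terms of degree > r), where P is a product of r pairwise independent linear
    forms.  By Euler's formula the two partials of P have no relation with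
    coefficients of degree r - 2, hence they generate all the forms of degree 2r - 3;
    by Nakayama the local Tjurina ideal contains the power 2r - 3 of the maximal
    ideal, modulo which a dimension count gives (r - 1)^2.

    Incidences.  Two lines meet at the cross product of their coefficient vectors, and
    a line meets the conic in at most two points; all the coordinates that occur lie
    in Z[sqrt 3, i], where the incidences and the tangents are computed. *)

Require Import Defs.
From Stdlib Require Import ZArith.
From HB Require Import structures.
From mathcomp Require Import all_boot all_order all_algebra.
From mathcomp Require Import reals complex mpoly ssrZ zify ring.

Set Implicit Arguments.
Unset Strict Implicit.
Unset Printing Implicit Defensive.

Import Order.TTheory GRing.Theory Num.Theory.
Local Open Scope ring_scope.
Delimit Scope Z_scope with BZ.

(** * Computing with integral polynomials in three variables *)

(** Elements of [{mpoly K[3]}] and complex numbers do not compute, so every numerical fact is stated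
    for lists of terms over Z or for quadruples of integers, settled by [vm_compute], and carried
    over by evaluation morphisms. Restriction to a line replaces homological algebra: on P^1 the
    absence of zeros of the gradient is witnessed by two polynomial identities, and these are all
    that the proof of freeness takes from the geometry of the curve beyond the cross product
    identity. The bound 4 on the multiplicities shapes the local computation. At an ordinary point
    of multiplicity r the terms beyond the initial form have order at least r + 1, while the ideal
    of the partials contains all germs of order 2r - 3. For r <= 4 one has r + 1 >= 2r - 3, so the
    initial form alone determines the Tjurina number; from r = 5 on higher terms can lower it. The
    number 109 is reached by two independent computations: as the sum of the local numbers, 10 * 9 +
    2 * 4 + 11, and from the exponents, 12^2 - 5 * 7. *)

Definition zmon : Type := nat * nat * nat.
Definition zpoly : Type := seq (zmon * Z).

Definition zmon_eq (m n : zmon) : bool :=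
  let: (a, b, c) := m in let: (a', b', c') := n in
  [&& a == a', b == b' & c == c'].

Definition zmon_lt (m n : zmon) : bool :=
  let: (a, b, c) := m in let: (a', b', c') := n in
  (a < a')%N || (a == a') && ((b < b')%N || (b == b') && (c < c')%N).

(** Like terms are merged at once, which keeps the lists short and lets equal polynomials cancel in
    [zeq]; soundness, [zev_ins], holds for every list, sorted or not. *)
Fixpoint zins (m : zmon) (c : Z) (p : zpoly) : zpoly :=
  if p is (m', c') :: q then
    if zmon_eq m m' then
      let s := (c + c')%BZ in if Z.eqb s 0 then q else (m', s) :: q
    else if zmon_lt m m' then (m, c) :: p else (m', c') :: zins m c q
  else [:: (m, c)].

Definition zadd (p q : zpoly) : zpoly :=
  foldr (fun t acc => zins t.1 t.2 acc) q p.

Definition zopp (p : zpoly) : zpoly := [seq (t.1, Z.opp t.2) | t <- p].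

Definition zsub (p q : zpoly) : zpoly := zadd p (zopp q).

Definition zmul_mon (m n : zmon) : zmon :=
  let: (a, b, c) := m in let: (a', b', c') := n in
  ((a + a')%N, (b + b')%N, (c + c')%N).

Definition zmul_term (t : zmon * Z) (p : zpoly) : zpoly :=
  [seq (zmul_mon t.1 u.1, (t.2 * u.2)%BZ) | u <- p].

Definition zmul (p q : zpoly) : zpoly :=
  foldr (fun t acc => zadd (zmul_term t q) acc) [::] p.

Definition zprod (s : seq zpoly) : zpoly :=
  foldr zmul [:: ((0, 0, 0)%N, 1%BZ)] s.

Definition zder (i : nat) (p : zpoly) : zpoly :=
  foldr (fun t acc =>
    let: (a, b, c) := t.1 in
    let k := nth 0%N [:: a; b; c] i in
    if k == 0%N then acc
    else ((a - (i == 0), b - (i == 1), c - (i == 2))%N,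
          (t.2 * Z.of_nat k)%BZ) :: acc) [::] p.

(* The powers of l in decreasing order, from l^n to 1. *)
Fixpoint zpow (l : zpoly) (n : nat) : seq zpoly :=
  if n is k.+1 then
    let s := zpow l k in zmul l (head [::] s) :: s
  else [:: [:: ((0, 0, 0)%N, 1%BZ)]].

(* Substitution of l for the third variable, whose exponents in p are at most n. *)
Definition zsubst (l : zpoly) (n : nat) (p : zpoly) : zpoly :=
  let s := rev (zpow l n) in
  foldr (fun t acc => let: (a, b, c) := t.1 in
    zadd (zmul_term ((a, b, 0)%N, t.2) (nth [::] s c)) acc) [::] p.

Definition zdeg_le3 (n : nat) (p : zpoly) : bool :=
  all (fun t => (t.1.2 <= n)%N) p.

Definition zhomog (d : nat) (p : zpoly) : bool :=
  all (fun t => let: (a, b, c) := t.1 in (a + b + c == d)%N) p.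

Section ZEval.
Variable A : comNzRingType.
Implicit Types (h : 'I_3 -> A) (p q : zpoly) (m : zmon) (c : Z).

Definition zr c : A := (int_of_Z c)%:~R.

Lemma zrD c d : zr (c + d)%BZ = zr c + zr d.
Proof. by rewrite /zr -rmorphD; congr (_%:~R); exact: (rmorphD int_of_Z). Qed.

Lemma zrN c : zr (Z.opp c) = - zr c.
Proof. by rewrite /zr -rmorphN; congr (_%:~R); exact: (rmorphN int_of_Z). Qed.

Lemma zrB c d : zr (c - d)%BZ = zr c - zr d.
Proof. by rewrite -zrN -zrD. Qed.

Lemma zrM c d : zr (c * d)%BZ = zr c * zr d.
Proof. by rewrite /zr -rmorphM; congr (_%:~R); exact: (rmorphM int_of_Z). Qed.

Lemma zr0 : zr 0 = 0. Proof. by []. Qed.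

Lemma zr_nat n : zr (Z.of_nat n) = n%:R.
Proof. by rewrite /zr -[Z.of_nat n]/(Z_of_int (Posz n)) Z_of_intK. Qed.

Definition i0 : 'I_3 := @Ordinal 3 0 isT.
Definition i1 : 'I_3 := @Ordinal 3 1 isT.
Definition i2 : 'I_3 := @Ordinal 3 2 isT.

Definition zmev h m : A := let: (a, b, c) := m in
  h i0 ^+ a * h i1 ^+ b * h i2 ^+ c.

(** At the variables this is the polynomial [zmp], at the coordinates of a point it is a value:
    lemmas proved once here serve both purposes. *)
Definition zev h p : A := \sum_(t <- p) zr t.2 * zmev h t.1.

Lemma zev_nil h : zev h [::] = 0.
Proof. by rewrite /zev big_nil. Qed.

Lemma zev_cons h t p : zev h (t :: p) = zr t.2 * zmev h t.1 + zev h p.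
Proof. by rewrite /zev big_cons. Qed.

Lemma zmon_eqP m n : zmon_eq m n -> m = n.
Proof. by case: m n => [[a b] c] [[a' b'] c'] /and3P[/eqP-> /eqP-> /eqP->]. Qed.

Lemma zev_ins h m c p : zev h (zins m c p) = zr c * zmev h m + zev h p.
Proof.
elim: p => [|[m' c'] p IH] /=; first by rewrite zev_cons.
case: ifP => [/zmon_eqP ->|_].
  rewrite zev_cons /= addrA -mulrDl -zrD.
  case: Z.eqb_spec => [->|_]; last by rewrite zev_cons.
  by rewrite zr0 mul0r add0r.
by case: ifP => _; rewrite !zev_cons //= IH addrCA.
Qed.

Lemma zev_add h p q : zev h (zadd p q) = zev h p + zev h q.
Proof.
elim: p => [|t p IH] /=; first by rewrite zev_nil add0r.
by rewrite zev_ins IH zev_cons addrA.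
Qed.

Lemma zev_opp h p : zev h (zopp p) = - zev h p.
Proof.
elim: p => [|t p IH] /=; first by rewrite !zev_nil oppr0.
by rewrite !zev_cons /= IH zrN mulNr opprD.
Qed.

Lemma zev_sub h p q : zev h (zsub p q) = zev h p - zev h q.
Proof. by rewrite zev_add zev_opp. Qed.

Lemma zmev_mul h m n : zmev h (zmul_mon m n) = zmev h m * zmev h n.
Proof. by case: m n => [[a b] c] [[a' b'] c'] /=; rewrite !exprD; ring. Qed.

Lemma zev_mul_term h t p :
  zev h (zmul_term t p) = zr t.2 * zmev h t.1 * zev h p.
Proof.
elim: p => [|u p IH] /=; first by rewrite !zev_nil mulr0.
by rewrite !zev_cons /= IH zrM zmev_mul; ring.
Qed.

Lemma zev_mul h p q : zev h (zmul p q) = zev h p * zev h q.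
Proof.
elim: p => [|t p IH] /=; first by rewrite !zev_nil mul0r.
by rewrite zev_add zev_mul_term IH zev_cons mulrDl.
Qed.

Lemma zev_const h c : zev h [:: ((0, 0, 0)%N, c)] = zr c.
Proof. by rewrite zev_cons zev_nil /= !expr0 !mulr1 addr0. Qed.

Lemma zev_prod h s : zev h (zprod s) = \prod_(p <- s) zev h p.
Proof.
elim: s => [|p s IH] /=; first by rewrite big_nil zev_const /zr.
by rewrite zev_mul IH big_cons.
Qed.

Lemma zev_pow h l n k : (k <= n)%N ->
  zev h (nth [::] (rev (zpow l n)) k) = zev h l ^+ k.
Proof.
elim: n k => [|n IH] k; first by rewrite leqn0 => /eqP->; rewrite zev_const.
rewrite /= rev_cons => le_kn.
have sz j : size (zpow l j) = j.+1 by elim: j => //= j ->.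
rewrite nth_rcons size_rev sz; case: ltnP => [lt_kn|le_nk]; first exact: IH.
have -> : k = n.+1 by apply/eqP; rewrite eqn_leq le_kn.
rewrite eqxx zev_mul exprS; congr (_ * _); rewrite -(IH n) //.
by rewrite nth_rev ?sz // subnn nth0.
Qed.

Lemma zev_subst h l n p : zdeg_le3 n p ->
  zev h (zsubst l n p) =
  zev (fun i => if i == i2 then zev h l else h i) p.
Proof.
elim: p => [|[[[a b] c] k] p IH] /=; first by rewrite !zev_nil.
case/andP=> /= le_c le_p.
rewrite zev_add zev_mul_term IH // zev_cons /= zev_pow //.
by congr (_ + _); rewrite /= expr0 mulr1 -!mulrA.
Qed.

End ZEval.

Lemma zr_eq0 (K : numDomainType) (c : Z) : (zr K c == 0) = Z.eqb c 0.
Proof.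
rewrite /zr intr_eq0; apply/eqP/Z.eqb_spec => [|-> //].
by move=> e; rewrite -[c]int_of_ZK e.
Qed.

Lemma rmorph_zev (A B : comNzRingType) (phi : {rmorphism A -> B}) h p :
  phi (zev h p) = zev (phi \o h) p.
Proof.
rewrite rmorph_sum; apply: eq_bigr => -[[[a b] c] k] _ /=.
by rewrite !rmorphM !rmorphXn /= /zr rmorph_int.
Qed.

Lemma eq_zev (A : comNzRingType) (h h' : 'I_3 -> A) p :
  h =1 h' -> zev h p = zev h' p.
Proof.
by move=> e; apply: eq_bigr => -[[[a b] c] k] _; rewrite /= !e.
Qed.

Section ZMpoly.
Variable K : fieldType.

Definition zmp (p : zpoly) : {mpoly K[3]} := zev (fun i => 'X_i) p.

Lemma ord3P (P : 'I_3 -> Prop) : P i0 -> P i1 -> P i2 -> forall i, P i.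
Proof.
by move=> p0 p1 p2 [[|[|[|//]]] lt_i];
  [move: p0 | move: p1 | move: p2]; congr P; apply: val_inj.
Qed.

Lemma mderivXn n (i : 'I_n) (p : {mpoly K[n]}) k :
  (p ^+ k)^`M(i) = p ^+ k.-1 * p^`M(i) *+ k.
Proof.
elim: k => [|k IH]; first by rewrite expr0 mulr0n -mpolyC1 mderivC.
rewrite exprS mderivM IH mulrS; case: k {IH} => [|k] /=.
  by rewrite !expr0 mul1r mulr1 mulr0n mulr0 addr0.
by rewrite mulrnAr mulrA -exprS mulrC.
Qed.

Lemma mderivXi n (i j : 'I_n) : ('X_j : {mpoly K[n]})^`M(i) = (i == j)%:R.
Proof.
rewrite mderivX mnm1E eq_sym; case: eqP => [->|_]; last by rewrite scale0r.
by rewrite scale1r (_ : (U_(j) - U_(j))%MM = 0%MM) ?mpolyX0 //;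
  apply/mnmP => k; rewrite mnmBE subnn mnm0E.
Qed.

Lemma zmp_der (i : 'I_3) p : zmp (zder i p) = (zmp p)^`M(i).
Proof.
rewrite /zmp; elim: p => [|[[[a b] c] k] p IH]; first by rewrite !zev_nil mderiv0.
rewrite zev_cons /= mderivD -IH.
have e : zr {mpoly K[3]} k = (zr K k)%:MP by rewrite /zr rmorph_int.
rewrite {1}e mderiv_mulC -e !mderivM !mderivXn !mderivXi.
have simp := (mulr0, mul0rn, mul0r, addr0, add0r, mulr1).
by elim/ord3P: i {IH} => /=; rewrite !simp; case: eqP => [->|_];
  rewrite ?mulr0n ?simp // zev_cons /= !subn0 subn1 zrM zr_nat;
  rewrite -(mulr_natr (_ ^+ _)); ring.
Qed.

Lemma zmp_homog d p : zhomog d p -> zmp p \is d.-homog.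
Proof.
rewrite /zmp; elim: p => [|[[[a b] c] k] p IH] /=; first by rewrite zev_nil rpred0.
case/andP=> /eqP ed hp; rewrite zev_cons /= rpredD ?IH //.
have -> : zr {mpoly K[3]} k = (zr K k)%:MP by rewrite /zr rmorph_int.
rewrite mul_mpolyC rpredZ // !mpolyXn -!mpolyXD dhomogX.
by rewrite /= !mdegD !mdegMn !mdeg1 !mul1n ed.
Qed.

End ZMpoly.

(** * Freeness from a pair of syzygies *)

Section Vec3.
Variable A : comNzRingType.
Implicit Types u v w : 'I_3 -> A.

Definition vec3 (a b c : A) : 'I_3 -> A := fun i => nth 0 [:: a; b; c] i.

Definition cross u v : 'I_3 -> A :=
  vec3 (u i1 * v i2 - u i2 * v i1) (u i2 * v i0 - u i0 * v i2)
       (u i0 * v i1 - u i1 * v i0).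

Definition dot u v : A := \sum_(i < 3) u i * v i.

Lemma sum3 (F : 'I_3 -> A) : \sum_(i < 3) F i = F i0 + F i1 + F i2.
Proof.
by rewrite !big_ord_recr big_ord0 /= add0r; congr (F _ + F _ + F _); apply: val_inj.
Qed.

Lemma dotE u v : dot u v = u i0 * v i0 + u i1 * v i1 + u i2 * v i2.
Proof. exact: sum3. Qed.

(** Four vectors of a free module of rank 3 satisfy a linear relation whose coefficients are their 3
    by 3 determinants, written here as triple products. *)
Lemma cramer3 w a u v i :
  dot w (cross u v) * a i =
  dot a (cross u v) * w i + dot w (cross a v) * u i + dot w (cross u a) * v i.
Proof. by elim/ord3P: i; rewrite !dotE /cross /vec3 /=; ring. Qed.

End Vec3.

(** Eliminating one of [a], [b] between two coordinates multiplies the other by a 2 by 2 minor, that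
    is, by a coordinate of the cross product up to sign. *)
Lemma cross_indep (A : idomainType) (u v : 'I_3 -> A) (a b : A) i :
  cross u v i != 0 -> (forall j, a * u j + b * v j = 0) -> a = 0 /\ b = 0.
Proof.
move=> nz e.
have ea j k : a * (u j * v k - u k * v j) = 0.
  transitivity ((a * u j + b * v j) * v k - (a * u k + b * v k) * v j); first by ring.
  by rewrite !e !mul0r subrr.
have eb j k : b * (u j * v k - u k * v j) = 0.
  transitivity (u j * (a * u k + b * v k) - u k * (a * u j + b * v j)); first by ring.
  by rewrite !e !mulr0 subrr.
split; apply/eqP; rewrite -[_ == 0]orbF -(negPf nz) -mulf_eq0;
  by elim/ord3P: (i); rewrite /cross /vec3 /= ?ea ?eb.
Qed.

Lemma rmorph_dot (A B : comNzRingType) (phi : {rmorphism A -> B}) u v :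
  phi (dot u v) = dot (phi \o u) (phi \o v).
Proof. by rewrite !dotE !rmorphD !rmorphM. Qed.

Lemma rmorph_cross (A B : comNzRingType) (phi : {rmorphism A -> B}) u v i :
  phi (cross u v i) = cross (phi \o u) (phi \o v) i.
Proof. by elim/ord3P: i; rewrite /cross /vec3 /= rmorphB !rmorphM. Qed.

(** * Divisibility by monomials, homogeneous components and congruences *)

Section MpolyDivisibility.
Variables (n : nat) (K : fieldType).
Implicit Types (p q : {mpoly K[n]}) (m : 'X_{1..n}).

Lemma mcoeffMXn p m k : (m <= k)%MM -> ('X_[m] * p)@_k = p@_(k - m).
Proof. by move=> le_mk; rewrite mulrC -{1}(submK le_mk) addmC mcoeffMX. Qed.

Lemma mcoeffMXn0 p m k : ~~ (m <= k)%MM -> ('X_[m] * p)@_k = 0.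
Proof.
move=> nle; apply: memN_msupp_eq0; apply: contra nle.
rewrite mulrC (perm_mem (msuppMX _ _)) => /mapP[k' _ ->].
exact: lem_addr.
Qed.

Lemma mpolyX_dvd p m : (forall k, ~~ (m <= k)%MM -> p@_k = 0) ->
  exists q, p = 'X_[m] * q.
Proof.
move=> p0; exists (\sum_(k <- msupp p) p@_k *: 'X_[k - m]).
rewrite {1}[p]mpolyE mulr_sumr; apply: eq_big_seq => k.
rewrite mcoeff_msupp -scalerAr -mpolyXD => nz; congr (_ *: 'X_[_]).
by rewrite addmC submK //; apply: contraNT nz => /p0 ->.
Qed.

(** Multiplication by a power of X_i leaves the exponents of X_j unchanged, so the monomials of [p]
    inherit their divisibility from the right-hand side. *)
Lemma mpolyXn_coprime (i j : 'I_n) N p q : i != j ->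
  'X_i ^+ N * p = 'X_j ^+ N * q -> exists p', p = 'X_j ^+ N * p'.
Proof.
move=> neq_ij; rewrite !mpolyXn => e; apply: mpolyX_dvd => k nle.
rewrite -(addmK (U_(i) *+ N)%MM k) -mcoeffMXn ?lem_addl // e mcoeffMXn0 //.
apply: contra nle => /mnm_lepP le_k; apply/mnm_lepP => l.
have := le_k l; rewrite mnmDE !mulmnE !mnm1E.
by case: eqP => [<-|]; rewrite ?(negPf neq_ij) ?mul0n ?addn0.
Qed.

Lemma mcoeff_pihomog d p m :
  (pihomog mdeg d p)@_m = if mdeg m == d then p@_m else 0.
Proof.
have hp := pihomogP mdeg d p.
have [e|ne] := eqVneq (mdeg m) d; last exact: dhomog_nemf_coeff hp ne.
rewrite pihomogE raddf_sum /= big_mkcond /=.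
rewrite [in RHS](mpolyE p) raddf_sum /=; apply: eq_bigr => k _.
case: ifP => // ne_kd; rewrite mcoeffZ mcoeffX.
by case: (k =P m) ne_kd => [->|_ _]; rewrite ?e ?eqxx // mulr0.
Qed.

(** Since [p] is arbitrary, coefficients found without any control of degrees can be replaced by
    their components of the right degree. *)
Lemma pihomogM d k p q : q \is d.-homog ->
  pihomog mdeg (k + d) (p * q) = pihomog mdeg k p * q.
Proof.
move=> hq; elim/mpolyind: p => [|c m p _ _ IH]; first by rewrite mul0r !linear0 mul0r.
rewrite mulrDl !linearD /= IH mulrDl; congr (_ + _).
rewrite -scalerAl !linearZ /= -scalerAl; congr (_ *: _); rewrite pihomogX /=.
have hm : 'X_[m] * q \is (mdeg m + d).-homog by rewrite dhomogM // dhomogX.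
case: eqP => [<-|/eqP ne]; first by rewrite pihomog_dE.
by rewrite mul0r (pihomog_ne0 _ hm) // eqn_add2r.
Qed.

Lemma pihomogM0 d k p q : q \is d.-homog -> (k < d)%N ->
  pihomog mdeg k (p * q) = 0.
Proof.
move=> hq lt_kd; elim/mpolyind: p => [|c m p _ _ IH]; first by rewrite mul0r linear0.
rewrite mulrDl linearD /= IH addr0 -scalerAl linearZ /=.
have hm : 'X_[m] * q \is (mdeg m + d).-homog by rewrite dhomogM // dhomogX.
rewrite (pihomog_ne0 _ hm) ?scaler0 //.
by rewrite eq_sym neq_ltn (leq_trans lt_kd) ?leq_addl.
Qed.

Lemma mderiv_homog d i p : p \is d.+1.-homog -> p^`M(i) \is d.-homog.
Proof.
move=> hp; apply/dhomogP => m; rewrite mcoeff_msupp mcoeff_deriv => nz.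
have : (m + U_(i))%MM \in msupp p.
  by rewrite mcoeff_msupp; apply: contraNN nz => /eqP ->; rewrite mul0rn.
by move/(dhomogP _ _ _ hp) => /=; rewrite mdegD mdeg1 addn1 => -[].
Qed.

(** Congruence modulo [l] is compatible with sums and products, so it passes from the variables to
    all polynomials. It serves for the restriction to [ell = 0] and for dividing a binary form by
    the linear form of one of its zeros. *)
Lemma comp_mpoly_congr (t : n.-tuple {mpoly K[n]}) (l : {mpoly K[n]}) :
  (forall i, exists q, 'X_i - tnth t i = l * q) ->
  forall h, exists q, h - (h \mPo t) = l * q.
Proof.
move=> et h.
have congrM u v u' v' : (exists q, u - u' = l * q) ->
    (exists q, v - v' = l * q) -> exists q, u * v - u' * v' = l * q.
  move=> [q eq] [q' eq']; exists (q * v + u' * q').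
  transitivity ((u - u') * v + u' * (v - v')); first by ring.
  by rewrite eq eq'; ring.
have congrX u u' k : (exists q, u - u' = l * q) ->
    exists q, u ^+ k - u' ^+ k = l * q.
  move=> eu; elim: k => [|k IH]; first by exists 0; rewrite !expr0 subrr mulr0.
  by rewrite !exprS; apply: congrM.
elim/mpolyind: h => [|a m p _ _ [p' ep]].
  by exists 0; rewrite comp_mpoly0 subrr mulr0.
suff [q eq] : exists q, 'X_[m] - ('X_[m] \mPo t) = l * q.
  exists (a *: q + p'); rewrite comp_mpolyD comp_mpolyZ opprD addrACA ep -scalerBr eq.
  by rewrite mulrDr -scalerAr.
rewrite comp_mpolyX mpolyXE_id.
elim/big_ind2: _ => [|u u' v v'|i _]; [|exact: congrM|exact/congrX].
by exists 0; rewrite subrr mulr0.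
Qed.

End MpolyDivisibility.

Section Freeness.
Variable K : fieldType.
Local Notation S := {mpoly K[3]}.
Variables (f : S) (d1 d2 : nat) (r1 r2 : 'I_3 -> S) (c : K).
Local Notation g := (fun i : 'I_3 => f^`M(i)).
Hypotheses (f_homog : f \is (d1 + d2).+1.-homog) (c_neq0 : c != 0).
Hypotheses (r1_homog : forall i, r1 i \is d1.-homog)
  (r2_homog : forall i, r2 i \is d2.-homog).
Hypothesis cross_r : forall i, cross r1 r2 i = c *: f^`M(i).

(* sigma is the restriction to the line ell = 0, which is identified with P^1 by
   means of the first two coordinates. *)
Variables (k0 k1 : K) (M : nat) (w0 w1 : 'I_3 -> S).
Local Notation lam := (k0 *: 'X_i0 + k1 *: 'X_i1 : S).
Local Notation sigma := (comp_mpoly [tuple 'X_i0; 'X_i1; lam]).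
Local Notation ell := ('X_i2 - lam).
(** Over an algebraically closed field such identities exist for some [M] exactly when the
    restricted gradient has no zero on P^1; in this form the condition can be checked by
    computation. *)
Hypotheses (w0P : dot w0 (sigma \o g) = 'X_i0 ^+ M)
  (w1P : dot w1 (sigma \o g) = 'X_i1 ^+ M).

Lemma sigma_X0 : sigma 'X_i0 = 'X_i0. Proof. by rewrite comp_mpolyXU. Qed.
Lemma sigma_X1 : sigma 'X_i1 = 'X_i1. Proof. by rewrite comp_mpolyXU. Qed.
Lemma sigma_X2 : sigma 'X_i2 = lam. Proof. by rewrite comp_mpolyXU. Qed.

Lemma sigma_lam : sigma lam = lam.
Proof. by rewrite linearD !linearZ /= sigma_X0 sigma_X1. Qed.

Lemma sigma_ell : sigma ell = 0.
Proof. by rewrite rmorphB /= sigma_X2 sigma_lam subrr. Qed.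

Lemma sigma_congr h : exists h', h = sigma h + ell * h'.
Proof.
have [|h' e] := @comp_mpoly_congr _ _ [tuple 'X_i0; 'X_i1; lam] ell _ h.
  by elim/ord3P; [exists 0 | exists 0 | exists 1]; rewrite ?mulr0 ?mulr1 ?subrr.
by exists h'; rewrite -e addrC subrK.
Qed.

Lemma sigma_idem h : sigma (sigma h) = sigma h.
Proof.
by have [h' eh] := sigma_congr h; rewrite [in RHS]eh rmorphD rmorphM /=
  sigma_ell mul0r addr0.
Qed.

Lemma ell_neq0 : ell != 0.
Proof.
apply/eqP => /(congr1 (mcoeff U_(i2)%MM)) /eqP.
rewrite mcoeffB mcoeffD !mcoeffZ !mcoeffXU mcoeff0 /= !mulr0 addr0 subr0.
by rewrite oner_eq0.
Qed.

Lemma ell_homog : ell \is 1.-homog.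
Proof. by rewrite rpredB ?rpredD ?rpredZ // dhomogX /= mdeg1. Qed.

Lemma ell_inj : injective ( *%R ell).
Proof. exact/mulfI/ell_neq0. Qed.

(** A vector is orthogonal to any cross product of which it is a factor, and by [cross_r] this
    product is a nonzero multiple of the gradient. *)
Lemma dot_r1 : dot r1 g = 0.
Proof.
apply: (scalerI c_neq0); rewrite dotE !scalerDr !scalerAr -!cross_r.
by rewrite /cross /vec3 /= scaler0; ring.
Qed.

Lemma dot_r2 : dot r2 g = 0.
Proof.
apply: (scalerI c_neq0); rewrite dotE !scalerDr !scalerAr -!cross_r.
by rewrite /cross /vec3 /= scaler0; ring.
Qed.

Lemma sigma_cross i :
  cross (sigma \o r1) (sigma \o r2) i = c%:MP * sigma (f^`M(i)).
Proof. by rewrite -rmorph_cross cross_r /= comp_mpolyZ mul_mpolyC. Qed.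

Lemma dot_sigma_cross w :
  dot w (cross (sigma \o r1) (sigma \o r2)) = c%:MP * dot w (sigma \o g).
Proof. by rewrite !dotE !sigma_cross /=; ring. Qed.

(* Cramer's rule, with w, r1, r2 as the rows. *)
Lemma sigma_cramer w a i : dot a (sigma \o g) = 0 ->
  c%:MP * dot w (sigma \o g) * a i =
    dot w (cross a (sigma \o r2)) * sigma (r1 i) +
    dot w (cross (sigma \o r1) a) * sigma (r2 i).
Proof.
move=> a_syz; have := cramer3 w a (sigma \o r1) (sigma \o r2) i.
by rewrite !dot_sigma_cross a_syz mulr0 mul0r add0r.
Qed.

Lemma gradient_sigma_neq0 : exists i, sigma (f^`M(i)) != 0.
Proof.
apply/existsP; apply: contraT; rewrite negb_exists => /forallP z.
move/eqP: (w0P); rewrite dotE /=.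
rewrite !(eqP (negbNE (z _))) !mulr0 !addr0 eq_sym expf_eq0.
by rewrite -msize_poly_eq0 msizeX andbF.
Qed.

Lemma gradient_neq0 : exists i, f^`M(i) != 0.
Proof.
have [i nz] := gradient_sigma_neq0; exists i.
by apply: contraNneq nz => ->; rewrite comp_mpoly0.
Qed.

Lemma r_indep u v : (forall i, u * r1 i + v * r2 i = 0) -> u = 0 /\ v = 0.
Proof.
have [i nz] := gradient_neq0; apply: (@cross_indep _ _ _ _ _ i).
by rewrite cross_r scaler_eq0 negb_or c_neq0.
Qed.

Lemma sigma_r_indep u v :
  (forall i, u * sigma (r1 i) + v * sigma (r2 i) = 0) -> u = 0 /\ v = 0.
Proof.
have [i nz] := gradient_sigma_neq0.
apply: (@cross_indep _ (sigma \o r1) (sigma \o r2) _ _ i).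
by rewrite sigma_cross mulf_neq0 ?mpolyC_eq0.
Qed.

Lemma sigma_syzygy a : dot a (sigma \o g) = 0 ->
  exists v1 v2, forall i, a i = v1 * sigma (r1 i) + v2 * sigma (r2 i).
Proof.
move=> a_syz.
have cr w i := sigma_cramer w i a_syz.
have e0 i := cr w0 i; have e1 i := cr w1 i; rewrite w0P in e0; rewrite w1P in e1.
move: e0 e1; set u1 := dot w0 _; set u2 := dot w0 _.
set u1' := dot w1 _; set u2' := dot w1 _.
clearbody u1 u2 u1' u2' => e0 e1.
have neq10 : i1 != i0 by [].
(* Cramer's rule with [w0] and with [w1] gives two expressions for c x^M y^M a. The restrictions of
   [r1] and [r2] are independent, so the coefficients agree; hence x^M divides [u1] and [u2] and can
   be cancelled. *)
have [/subr0_eq eu1 /subr0_eq eu2] : 'X_i1 ^+ M * u1 - 'X_i0 ^+ M * u1' = 0 /\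
    'X_i1 ^+ M * u2 - 'X_i0 ^+ M * u2' = 0.
  apply: sigma_r_indep => i.
  transitivity ('X_i1 ^+ M * (c%:MP * 'X_i0 ^+ M * a i) -
                'X_i0 ^+ M * (c%:MP * 'X_i1 ^+ M * a i)); last by ring.
  by rewrite e0 e1; ring.
have [v1 ev1] := mpolyXn_coprime neq10 eu1.
have [v2 ev2] := mpolyXn_coprime neq10 eu2.
exists (c^-1 *: v1), (c^-1 *: v2) => i.
have Xnz : 'X_i0 ^+ M != 0 :> S.
  by rewrite expf_neq0 // -msize_poly_eq0 msizeX.
apply: (mulfI Xnz); apply: (scalerI c_neq0).
have := e0 i; rewrite -mulrA mul_mpolyC => ->; rewrite ev1 ev2.
by rewrite -!scalerAl -scalerDr -scalerAr scalerA divff // scale1r; ring.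
Qed.

(** One statement for two uses: h = 0 drives the induction on the degree of a syzygy, and arbitrary
    [h] shows that [ell] is a nonzerodivisor modulo the Jacobian ideal. *)
Lemma ell_syzygy a h : dot a g = ell * h -> exists v1 v2 b,
  (forall i, a i = v1 * r1 i + v2 * r2 i + ell * b i) /\ dot b g = h.
Proof.
move=> e; have := congr1 sigma e.
rewrite rmorph_dot rmorphM /= sigma_ell mul0r => /sigma_syzygy[v1 [v2 ev]].
(* The equation is boolean so that [xchoose] can select the quotients. As [v1] and [v2] may involve
   the third variable, they are first replaced by their restrictions, which changes the combination
   by a multiple of [ell]. *)
have eb i : exists b, a i - (v1 * r1 i + v2 * r2 i) == ell * b.
  have [b eb] := sigma_congr (a i - (sigma v1 * r1 i + sigma v2 * r2 i)).
  have [q1 eq1] := sigma_congr v1; have [q2 eq2] := sigma_congr v2.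
  have s0 : sigma (a i - (sigma v1 * r1 i + sigma v2 * r2 i)) = 0.
    rewrite !(rmorphB, rmorphD, rmorphM) /= !sigma_idem -[sigma (a i)]sigma_idem.
    by rewrite -[sigma (a i)]/((sigma \o a) i) ev rmorphD !rmorphM /= !sigma_idem subrr.
  exists (b - q1 * r1 i - q2 * r2 i); apply/eqP; move: eb; rewrite s0 add0r.
  by rewrite {2}eq1 {2}eq2 !mulrBr => <-; ring.
pose b i := xchoose (eb i).
have ab i : a i = v1 * r1 i + v2 * r2 i + ell * b i.
  by rewrite -(eqP (xchooseP (eb i))) addrC subrK.
exists v1, v2, b; split=> //; apply: ell_inj; rewrite -e.
have -> : dot a g = v1 * dot r1 g + v2 * dot r2 g + ell * dot b g.
  by rewrite !dotE !ab; ring.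
by rewrite dot_r1 dot_r2 !mulr0 !add0r.
Qed.

Lemma jacobianE h : jacobian_ideal f h <-> exists a, h = dot a g.
Proof. by split=> -[a]; exists a. Qed.

Lemma jacobianD h h' : jacobian_ideal f h -> jacobian_ideal f h' ->
  jacobian_ideal f (h + h').
Proof.
move=> /jacobianE[a ->] /jacobianE[a' ->]; apply/jacobianE.
by exists (fun i => a i + a' i); rewrite !dotE; ring.
Qed.

Lemma jacobianM q h : jacobian_ideal f h -> jacobian_ideal f (q * h).
Proof.
move=> /jacobianE[a ->]; apply/jacobianE.
by exists (fun i => q * a i); rewrite !dotE; ring.
Qed.

Lemma jacobian_ell h : jacobian_ideal f (ell * h) -> jacobian_ideal f h.
Proof.
move=> /jacobianE[a /esym e]; have [_ [_ [b [_ eb]]]] := ell_syzygy e.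
by apply/jacobianE; exists b.
Qed.

(** If all the monomials of degree N + 1 multiply [h] into the ideal, so does [ell] times any
    monomial of degree N, because [ell] is a linear form; then [ell] cancels, which lowers N. *)
Lemma saturated : free_curve f.
Proof.
move=> h N; elim: N => [|N IH] hm.
  by have := hm 0%MM mdeg0; rewrite mpolyX0 mul1r.
apply: IH => m dm; apply: jacobian_ell.
have jX i : jacobian_ideal f ('X_i * ('X_[m] * h)).
  by rewrite mulrA -mpolyXD; apply: hm; rewrite mdegD mdeg1 dm.
rewrite mulrBl mulrDl -!mul_mpolyC -!mulrA opprD -!mulNr.
by apply: jacobianD => //; apply: jacobianD; apply: jacobianM.
Qed.

(** The clause for q < d is carried along to [homog_syzygy], where it makes both coefficients vanish
    in degrees below [d1]; this gives [mdr_eq]. *)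
Lemma pihomog_quot q d v : exists v', ((q < d)%N -> v' = 0) /\
  forall r : S, r \is d.-homog -> pihomog mdeg q (v * r) = v' * r.
Proof.
case: (ltnP q d) => [lt_qd|le_dq].
  by exists 0; split=> // r hr; rewrite (pihomogM0 _ hr) // mul0r.
by exists (pihomog mdeg (q - d) v); split=> // r hr; rewrite -{1}(subnK le_dq) pihomogM.
Qed.

Lemma homog_ell_syzygy q a : dot a g = 0 -> (forall i, a i \is q.-homog) ->
  exists v1 v2 b, [/\ forall i, a i = v1 * r1 i + v2 * r2 i +
      pihomog mdeg q (b i * ell),
    (q < d1)%N -> v1 = 0 & (q < d2)%N -> v2 = 0].
Proof.
move=> a_syz a_homog; have := a_syz.
rewrite -[RHS](mulr0 ell) => /ell_syzygy[v1 [v2 [b [ea _]]]].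
have [v1' [v10 ev1]] := pihomog_quot q d1 v1.
have [v2' [v20 ev2]] := pihomog_quot q d2 v2.
exists v1', v2', b; split=> // i; rewrite -ev1 // -ev2 //.
rewrite -[LHS](pihomog_dE (a_homog i)) ea [b i * _]mulrC.
by rewrite !raddfD.
Qed.

Lemma homog_syzygy q a : dot a g = 0 -> (forall i, a i \is q.-homog) ->
  exists v1 v2, [/\ forall i, a i = v1 * r1 i + v2 * r2 i,
    (q < d1)%N -> v1 = 0 & (q < d2)%N -> v2 = 0].
Proof.
elim: q a => [|q IH] a a_syz a_homog.
  have [v1 [v2 [b [ea v10 v20]]]] := homog_ell_syzygy a_syz a_homog.
  exists v1, v2; split=> // i.
  by rewrite ea (pihomogM0 _ ell_homog) // addr0.
have [v1' [v2' [b [ea v10 v20]]]] := homog_ell_syzygy a_syz a_homog.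
pose b' i := pihomog mdeg q (b i).
have eab i : a i = v1' * r1 i + v2' * r2 i + ell * b' i.
  by rewrite ea [ell * _]mulrC -(addn1 q) (pihomogM _ _ ell_homog).
have b'_syz : dot b' g = 0.
  apply: ell_inj; rewrite mulr0 -a_syz.
  have -> : dot a g = v1' * dot r1 g + v2' * dot r2 g + ell * dot b' g.
    by rewrite !dotE !eab; ring.
  by rewrite dot_r1 dot_r2 !mulr0 !add0r.
have [u1 [u2 [eu u10 u20]]] := IH b' b'_syz (fun i => pihomogP mdeg q (b i)).
exists (v1' + ell * u1), (v2' + ell * u2); split=> [i|lt_q|lt_q].
- by rewrite eab eu; ring.
- by rewrite v10 // u10 ?mulr0 ?addr0 // (ltn_trans (ltnSn q)).
- by rewrite v20 // u20 ?mulr0 ?addr0 // (ltn_trans (ltnSn q)).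
Qed.

(** The partials of [f] all have degree d1 + d2, so the homogeneous components of a syzygy are again
    syzygies. *)
Lemma syzygy_span a : dot a g = 0 ->
  exists v1 v2, forall i, a i = v1 * r1 i + v2 * r2 i.
Proof.
move=> a_syz; pose pi k i := pihomog mdeg k (a i).
have [N leN] : exists N, forall i, (msize (a i) <= N)%N.
  exists (\max_i msize (a i)) => i; exact: leq_bigmax.
suff [v1 [v2 e]] : exists v1 v2, forall i, \sum_(k < N) pi k i = v1 * r1 i + v2 * r2 i.
  by exists v1, v2 => i; rewrite -e; apply: pihomog_partitionE.
elim: N {leN} => [|N [v1 [v2 e]]].
  by exists 0, 0 => i; rewrite big_ord0 !mul0r addr0.
have pi_syz : dot (pi N) g = 0.
  have g_homog i : f^`M(i) \is (d1 + d2).-homog by apply: mderiv_homog.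
  have := congr1 (pihomog mdeg (N + (d1 + d2))) a_syz.
  by rewrite !dotE !linearD linear0 /= !pihomogM.
have [u1 [u2 [eu _ _]]] := homog_syzygy pi_syz (fun i => pihomogP mdeg N (a i)).
exists (v1 + u1), (v2 + u2) => i.
by rewrite big_ord_recr /= e eu; ring.
Qed.

Hypothesis le_d : (d1 <= d2)%N.

Lemma syzygy_dot (a : 'rV[S]_3) : syzygy f a <-> dot (a 0) g = 0.
Proof. by []. Qed.

Lemma r1_row_neq0 : \row_i r1 i != 0.
Proof.
apply/eqP => /rowP r10; have [i nz] := gradient_neq0.
move/negP: nz; apply; rewrite -[_ == 0]orFb -(negPf c_neq0) -scaler_eq0 -cross_r.
have e j : r1 j = 0 by have := r10 j; rewrite !mxE.
by elim/ord3P: i; rewrite /cross /vec3 /= !e !mul0r subr0.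
Qed.

Lemma mdr_eq : is_mdr f d1.
Proof.
split=> [|q lt_q a [/syzygy_dot a_syz a_homog]].
  exists (\row_i r1 i); last exact: r1_row_neq0.
  split=> [|i]; last by rewrite mxE.
  by apply/syzygy_dot; rewrite -[RHS]dot_r1; apply: eq_bigr => i _; rewrite mxE.
have [v1 [v2 [ea v10 v20]]] := homog_syzygy a_syz a_homog.
apply/rowP => i; rewrite ea v10 // v20 ?(leq_trans lt_q) //.
by rewrite !mul0r addr0 mxE.
Qed.

Lemma homog_neq0_deg d (p : S) : p != 0 -> p \is d.-homog -> deg p = d.
Proof.
by move=> nz hp; rewrite /deg; apply/esym/(dhomog_uniq nz hp)/(dhomog_msize hp).
Qed.

Lemma f_neq0 : f != 0.
Proof.
have [i nz] := gradient_neq0; apply: contraNneq nz => ->.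
by rewrite mderiv0.
Qed.

Lemma free_of_cross : free_with_exponents f d1 d2.
Proof.
split; [exact: saturated | exact: mdr_eq | | ].
  by rewrite (homog_neq0_deg f_neq0 f_homog) subn1 addKn.
exists (\row_i r1 i), (\row_i r2 i); split.
- split=> [|i]; last by rewrite mxE.
  by apply/syzygy_dot; rewrite -[RHS]dot_r1; apply: eq_bigr => i _; rewrite mxE.
- split=> [|i]; last by rewrite mxE.
  by apply/syzygy_dot; rewrite -[RHS]dot_r2; apply: eq_bigr => i _; rewrite mxE.
move=> a /syzygy_dot /syzygy_span[v1 [v2 ea]].
exists (v1, v2); split=> [|[u1 u2] /rowP eu].
  by apply/rowP => i; rewrite !mxE ea.
have [|/subr0_eq -> /subr0_eq -> //] := @r_indep (v1 - u1) (v2 - u2).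
move=> i; have := eu i; rewrite !mxE ea /= => e.
transitivity (v1 * r1 i + v2 * r2 i - (u1 * r1 i + u2 * r2 i)); first by ring.
by rewrite e subrr.
Qed.

End Freeness.

(** * The degree of the Jacobian scheme from the free resolution *)

Section JacobianDegree.
Variable K : fieldType.
Local Notation S := {mpoly K[3]}.
Local Notation H d := (dhomog 3 K d).

Lemma dim_dhomog n d : dim (dhomog n.+1 K d) = 'C(d + n, d).
Proof. by []. Qed.

Variables (f : S) (d1 d2 : nat) (r1 r2 : 'I_3 -> S).
Local Notation g := (fun i : 'I_3 => f^`M(i)).
Local Notation e := (d1 + d2)%N.
Hypothesis f_homog : f \is e.+1.-homog.
Hypotheses (r1_homog : forall i, r1 i \is d1.-homog)
  (r2_homog : forall i, r2 i \is d2.-homog).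
Hypotheses (r1_syz : dot r1 g = 0) (r2_syz : dot r2 g = 0).
Hypothesis r_span : forall a, dot a g = 0 ->
  exists v1 v2, forall i, a i = v1 * r1 i + v2 * r2 i.
Hypothesis r_free :
  forall u v, (forall i, u * r1 i + v * r2 i = 0) -> u = 0 /\ v = 0.

Lemma g_homog i : f^`M(i) \is e.-homog.
Proof. exact: mderiv_homog. Qed.

Section Degree.
Variable j : nat.
Local Notation V := (H (j + e) * H (j + e) * H (j + e))%type.
Local Notation T := (H (j + d2) * H (j + d1))%type.

Definition triple (u : V) : 'I_3 -> S := vec3 (val u.1.1) (val u.1.2) (val u.2).

Lemma triple_homog u i : triple u i \is (j + e).-homog.
Proof. by elim/ord3P: i; apply: dhomog_is_dhomog. Qed.

Lemma triple_inj u v : triple u =1 triple v -> u = v.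
Proof.
case: u v => [[u0 u1] u2] [[v0 v1] v2] e.
by congr (_, _, _); apply: val_inj; [have := e i0|have := e i1|have := e i2].
Qed.

Fact gen_subproof (u : V) : dot (triple u) g \is (j + e + e).-homog.
Proof. by rewrite rpred_sum // => i _; apply: dhomogM; [exact: triple_homog|exact: g_homog]. Qed.

Definition gen (u : V) : H (j + e + e) := DHomog (gen_subproof u).

Lemma triple_linear c u v i : triple (c *: u + v) i = c *: triple u i + triple v i.
Proof. by elim/ord3P: i. Qed.

Fact gen_linear : linear gen.
Proof.
move=> c u v; apply: val_inj; rewrite linearD linearZ /=.
by rewrite !dotE !triple_linear -!mul_mpolyC; ring.
Qed.
HB.instance Definition _ := GRing.isLinear.Build K V (H (j + e + e)) _ gen gen_linear.

Definition genf : 'Hom(V, H (j + e + e)) := linfun gen.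
Lemma genfE u : genf u = gen u. Proof. exact: lfunE. Qed.

Fact lincomb_subproof (t : T) i : val t.1 * r1 i + val t.2 * r2 i \is (j + e).-homog.
Proof.
rewrite rpredD //.
  by rewrite [e]addnC addnA; apply: dhomogM; [exact: dhomog_is_dhomog|].
by rewrite addnA; apply: dhomogM; [exact: dhomog_is_dhomog|].
Qed.

(** With [gen] this forms the exact sequence 0 -> T -> V -> (forms of degree j + 2e), whose cokernel
    is the wanted graded piece. The coefficient of [r1] has degree (j + e) - d1 = j + d2, and
    symmetrically for [r2]. *)
Definition lincomb (t : T) : V :=
  (DHomog (lincomb_subproof t i0), DHomog (lincomb_subproof t i1), DHomog (lincomb_subproof t i2)).

Lemma triple_lincomb t i : triple (lincomb t) i = val t.1 * r1 i + val t.2 * r2 i.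
Proof. by elim/ord3P: i. Qed.

Fact lincomb_linear : linear lincomb.
Proof.
move=> c u v; apply: triple_inj => i; rewrite triple_linear !triple_lincomb.
by rewrite [(c *: u + v).1]/= !linearD !linearZ /= -!mul_mpolyC; ring.
Qed.
HB.instance Definition _ := GRing.isLinear.Build K T V _ lincomb lincomb_linear.

Definition lincombf : 'Hom(T, V) := linfun lincomb.
Lemma lincombfE t : lincombf t = lincomb t. Proof. exact: lfunE. Qed.

Lemma ker_gen : lker genf = limg lincombf.
Proof.
apply/vspaceP => u; rewrite memv_ker genfE.
apply/eqP/memv_imgP => [/(congr1 val) /= u_syz | [t _ ->]].
  have [v1 [v2 ev]] := r_span u_syz.
  pose p1 := pihomog mdeg (j + d2) v1; pose p2 := pihomog mdeg (j + d1) v2.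
  have hp1 : p1 \is (j + d2).-homog by exact: pihomogP.
  have hp2 : p2 \is (j + d1).-homog by exact: pihomogP.
  exists (DHomog hp1, DHomog hp2); first exact: memvf.
  have eu i : triple u i = p1 * r1 i + p2 * r2 i.
    rewrite -[LHS](pihomog_dE (triple_homog u i)) ev linearD /=.
    rewrite {1}[e]addnC addnA (pihomogM _ _ (r1_homog i)).
    by rewrite addnA (pihomogM _ _ (r2_homog i)).
  by rewrite lincombfE; apply: triple_inj => i; rewrite eu triple_lincomb.
apply: val_inj; rewrite lincombfE /= dotE !triple_lincomb.
transitivity (val t.1 * dot r1 g + val t.2 * dot r2 g); first by rewrite !dotE; ring.
by rewrite r1_syz r2_syz !mulr0 addr0.
Qed.

Lemma lincomb_inj : lker lincombf == 0%VS.
Proof.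
apply/lker0P => t t'; rewrite !lincombfE => ett.
have [i|/subr0_eq et1 /subr0_eq et2] :=
    @r_free (val t.1 - val t'.1) (val t.2 - val t'.2).
  transitivity (triple (lincomb t) i - triple (lincomb t') i); last by rewrite ett subrr.
  by rewrite !triple_lincomb; ring.
by case: t t' et1 et2 {ett} => [t1 t2] [t1' t2'] /= /val_inj-> /val_inj->.
Qed.

Lemma dim_gen :
  (\dim (limg genf) + 'C(j + d2 + 2, j + d2) + 'C(j + d1 + 2, j + d1) =
   3 * 'C(j + e + 2, j + e))%N.
Proof.
have := limg_ker_dim genf fullv; rewrite capfv ker_gen.
rewrite limg_dim_eq; last by rewrite (eqP lincomb_inj) capv0.
rewrite !dimvf -[dim V]/(_ + _ + _)%N -[dim T]/(_ + _)%N !dim_dhomog.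
lia.
Qed.

Lemma jacobian_gen (h : H (j + e + e)) :
  jacobian_ideal f (val h) <-> h \in limg genf.
Proof.
split=> [[a eh]|/memv_imgP[u _ ->]]; last by rewrite genfE; exists (triple u).
have hp i : pihomog mdeg (j + e) (a i) \is (j + e).-homog by exact: pihomogP.
apply/memv_imgP; exists (DHomog (hp i0), DHomog (hp i1), DHomog (hp i2)).
  exact: memvf.
apply: val_inj; rewrite genfE /= -[LHS](pihomog_dE (valP h)) eh.
rewrite sum3 !linearD /= dotE /triple /=.
by rewrite !(pihomogM _ _ (g_homog _)).
Qed.

End Degree.

Lemma bin2S n : 'C(n + 2, n) = 'C(n + 2, 2).
Proof. by rewrite -bin_sub ?leq_addr // addKn. Qed.

Lemma deg_jacobian_of_basis : deg_jacobian f (e ^ 2 - d1 * d2).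
Proof.
exists (e + e)%N => k le_k; rewrite -(subnK le_k) addnA; move: (k - _)%N => j.
pose W := ((limg (genf j))^C)%VS.
have dimW : \dim W = (e ^ 2 - d1 * d2)%N.
  rewrite dimv_compl dimvf dim_dhomog; have := dim_gen j.
  (* Doubled, the binomial coefficients become quadratic polynomials, and [j] cancels in the
     alternating sum of dimensions. *)
  have bin2E n : ('C(n + 2, n) * 2 = (n + 2) * (n + 1))%N.
    by rewrite bin2S -[2%N in RHS]/(2`!) bin_ffact addn2 addn1 !ffactSS ffactn0 muln1.
  have := bin2E (j + e + e)%N; have := bin2E (j + d1)%N.
  have := bin2E (j + d2)%N; have := bin2E (j + e)%N.
  (* Writing e^2 with d1 d2 as a summand removes the truncated subtraction. *)
  have -> : (e ^ 2 = d1 * d2 + (d1 * d1 + d2 * d2 + d1 * d2))%N by lia.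
  rewrite addKn.
  move: 'C(_, _) 'C(_, _) 'C(_, _) 'C(_, _) (\dim _ : nat) => x1 x2 x3 x4 x5; lia.
rewrite -dimW; exists (fun i => val (vbasis W)`_i); split=> [i|p hp|c jc].
- exact: dhomog_is_dhomog.
- have := memvf (DHomog hp); rewrite -(addv_complf (limg (genf j))).
  case/memv_addP => u u_in [w w_in ep].
  exists (fun i => coord (vbasis W) i w).
  have -> : p = val u + \sum_i coord (vbasis W) i w *: val (vbasis W)`_i.
    rewrite -[p]/(val (DHomog hp)) ep {1}(coord_vbasis w_in) linearD linear_sum.
    by congr (_ + _); apply: eq_bigr => i _; rewrite linearZ.
  rewrite addrK.
  exact/jacobian_gen.
have hW : \sum_i c i *: (vbasis W)`_i = 0.
  apply/eqP; rewrite -memv0 -(capv_compl (limg (genf j))).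
  rewrite memv_cap; apply/andP; split.
    by apply/jacobian_gen; rewrite linear_sum.
  by rewrite memv_suml // => i _; rewrite memvZ // vbasis_mem // mem_nth ?size_tuple.
exact: (elimT (@freeP _ _ _ (vbasis W)) (basis_free (vbasisP W)) c hW).
Qed.

End JacobianDegree.

Lemma deg_jacobian_free (K : fieldType) (f : {mpoly K[3]}) d1 d2 :
  f \is (d1 + d2).+1.-homog -> free_with_exponents f d1 d2 ->
  deg_jacobian f ((d1 + d2) ^ 2 - d1 * d2).
Proof.
move=> f_homog [_ _ _ [r1 [r2 [[r1_syz r1_homog] [r2_syz r2_homog] uniq_r]]]].
apply: (@deg_jacobian_of_basis _ _ _ _ (r1 0) (r2 0)) => // [a a_syz|u v e].
  have a_syz' : syzygy f (\row_i a i).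
    by rewrite /syzygy -[RHS]a_syz; apply: eq_bigr => i _; rewrite mxE.
  have [[v1 v2] [/rowP ea _]] := uniq_r _ a_syz'.
  by exists v1, v2 => i; have := ea i; rewrite !mxE.
have z_syz : syzygy f 0 by rewrite /syzygy big1 // => i _; rewrite mxE mul0r.
have [w [_ uw]] := uniq_r _ z_syz.
have e0 : w = (0, 0) by apply: uw; rewrite /= !scale0r addr0.
have : w = (u, v) by apply: uw; apply/rowP => i; rewrite !mxE e.
by rewrite e0 => -[<- <-].
Qed.

(** * Binary forms *)

Section OrderOfVanishing.
Variables (n : nat) (K : fieldType).
Local Notation S := {mpoly K[n]}.
Implicit Types (p q h : S) (m : 'X_{1..n}) (k l d : nat).

(** Membership in the k-th power of the maximal ideal of the origin, read off the coefficients. *)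
Definition in_mpow k h : Prop := forall m, (mdeg m < k)%N -> h@_m = 0.

Lemma mpow_le k l h : (l <= k)%N -> in_mpow k h -> in_mpow l h.
Proof. by move=> le_lk hk m lt_m; apply: hk; apply: leq_trans le_lk. Qed.

Lemma mpowD k p q : in_mpow k p -> in_mpow k q -> in_mpow k (p + q).
Proof. by move=> hp hq m lt_m; rewrite mcoeffD hp // hq // addr0. Qed.

Lemma mpowN k p : in_mpow k p -> in_mpow k (- p).
Proof. by move=> hp m lt_m; rewrite mcoeffN hp // oppr0. Qed.

Lemma mpowB k p q : in_mpow k p -> in_mpow k q -> in_mpow k (p - q).
Proof. by move=> hp hq; apply: mpowD => //; apply: mpowN. Qed.

Lemma mpowZ k c p : in_mpow k p -> in_mpow k (c *: p).
Proof. by move=> hp m lt_m; rewrite mcoeffZ hp // mulr0. Qed.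

Lemma mpowM k l p q : in_mpow k p -> in_mpow l q -> in_mpow (k + l) (p * q).
Proof.
move=> hp hq m lt_m; rewrite (mcoeff_poly_mul p q (leqnn _)) big1 // => -[m1 m2] /= /eqP em.
have [lt1|le1] := ltnP (mdeg m1) k; first by rewrite hp ?mul0r.
have lt12 : (mdeg m1 + mdeg m2 < k + l)%N by rewrite -mdegD -em.
rewrite hq ?mulr0 // -(ltn_add2l k) (leq_ltn_trans _ lt12) //.
by rewrite leq_add2r.
Qed.

Lemma mpowMl k p q : in_mpow k q -> in_mpow k (p * q).
Proof. by move=> hq; rewrite -[k]add0n; apply: mpowM. Qed.

Lemma mpowX k l p : in_mpow k p -> in_mpow (k * l) (p ^+ l).
Proof.
move=> hp; elim: l => [|l IH]; first by rewrite muln0.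
by rewrite exprS mulnS; apply: mpowM.
Qed.

Lemma mpow_homog d p : p \is d.-homog -> in_mpow d p.
Proof.
move=> hp m lt_m; apply: (dhomog_nemf_coeff hp).
by rewrite neq_ltn lt_m.
Qed.

Lemma homog_mpow0 d p : p \is d.-homog -> in_mpow d.+1 p -> p = 0.
Proof.
move=> hp hd; apply/mpolyP => m; rewrite mcoeff0.
have [e|ne] := eqVneq (mdeg m) d; last exact: (dhomog_nemf_coeff hp).
by apply: hd; rewrite e.
Qed.

Lemma mpow_pihomog k p : in_mpow k p -> in_mpow k.+1 (p - pihomog mdeg k p).
Proof.
move=> hp m; rewrite ltnS leq_eqVlt mcoeffB mcoeff_pihomog.
by case: eqP => [_ _|_ /= lt_m]; rewrite ?subrr // subr0 hp.
Qed.

Lemma mpow_mderiv k i p : in_mpow k.+1 p -> in_mpow k (p^`M(i)).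
Proof. by move=> hp m lt_m; rewrite mcoeff_deriv hp ?mul0rn // mdegD mdeg1 addn1. Qed.

Lemma meval_mcoeff0 p : p.@[fun=> 0] = p@_0%MM.
Proof.
elim/mpolyind: p => [|c m p _ _ IH]; first by rewrite meval0 mcoeff0.
rewrite mevalD mevalZ mcoeffD mcoeffZ IH mevalX mcoeffX; congr (_ * _ + _).
case: eqP => [->|/eqP nz]; first by rewrite big1 // => i _; rewrite mnm0E.
have [i nzi] : exists i, m i != 0%N.
  apply/existsP; apply: contraNT nz; rewrite negb_exists => /forallP z.
  by apply/eqP/mnmP => i; rewrite mnm0E; apply/eqP; rewrite -[_ == _]negbK z.
by rewrite (bigD1 i) //= expr0n (negPf nzi) mul0r.
Qed.

Lemma mpow1 p : p.@[fun=> 0] = 0 -> in_mpow 1 p.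
Proof.
by rewrite meval_mcoeff0 => p0 m; rewrite ltnS leqn0 mdeg_eq0 => /eqP ->.
Qed.

(** Truncated geometric series: p = c (1 - x) with x vanishing at the origin. *)
Lemma inv_mod_mpow k p : p.@[fun=> 0] != 0 -> exists q, in_mpow k (p * q - 1).
Proof.
set c := p.@[_] => nz; pose x : S := 1 - c^-1 *: p.
have x1 : in_mpow 1 x.
  by apply: mpow1; rewrite mevalB meval1 mevalZ mulVf ?subrr.
exists (c^-1 *: \sum_(i < k) x ^+ i).
have -> : p * (c^-1 *: \sum_(i < k) x ^+ i) - 1 = - x ^+ k.
  have ex : x - 1 = - (c^-1 *: p) by rewrite addrAC subrr add0r.
  transitivity (- (x ^+ k - 1) - 1); last by rewrite opprB addrAC subrr add0r.
  by rewrite subrX1 ex mulNr opprK -scalerAr scalerAl.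
by apply: mpowN; have := @mpowX 1 k x x1; rewrite mul1n.
Qed.

Lemma mnm_sub_deg m k : (k <= mdeg m)%N -> exists2 m', (m' <= m)%MM & mdeg m' = k.
Proof.
elim: k => [|k IH] le_km.
  by exists 0%MM; rewrite ?mdeg0 //; apply/mnm_lepP => i; rewrite mnm0E.
have [m' le_m' dm'] := IH (ltnW le_km).
have : (m - m')%MM != 0%MM.
  apply: contraTneq le_km => e; rewrite -(submK le_m') e mdegD mdeg0 dm'.
  by rewrite add0n ltnn.
rewrite -mdeg_eq0 => nz.
have [i nzi] : exists i, (m - m')%MM i != 0%N.
  apply/existsP; apply: contraNT nz; rewrite negb_exists => /forallP z.
  by rewrite mdegE big1 // => i _; apply/eqP; rewrite -[_ == _]negbK z.
exists (m' + U_(i))%MM; last by rewrite mdegD dm' mdeg1 addn1.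
apply/mnm_lepP => j; rewrite mnmDE mnm1E; move/mnm_lepP/(_ j): le_m'.
case: eqP => [<-|_]; last by rewrite addn0.
by move: nzi; rewrite mnmBE subn_eq0 -ltnNge addn1.
Qed.

Lemma mpow_ind k (Q : S -> Prop) :
    Q 0 -> (forall p q, Q p -> Q q -> Q (p + q)) -> (forall p q, Q q -> Q (p * q)) ->
    (forall m, mdeg m = k -> Q 'X_[m]) ->
  forall h, in_mpow k h -> Q h.
Proof.
move=> Q0 QD QM QX h hk; rewrite [h]mpolyE big_seq_cond.
elim/big_ind: _ => // m; rewrite andbT mcoeff_msupp => nz.
have [|m' le_m dm] := @mnm_sub_deg m k.
  by rewrite leqNgt; apply: contraNN nz => /hk ->.
by rewrite -(submK le_m) mpolyXD scalerAl; apply: QM; apply: QX.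
Qed.

Lemma meval_homog d p (c : K) (v : 'I_n -> K) : p \is d.-homog ->
  p.@[fun i => c * v i] = c ^+ d * p.@[v].
Proof.
move=> hp; rewrite !mevalE mulr_sumr; apply: eq_big_seq => m m_in.
rewrite mulrCA; congr (_ * _).
rewrite (eq_bigr (fun i => c ^+ m i * v i ^+ m i)); last by move=> i _; rewrite exprMn.
by rewrite big_split /= prodrXr -mdegE (dhomogP _ _ _ hp _ m_in).
Qed.

Lemma comp_mpoly_homog d p (v : 'I_n -> K) (z : S) : p \is d.-homog ->
  (p \mPo [tuple v i *: z | i < n]) = p.@[v] *: z ^+ d.
Proof.
move=> hp; rewrite comp_mpolyE mevalE scaler_suml; apply: eq_big_seq => m m_in.
rewrite -scalerA; congr (_ *: _).
rewrite (eq_bigr (fun i => (v i ^+ m i)%:MP * z ^+ m i)); last first.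
  by move=> i _; rewrite tnth_mktuple -mul_mpolyC exprMn -rmorphXn.
rewrite big_split /= prodrXr -mdegE (dhomogP _ _ _ hp _ m_in).
by rewrite -rmorph_prod mul_mpolyC.
Qed.

Lemma euler_homog d p : p \is d.-homog -> \sum_(i < n) 'X_i * p^`M(i) = d%:R *: p.
Proof.
move=> hp; rewrite {2}[p]mpolyE scaler_sumr.
transitivity (\sum_(i < n) \sum_(m <- msupp p) (p@_m * (m i)%:R) *: 'X_[m]).
  apply: eq_bigr => i _; rewrite {1}[p]mpolyE linear_sum mulr_sumr /=.
  apply: eq_bigr => m _; rewrite mderivZ mderivX -!scalerAr scalerA.
  case: (eqVneq (m i) 0%N) => [->|nz]; first by rewrite !mulr0 !scale0r.
  rewrite -mpolyXD addmC submK //.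
  by apply/mnm_lepP => j; rewrite mnm1E; case: eqP => [<-|//]; rewrite lt0n.
rewrite exchange_big /=; apply: eq_big_seq => m m_in.
rewrite -scaler_suml -mulr_sumr -natr_sum -mdegE (dhomogP _ _ _ hp _ m_in).
by rewrite scalerA mulrC.
Qed.

End OrderOfVanishing.

Definition j0 : 'I_2 := @Ordinal 2 0 isT.
Definition j1 : 'I_2 := @Ordinal 2 1 isT.

Lemma ord2P (P : 'I_2 -> Prop) : P j0 -> P j1 -> forall i, P i.
Proof.
by move=> p0 p1 [[|[|//]] lt_i]; [move: p0 | move: p1]; congr P; apply: val_inj.
Qed.

Lemma sum2 (V : nmodType) (F : 'I_2 -> V) : \sum_(i < 2) F i = F j0 + F j1.
Proof.
by rewrite !big_ord_recr big_ord0 /= add0r; congr (F _ + F _); apply: val_inj.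
Qed.

Section BinaryForms.
Variable K : numFieldType.
Local Notation S := {mpoly K[2]}.
Implicit Types (s t w : K * K) (P Q : S).

Definition det2 s t : K := s.1 * t.2 - s.2 * t.1.
Definition pt t : 'I_2 -> K := fun i => if i == j0 then t.1 else t.2.
Definition lf t : S := t.1 *: 'X_j0 + t.2 *: 'X_j1.

(* The zero of the linear form lf t on P^1. *)
Definition zero_of t : K * K := (t.2, - t.1).

Lemma lf_homog t : lf t \is 1.-homog.
Proof. by rewrite rpredD ?rpredZ // dhomogX /= mdeg1. Qed.

Lemma meval_lf t w : (lf t).@[pt w] = t.1 * w.1 + t.2 * w.2.
Proof. by rewrite mevalD !mevalZ !mevalXU. Qed.

Lemma form_dvd d Q w : (w.1 != 0) || (w.2 != 0) -> Q \is d.+1.-homog ->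
  Q.@[pt w] = 0 -> exists2 Q', Q' \is d.-homog & Q = lf (zero_of w) * Q'.
Proof.
move=> w_neq0 hQ Qw.
have [k nz] : exists k, pt w k != 0.
  by case/orP: w_neq0 => nz; [exists j0 | exists j1].
(* This substitution retracts the plane onto the line spanned by [w]. It moves each variable by a
   multiple of the linear form vanishing at [w], and it sends [Q] to a multiple of Q(w), which is
   0. *)
pose t := [tuple (pt w k)^-1 * pt w i *: ('X_k : S) | i < 2].
have [|Q' eQ] := @comp_mpoly_congr _ _ t (lf (zero_of w)) _ Q.
  move=> i; rewrite tnth_mktuple.
  have [->|ne] := eqVneq i k; first by exists 0; rewrite mulVf // scale1r subrr mulr0.
  have e : pt w k *: 'X_i - pt w i *: ('X_k : S) =
      (if i == j0 then 1 else -1) * lf (zero_of w).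
    move: ne; rewrite /lf /zero_of /pt /=.
    elim/ord2P: i; elim/ord2P: k {nz t} => //= _; rewrite ?mul1r ?mulN1r.
      by rewrite scaleNr.
    by rewrite scaleNr opprD opprK addrC.
  exists ((pt w k)^-1 *: (if i == j0 then 1 else -1)).
  by rewrite -scalerAr [lf _ * _]mulrC -e scalerBr !scalerA mulVf // scale1r.
have Qt0 : Q \mPo t = 0.
  by rewrite (comp_mpoly_homog _ _ hQ) (meval_homog _ _ hQ) Qw mulr0 scale0r.
exists (pihomog mdeg d Q'); first exact: pihomogP.
rewrite Qt0 subr0 mulrC in eQ.
by rewrite -[LHS](pihomog_dE hQ) eQ -(addn1 d) (pihomogM _ _ (lf_homog _)) mulrC.
Qed.

Lemma form_eq0 d Q ws : Q \is d.-homog -> size ws = d.+1 ->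
  pairwise (fun s t => det2 s t != 0) ws -> all (fun w => Q.@[pt w] == 0) ws -> Q = 0.
Proof.
elim: d Q ws => [|d IH] Q [|w ws] //= hQ [sz_ws].
  move=> _ /andP[/eqP Qw _].
  have eQ : Q = (Q@_0%MM)%:MP.
    apply/mpolyP => m; rewrite mcoeffC; case: (eqVneq m 0%MM) => [->|nz].
      by rewrite mulr1.
    by rewrite mulr0; apply: (dhomog_nemf_coeff hQ); rewrite /= mdeg_eq0.
  by move: Qw; rewrite eQ mevalC => ->.
case/andP=> w_ws pw /andP[/eqP Qw Qws].
have w_neq0 : (w.1 != 0) || (w.2 != 0).
  case: ws sz_ws w_ws {pw Qws} => //= w' ws' _ /andP[nz _].
  rewrite -negb_and; apply: contraNN nz => /andP[/eqP e1 /eqP e2].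
  by rewrite /det2 e1 e2 !mul0r subrr.
have [Q' hQ' eQ] := form_dvd w_neq0 hQ Qw.
rewrite eQ (IH Q' ws) ?mulr0 //; apply/allP => t t_in.
have := allP Qws t t_in; rewrite eQ mevalM meval_lf mulf_eq0 => /orP[|//].
have := allP w_ws t t_in; rewrite /det2 /zero_of /= => /negPf.
by rewrite mulNr => nz /eqP e; rewrite -oppr_eq0 opprB e eqxx in nz.
Qed.

Definition line_prod (c : K) ts : S := c *: \prod_(t <- ts) lf t.

Lemma line_prod_homog c ts : line_prod c ts \is (size ts).-homog.
Proof.
rewrite /line_prod rpredZ //; elim: ts => [|t ts IH]; first by rewrite big_nil dhomog1.
by rewrite big_cons -[size _]add1n; apply: dhomogM => //; apply: lf_homog.
Qed.

Lemma mderiv_lf t i : (lf t)^`M(i) = (pt t i)%:MP.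
Proof.
rewrite mderivD !mderivZ !mderivXi -!mul_mpolyC.
by elim/ord2P: i; rewrite /pt /= ?mulr1 ?mulr0 ?addr0 ?add0r.
Qed.

Lemma lf_zero_of t : (lf t).@[pt (zero_of t)] = 0.
Proof. by rewrite meval_lf /=; ring. Qed.

Lemma mderiv_line_prod c t ts i :
  ((lf t * line_prod c ts)^`M(i)).@[pt (zero_of t)] =
  pt t i * (line_prod c ts).@[pt (zero_of t)].
Proof. by rewrite mderivM mevalD !mevalM lf_zero_of mul0r addr0 mderiv_lf mevalC. Qed.

Lemma line_prod_neq0_at c t ts : c != 0 -> all (fun t' => det2 t t' != 0) ts ->
  (line_prod c ts).@[pt (zero_of t)] != 0.
Proof.
move=> c0; rewrite mevalZ mulf_eq0 negb_or c0 rmorph_prod /=.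
elim: ts => [|t' ts IH] /=; first by rewrite big_nil oner_eq0.
case/andP=> nz /IH nz'; rewrite big_cons mulf_neq0 // meval_lf.
by rewrite /= -oppr_eq0; apply: contraNN nz; rewrite /det2 => /eqP <-; apply/eqP; ring.
Qed.

(** At the zero of a factor of P the gradient of P is a nonzero multiple of the coefficients of that
    factor, so the relation makes b1 x - b0 y vanish there. This form has degree k + 1 and k + 2
    zeros, hence is 0. Then (b0, b1) is proportional to (x, y), and Euler's formula turns the
    relation into (k + 2) b0 P = 0. *)
Lemma sylvester_inj c ts k (b0 b1 : S) :
    c != 0 -> size ts = k.+2 -> pairwise (fun s t => det2 s t != 0) ts ->
    b0 \is k.-homog -> b1 \is k.-homog ->
    b0 * (line_prod c ts)^`M(j0) + b1 * (line_prod c ts)^`M(j1) = 0 ->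
  b0 = 0 /\ b1 = 0.
Proof.
move=> c0 sz_ts pw hb0 hb1 e; set P := line_prod c ts in e.
pose Q := b1 * 'X_j0 - b0 * 'X_j1.
have hX i : ('X_i : S) \is 1.-homog by rewrite dhomogX /= mdeg1.
have hQ : Q \is k.+1.-homog by rewrite -(addn1 k) rpredB // dhomogM.
have split_ts t : t \in ts -> exists2 ts', P = lf t * line_prod c ts' &
    all (fun t' => det2 t t' != 0) ts'.
  move=> t_in; case/splitPr: t_in @P {e sz_ts} pw => ts1 ts2 P.
  rewrite pairwise_cat /= allrel_consr => /and3P[/andP[r1 _] _ /andP[r2 _]].
  exists (ts1 ++ ts2); first by rewrite /P /line_prod !big_cat big_cons /= -scalerAr mulrCA.
  rewrite all_cat r2 andbT; apply: sub_all r1 => t'; rewrite /det2.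
  by apply: contraNN => /eqP e; rewrite -oppr_eq0 opprB mulrC [t'.1 * _]mulrC e.
have Q0 : Q = 0.
  apply: (@form_eq0 k.+1 Q [seq zero_of t | t <- ts]) => //.
  - by rewrite size_map.
  - rewrite pairwise_map; apply: sub_pairwise pw => s t /=.
    by rewrite /det2 /zero_of /= mulrN mulNr opprK addrC mulrC [t.1 * _]mulrC.
  rewrite all_map; apply/allP => t /split_ts[ts' eP nz] /=.
  have := congr1 (meval (pt (zero_of t))) e.
  rewrite meval0 mevalD !mevalM eP !mderiv_line_prod !mulrA -mulrDl => /eqP.
  rewrite mulf_eq0 (negPf (line_prod_neq0_at c0 nz)) orbF.
  by rewrite mevalB !mevalM !mevalXU /pt /= mulrN opprK addrC.
have P_neq0 : P != 0.
  have [t [t' [t_in nz]]] : exists t t', t \in ts /\ det2 t t' != 0.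
    case: (ts) sz_ts pw => [|t [|t' ts0]] //= _ /andP[/andP[nz _] _].
    by exists t, t'; rewrite mem_head.
  have [ts' -> nz'] := split_ts t t_in; rewrite mulf_neq0 //.
    have e' : (lf t).@[pt (zero_of t')] = det2 t t' by rewrite meval_lf /= mulrN.
    by apply: contraNneq nz => lf0; rewrite -e' lf0 meval0.
  have := line_prod_neq0_at c0 nz'; apply: contraNneq => ->.
  by rewrite meval0.
have eX : b1 * 'X_j0 = b0 * 'X_j1 by apply: subr0_eq Q0.
have euler : 'X_j0 * P^`M(j0) + 'X_j1 * P^`M(j1) = k.+2%:R *: P.
  have := euler_homog (line_prod_homog c ts).
  by rewrite sum2 sz_ts.
have kP : k.+2%:R *: P != 0 by rewrite scaler_eq0 pnatr_eq0.
have b00 : b0 = 0.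
  apply/eqP; rewrite -[_ == 0]orbF -(negPf kP) -mulf_eq0 -euler.
  rewrite mulrDr !mulrA -eX [b0 * _]mulrC -[b1 * _]mulrC -!mulrA -mulrDr e mulr0.
  exact: eqxx.
split=> //; apply/eqP; rewrite -[_ == 0]orbF.
have /negPf <- : ('X_j0 : S) != 0 by rewrite -msize_poly_eq0 msizeX.
by rewrite -mulf_eq0 eX b00 mul0r.
Qed.

End BinaryForms.

(** * Polynomials modulo a power of the maximal ideal *)

Section Truncation.
Variable K : numFieldType.
Local Notation S := {mpoly K[2]}.
Implicit Types (p q h : S) (N : nat) (m : 'X_{1..2}).

Definition mk2 (a : nat * nat) : 'X_{1..2} := (U_(j0) *+ a.1 + U_(j1) *+ a.2)%MM.

Lemma mk2E a : (mk2 a j0 = a.1) * (mk2 a j1 = a.2).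
Proof. by split; rewrite mnmDE !mulmnE !mnm1E /= ?mul1n ?mul0n ?addn0. Qed.

Lemma mk2K m : mk2 (m j0, m j1) = m.
Proof. by apply/mnmP; apply: ord2P; rewrite mk2E. Qed.

Lemma mk2_inj : injective mk2.
Proof. by move=> [a b] [a' b'] e; congr (_, _); rewrite -[LHS](mk2E (a, b)) e mk2E. Qed.

Lemma mdeg_mk2 a : mdeg (mk2 a) = (a.1 + a.2)%N.
Proof. by rewrite mdegD !mdegMn !mdeg1 !mul1n. Qed.

(** An explicit list, so that [trunc_size] reduces to a numeral for the values of [k] met in
    [dim_gradf_compl]. *)
Definition pairs_lt N : seq (nat * nat) := [seq (i, d - i)%N | d <- iota 0 N, i <- iota 0 d.+1].

Lemma mem_pairs_lt N a : (a \in pairs_lt N) = (a.1 + a.2 < N)%N.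
Proof.
apply/allpairsPdep/idP => [[d [i [+ + ->]]]|lt_a].
  by rewrite !mem_iota /= !add0n ltnS => lt_d le_i; rewrite subnKC.
exists (a.1 + a.2)%N, a.1; rewrite !mem_iota /= !add0n ltnS leq_addr addKn.
by case: a lt_a.
Qed.

Lemma uniq_pairs_lt N : uniq (pairs_lt N).
Proof.
apply: allpairs_uniq_dep => [|d _|]; rewrite ?iota_uniq //.
move=> u v /allpairsPdep[d [i [_ + ->]]] /allpairsPdep[d' [i' [_ + ->]]] /=.
rewrite !mem_iota /= !add0n !ltnS => le_i le_i' [e1 e2]; rewrite e1 in le_i e2 *.
suff -> : d = d' by [].
by rewrite -(subnK le_i) e2 subnK.
Qed.

Definition trunc_size N := size (pairs_lt N).
Definition trunc_mon N (i : 'I_(trunc_size N)) : 'X_{1..2} :=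
  mk2 (nth (0, 0)%N (pairs_lt N) i).

Lemma trunc_mon_lt N i : (mdeg (@trunc_mon N i) < N)%N.
Proof. by rewrite mdeg_mk2 -mem_pairs_lt mem_nth. Qed.

Lemma trunc_monP N m : (mdeg m < N)%N -> exists i, m = @trunc_mon N i.
Proof.
rewrite -[m]mk2K mdeg_mk2 -mem_pairs_lt => m_in.
have lt_i : (index (m j0, m j1) (pairs_lt N) < trunc_size N)%N by rewrite index_mem.
by exists (Ordinal lt_i); rewrite /trunc_mon /= nth_index.
Qed.

Lemma trunc_mon_inj N : injective (@trunc_mon N).
Proof.
move=> i j /mk2_inj /eqP; rewrite nth_uniq ?uniq_pairs_lt //.
by move/eqP; apply: val_inj.
Qed.

Definition trunc N h : 'rV[K]_(trunc_size N) := \row_i h@_(trunc_mon i).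
Definition lift_trunc N (w : 'rV[K]_(trunc_size N)) : S :=
  \sum_i w 0 i *: 'X_[trunc_mon i].

Lemma trunc_linear N : linear (trunc N).
Proof. by move=> c p q; apply/rowP => i; rewrite !mxE mcoeffD mcoeffZ. Qed.
HB.instance Definition _ N := GRing.isLinear.Build K S 'rV_(trunc_size N) _ (trunc N)
  (@trunc_linear N).

Lemma lift_trunc_linear N : linear (@lift_trunc N).
Proof.
move=> c p q; rewrite /lift_trunc scaler_sumr -big_split; apply: eq_bigr => i _ /=.
by rewrite !mxE scalerDl scalerA.
Qed.
HB.instance Definition _ N := GRing.isLinear.Build K 'rV_(trunc_size N) S _
  (@lift_trunc N) (@lift_trunc_linear N).

Lemma trunc_eq0 N h : trunc N h = 0 <-> in_mpow N h.
Proof.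
split=> [/rowP e m /trunc_monP[i ->]|e]; first by have := e i; rewrite !mxE.
by apply/rowP => i; rewrite !mxE e // trunc_mon_lt.
Qed.

Lemma lift_truncK N : cancel (@lift_trunc N) (trunc N).
Proof.
move=> w; apply/rowP => i; rewrite mxE raddf_sum (bigD1 i) //= big1 => [|j ne].
  by rewrite mcoeffZ mcoeffX eqxx mulr1 addr0.
by rewrite mcoeffZ mcoeffX (inj_eq (@trunc_mon_inj N)) (negPf ne) mulr0.
Qed.

Lemma lift_trunc_mod N h : in_mpow N (h - lift_trunc (trunc N h)).
Proof. by apply/trunc_eq0; rewrite linearB /= lift_truncK subrr. Qed.

End Truncation.

(** * The local algebra of P + H, where P is the initial form of degree k + 2 *)

Section LocalAlgebra.
Variable K : numFieldType.
Local Notation S := {mpoly K[2]}.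
Variables (k : nat) (P H : S).
Local Notation G := (P + H).
Local Notation N := (k + k).+1.
Hypotheses (le_k2 : (k <= 2)%N) (hP : P \is k.+2.-homog) (hH : in_mpow k.+3 H).
Hypothesis P_inj : forall b0 b1, b0 \is k.-homog -> b1 \is k.-homog ->
  b0 * P^`M(j0) + b1 * P^`M(j1) = 0 -> b0 = 0 /\ b1 = 0.

(** The ideal of the partials alone, easier to count with; by [grad_tjurina] and [tjurina_mod] it
    agrees with the Tjurina ideal up to terms of order [N]. *)
Definition grad_ideal (h : S) : Prop :=
  exists b0 b1, h = b0 * G^`M(j0) + b1 * G^`M(j1).

Lemma grad_idealD p q : grad_ideal p -> grad_ideal q -> grad_ideal (p + q).
Proof.
by move=> [a [b ->]] [a' [b' ->]]; exists (a + a'), (b + b'); ring.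
Qed.

Lemma grad_idealM p q : grad_ideal q -> grad_ideal (p * q).
Proof. by move=> [a [b ->]]; exists (p * a), (p * b); ring. Qed.

Lemma dP_homog i : P^`M(i) \is k.+1.-homog.
Proof. exact: mderiv_homog. Qed.

Definition sylv (u : dhomog 2 K k * dhomog 2 K k) : S :=
  val u.1 * P^`M(j0) + val u.2 * P^`M(j1).

Fact sylv_subproof u : sylv u \is (k + k.+1).-homog.
Proof.
by rewrite rpredD //; apply: dhomogM; rewrite ?dP_homog //; apply: dhomog_is_dhomog.
Qed.

Definition sylvh u : dhomog 2 K (k + k.+1) := DHomog (sylv_subproof u).

Fact sylvh_linear : linear sylvh.
Proof.
move=> c u v; apply: val_inj; rewrite [RHS]linearD [in RHS]linearZ /= /sylv.
rewrite [(c *: u + v).1]/= [(c *: u + v).2]/= !linearD !linearZ /= -!mul_mpolyC; ring.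
Qed.
HB.instance Definition _ := GRing.isLinear.Build K _ _ _ sylvh sylvh_linear.

(** [P_inj] makes the Sylvester map injective, and its source and target both have dimension 2 (k +
    1). *)
Lemma sylv_surj h : h \is N.-homog -> exists b0 b1,
  [/\ b0 \is k.-homog, b1 \is k.-homog & h = b0 * P^`M(j0) + b1 * P^`M(j1)].
Proof.
rewrite -addnS => hh; pose F := linfun sylvh.
have FE u : F u = sylvh u by exact: lfunE.
have kerF : lker F == 0%VS.
  apply/lker0P => u v; rewrite !FE => /(congr1 val) /= e.
  have [|||/subr0_eq e0 /subr0_eq e1] := @P_inj (val u.1 - val v.1) (val u.2 - val v.2).
  - by rewrite rpredB //; apply: dhomog_is_dhomog.
  - by rewrite rpredB //; apply: dhomog_is_dhomog.
  - by transitivity (sylv u - sylv v); [rewrite /sylv; ring | rewrite e subrr].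
  by case: u v e0 e1 {e} => [u0 u1] [v0 v1] /= /val_inj-> /val_inj->.
have : limg F = fullv.
  apply/eqP; rewrite eqEdim subvf /= limg_dim_eq ?(eqP kerF) ?capv0 //.
  rewrite !dimvf -[dim (dhomog 2 K k * dhomog 2 K k)%type]/(_ + _)%N !dim_dhomog !addn1.
  by rewrite !binSn addnn; lia.
move/vspaceP/(_ (DHomog hh)); rewrite memvf => /memv_imgP[u _ e].
exists (val u.1), (val u.2); split; try exact: dhomog_is_dhomog.
by have := congr1 val e; rewrite FE.
Qed.

(* Modulo the maximal ideal, the matrix 1 - A expressing the monomials of degree N
   in terms of the ideal is the identity, so its determinant is a local unit. *)
Lemma grad_ideal_mpow : exists s, s.@[fun=> 0] != 0 /\
  forall h, in_mpow N h -> grad_ideal (s * h).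
Proof.
pose X (i : 'I_N.+1) : S := 'X_[mk2 (i : nat, (N - i)%N)].
(* A monomial of degree N + 1 is a variable times one of degree [N]; the variable supplies a
   coefficient vanishing at the origin. *)
have Q_ind h : in_mpow N.+1 h -> exists A : 'I_N.+1 -> S,
    (forall i, (A i).@[fun=> 0] = 0) /\ h = \sum_i A i * X i.
  move: h; apply: mpow_ind.
  - exists (fun=> 0); split=> [i|]; first by rewrite meval0.
    by rewrite big1 // => i _; rewrite mul0r.
  - move=> p q [A [A0 ->]] [B [B0 ->]]; exists (fun i => A i + B i).
    split=> [i|]; first by rewrite mevalD A0 B0 addr0.
    by rewrite -big_split; apply: eq_bigr => i _; rewrite mulrDl.
  - move=> p q [A [A0 ->]]; exists (fun i => p * A i).
    split=> [i|]; first by rewrite mevalM A0 mulr0.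
    by rewrite mulr_sumr; apply: eq_bigr => i _; rewrite mulrA.
  move=> m dm.
  have [l [i em]] : exists l i, 'X_[m] = 'X_l * X i.
    move: dm; rewrite -[m]mk2K mdeg_mk2 /=.
    case: (m j0) => [|a] e.
      exists j1, ord0; rewrite /X /= subn0 add0n in e *; rewrite e -mpolyXD.
      congr 'X_[_]; apply/mnmP; apply: ord2P.
        by rewrite mnmDE !mk2E mnm1E.
      by rewrite mnmDE !mk2E mnm1E /= add1n.
    have lt_a : (a < N.+1)%N by move: e; lia.
    exists j0, (Ordinal lt_a); rewrite /X -mpolyXD; congr 'X_[_].
    apply/mnmP; apply: ord2P; first by rewrite mnmDE !mk2E mnm1E.
    by rewrite mnmDE !mk2E mnm1E /=; lia.
  exists (fun j => if j == i then 'X_l else 0); split=> [j|].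
    by case: ifP; rewrite ?mevalXU ?meval0.
  rewrite (bigD1 i) //= eqxx big1 ?addr0 // => j /negPf ->; by rewrite mul0r.
have XA i : exists A : 'I_N.+1 -> S, (forall j, (A j).@[fun=> 0] = 0) /\
    grad_ideal (X i - \sum_j A j * X j).
  have hX : X i \is N.-homog.
    by rewrite dhomogX /= mdeg_mk2 /= subnKC // -ltnS.
  have [b0 [b1 [hb0 hb1 eX]]] := sylv_surj hX.
  (* Replacing the partials of [P] by those of P + H costs an error of order k + (k + 2) = N + 1. *)
  have [|A [A0 eA]] := @Q_ind (- (b0 * H^`M(j0) + b1 * H^`M(j1))).
    have eN : N.+1 = (k + k.+2)%N by rewrite !addnS.
    rewrite eN; apply: mpowN; apply: mpowD; apply: mpowM;
      by [apply: mpow_homog | apply: mpow_mderiv].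
  exists A; split=> //; exists b0, b1; rewrite -eA eX !mderivD; ring.
have [A AP] := fin_all_exists XA.
pose B : 'M[S]_N.+1 := 1%:M - \matrix_(i, j) A i j.
have BX i : grad_ideal (\sum_j B i j * X j).
  have [_] := AP i; congr grad_ideal.
  rewrite [in RHS](eq_bigr (fun j => (i == j)%:R * X j - A i j * X j)); last first.
    by move=> j _; rewrite /B !mxE mulrBl.
  rewrite sumrB; congr (_ - _).
  rewrite (bigD1 i) //= eqxx mul1r big1 ?addr0 // => j.
  by rewrite eq_sym => /negPf ->; rewrite mul0r.
exists (\det B); split.
  rewrite -det_map_mx /=.
  have -> : map_mx (meval (fun=> 0)) B = 1%:M.
    apply/matrixP => i j; rewrite /B !mxE mevalB (proj1 (AP i)) subr0.
    by rewrite rmorph_nat.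
  by rewrite det1 oner_eq0.
suff detX m : mdeg m = N -> grad_ideal (\det B * 'X_[m]).
  apply: mpow_ind => [|p q hp hq|p q hq|]; last exact: detX.
  - by exists 0, 0; rewrite mulr0 !mul0r addr0.
  - by rewrite mulrDr; apply: grad_idealD.
  by rewrite mulrCA; apply: grad_idealM.
move=> dm; have dE := mdeg_mk2 (m j0, m j1); rewrite mk2K dm /= in dE.
have lt_m : (m j0 < N.+1)%N by rewrite ltnS dE leq_addr.
have -> : 'X_[m] = X (Ordinal lt_m) by rewrite /X /= dE addKn mk2K.
set i := Ordinal lt_m.
(* The adjugate of [B] times [B] is the determinant, so the relations [BX] combine to put det B
   times each monomial of degree [N] in the ideal. *)
have -> : \det B * X i = \sum_l \adj B i l * \sum_j B l j * X j.
  transitivity (\sum_j (\adj B *m B) i j * X j).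
    rewrite mul_adj_mx (bigD1 i) //= big1 ?addr0 => [|j /negPf ne].
      by rewrite mxE eqxx mulr1n.
    by rewrite mxE eq_sym ne mulr0n mul0r.
  rewrite (eq_bigr (fun j => \sum_l \adj B i l * (B l j * X j))).
    by rewrite exchange_big; apply: eq_bigr => l _; rewrite mulr_sumr.
  by move=> j _; rewrite mxE mulr_suml; apply: eq_bigr => l _; rewrite mulrA.
elim/big_ind: _ => [|p q|l _]; [|exact: grad_idealD|exact/grad_idealM].
by exists 0, 0; rewrite !mul0r addr0.
Qed.

Lemma grad_tjurina h : grad_ideal h -> tjurina_ideal G h.
Proof.
move=> [b0 [b1 ->]]; exists 0, (fun i => if i == j0 then b0 else b1).
by rewrite mul0r add0r sum2.
Qed.

Lemma tjurina_mod h : tjurina_ideal G h ->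
  exists j, grad_ideal j /\ in_mpow N (h - j).
Proof.
(* [D] is the failure of Euler's formula for [H]; up to it, P + H is a combination of its own
   partials. It has order k + 3, which is at least N = 2k + 1 because k <= 2. *)
move=> [b [a ->]]; pose D := k.+2%:R *: H - \sum_(i < 2) 'X_i * H^`M(i).
have hD : in_mpow N D.
  apply: (@mpow_le _ _ k.+3); first by move: le_k2; lia.
  apply: mpowB; first exact: mpowZ.
  rewrite sum2 -[k.+3]add1n; apply: mpowD; apply: mpowM; try exact: mpow_mderiv;
    by apply: mpow_homog; rewrite dhomogX /= mdeg1.
have nz : k.+2%:R != 0 :> K by rewrite pnatr_eq0.
have eG : G = k.+2%:R^-1 *: (\sum_(i < 2) 'X_i * G^`M(i) + D).
  apply: (scalerI nz); rewrite scalerA divff // scale1r /D scalerDr -(euler_homog hP).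
  by rewrite !sum2 !mderivD; ring.
exists (b * (k.+2%:R^-1 *: \sum_(i < 2) 'X_i * G^`M(i)) + \sum_(j < 2) a j * G^`M(j)).
split.
  apply: grad_idealD.
    apply: grad_idealM; rewrite -mul_mpolyC; apply: grad_idealM.
    by exists 'X_j0, 'X_j1; rewrite sum2.
  by exists (a j0), (a j1); rewrite sum2.
rewrite opprD addrACA subrr addr0 {1}eG scalerDr mulrDr addrAC subrr add0r.
by apply: mpowMl; apply: mpowZ.
Qed.

(** The lowest components of [b0] and [b1], if of degree below [k], would be a relation between the
    partials of [P]. *)
Lemma grad_low b0 b1 : in_mpow N (b0 * G^`M(j0) + b1 * G^`M(j1)) ->
  in_mpow k b0 /\ in_mpow k b1.
Proof.
move=> hN; suff low l : (l <= k)%N -> in_mpow l b0 /\ in_mpow l b1 by exact: low.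
elim: l => [//|l IH] lt_lk; have [h0 h1] := IH (ltnW lt_lk).
pose c0 := pihomog mdeg l b0; pose c1 := pihomog mdeg l b1.
have hc0 : c0 \is l.-homog by exact: pihomogP.
have hc1 : c1 \is l.-homog by exact: pihomogP.
have e0 : c0 * P^`M(j0) + c1 * P^`M(j1) = 0.
  apply: (@homog_mpow0 _ _ (l + k.+1)).
    by rewrite rpredD //; apply: dhomogM; rewrite ?dP_homog.
  have -> : c0 * P^`M(j0) + c1 * P^`M(j1) =
     (b0 * G^`M(j0) + b1 * G^`M(j1)) - ((b0 - c0) * P^`M(j0) + (b1 - c1) * P^`M(j1))
     - (b0 * H^`M(j0) + b1 * H^`M(j1)) by rewrite !mderivD; ring.
  have hdP i : in_mpow k.+1 P^`M(i) by apply: mpow_homog; apply: dP_homog.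
  have hdH i : in_mpow k.+2 H^`M(i) by apply: mpow_mderiv.
  apply: mpowB; first apply: mpowB.
  - by apply: mpow_le hN; move: lt_lk; lia.
  - by rewrite -addSn; apply: mpowD; apply: mpowM => //; apply: mpow_pihomog.
  by rewrite -addnS; apply: mpowD; apply: mpowM.
(* [P_inj] speaks of coefficients of degree exactly [k], so those of degree [l] are multiplied by a
   power of a variable. *)
pose z : S := 'X_j0 ^+ (k - l).
have hz : z \is (k - l).-homog.
  by rewrite /z mpolyXn dhomogX /= mdegMn mdeg1 mul1n.
have nz : z != 0 by rewrite expf_neq0 // -msize_poly_eq0 msizeX.
have [||| /eqP + /eqP] := @P_inj (z * c0) (z * c1).
- by rewrite -[X in X.-homog](subnK (ltnW lt_lk)); apply: dhomogM.
- by rewrite -[X in X.-homog](subnK (ltnW lt_lk)); apply: dhomogM.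
- by rewrite -!mulrA -mulrDr e0 mulr0.
rewrite !mulf_eq0 (negPf nz) /= => /eqP z0 /eqP z1.
split; [rewrite -[b0]subr0 -z0 | rewrite -[b1]subr0 -z1]; exact: mpow_pihomog.
Qed.

Local Notation TK := ('rV[K]_(trunc_size k) * 'rV[K]_(trunc_size k))%type.

(** Only the coefficients below degree [k] matter: the partials of P + H have order k + 1, and k +
    (k + 1) = N. *)
Definition grad_trunc (b : TK) : 'rV[K]_(trunc_size N) :=
  trunc N (lift_trunc b.1 * G^`M(j0) + lift_trunc b.2 * G^`M(j1)).

Fact grad_trunc_linear : linear grad_trunc.
Proof.
move=> c p q; rewrite /grad_trunc -linearP; congr trunc => /=.
by rewrite !linearD !linearZ /= -!mul_mpolyC; ring.
Qed.
HB.instance Definition _ := GRing.isLinear.Build K TK 'rV_(trunc_size N) _ grad_trunc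
  grad_trunc_linear.

Definition gradf : 'Hom(TK, 'rV[K]_(trunc_size N)) := linfun grad_trunc.

Lemma gradfE b : gradf b = grad_trunc b. Proof. exact: lfunE. Qed.

Lemma gradf_inj : lker gradf == 0%VS.
Proof.
rewrite -subv0; apply/subvP => b; rewrite memv_ker memv0 gradfE => /eqP/trunc_eq0.
case/grad_low => /trunc_eq0 + /trunc_eq0; rewrite !lift_truncK.
by case: b => [b0 b1] /= -> ->.
Qed.

Lemma mem_gradf h : trunc N h \in limg gradf <->
  exists j, grad_ideal j /\ in_mpow N (h - j).
Proof.
split=> [/memv_imgP[b _]|[_ [[b0 [b1 ->]]]]].
  rewrite gradfE => /eqP; rewrite -subr_eq0 -linearB => /eqP/trunc_eq0 hj.
  by eexists; split; [|exact: hj]; exists (lift_trunc b.1), (lift_trunc b.2).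
set j := b0 * _ + b1 * _ => hj; have -> : trunc N h = trunc N j.
  by apply/eqP; rewrite -subr_eq0 -linearB; apply/eqP/trunc_eq0.
apply/memv_imgP; exists (trunc k b0, trunc k b1); first exact: memvf.
rewrite gradfE; apply/eqP; rewrite -subr_eq0 -linearB; apply/eqP/trunc_eq0.
have -> : j - (lift_trunc (trunc k b0) * G^`M(j0) + lift_trunc (trunc k b1) * G^`M(j1)) =
    (b0 - lift_trunc (trunc k b0)) * G^`M(j0) +
    (b1 - lift_trunc (trunc k b1)) * G^`M(j1) by rewrite /j; ring.
have hdG i : in_mpow k.+1 G^`M(i).
  rewrite mderivD; apply: mpowD; first by apply: mpow_homog; apply: dP_homog.
  by apply: (@mpow_le _ _ k.+2) => //; apply: mpow_mderiv.
by rewrite -addnS; apply: mpowD; apply: mpowM => //; apply: lift_trunc_mod.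
Qed.

(** The count is (2k + 1)(2k + 2)/2 - k (k + 1) = (k + 1)^2, verified for k = 0, 1, 2. *)
Lemma dim_gradf_compl : \dim (limg gradf)^C = (k.+1 ^ 2)%N.
Proof.
rewrite dimv_compl limg_dim_eq ?(eqP gradf_inj) ?capv0 // !dimvf.
rewrite -[dim TK]/(dim 'rV[K]_(trunc_size k) + dim 'rV[K]_(trunc_size k))%N !dim_matrix.
by case: k le_k2 => [|[|[|]]] //=; rewrite ?mul1n.
Qed.

Lemma local_colength_homog : local_colength (tjurina_ideal G) (k.+1 ^ 2).
Proof.
pose W := ((limg gradf)^C)%VS; rewrite -dim_gradf_compl -/W.
have [s [s0 sP]] := grad_ideal_mpow.
have eb (c : 'I_(\dim W) -> K) :
    \sum_i c i *: lift_trunc (vbasis W)`_i = lift_trunc (\sum_i c i *: (vbasis W)`_i).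
  by rewrite linear_sum; apply: eq_bigr => i _; rewrite linearZ.
exists (fun i => lift_trunc (vbasis W)`_i); split=> [h t t0|c u u0 hu].
  have [t' ht'] := inv_mod_mpow N t0.
  have := memvf (trunc N (t' * h)); rewrite -(addv_complf (limg gradf)).
  case/memv_addP => w w_in [w' w'_in e].
  exists (fun i => coord (vbasis W) i w'), s; split=> //; rewrite eb -(coord_vbasis w'_in).
  have : trunc N (t' * h - lift_trunc w') \in limg gradf.
    by rewrite linearB /= e lift_truncK addrK.
  case/mem_gradf => j [hj hN].
  (* The first summand lies in the ideal and the rest has order [N], since [t'] inverts [t] modulo
     that order; multiplication by [s] carries the rest into the ideal. *)
  have -> : h - t * lift_trunc w' =
      t * j + (t * (t' * h - lift_trunc w' - j) - (t * t' - 1) * h) by ring.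
  rewrite mulrDr; apply: grad_tjurina; apply: grad_idealD.
    by do 2!apply: grad_idealM.
  by apply: sP; apply: mpowB; [|rewrite mulrC]; apply: mpowMl.
rewrite eb in hu; set w := \sum_i _ in hu.
have [u' hu'] := inv_mod_mpow N u0.
have [j [hj hN]] := tjurina_mod hu.
have w_in : w \in limg gradf.
  rewrite -[w]lift_truncK; apply/mem_gradf; exists (u' * j); split; first exact: grad_idealM.
  have -> : lift_trunc w - u' * j =
      u' * (u * lift_trunc w - j) - (u * u' - 1) * lift_trunc w by ring.
  by apply: mpowB; [|rewrite mulrC]; apply: mpowMl.
have w0 : w = 0.
  apply/eqP; rewrite -memv0 -(capv_compl (limg gradf)) memv_cap w_in.
  by rewrite memv_suml // => i _; rewrite memvZ // vbasis_mem // mem_nth ?size_tuple.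
exact: (elimT (@freeP _ _ _ (vbasis W)) (basis_free (vbasisP W)) c w0).
Qed.

End LocalAlgebra.

(** * Points of an arrangement *)

Section ChainRule.
Variables (n m : nat) (K : fieldType).
Implicit Types (g : {mpoly K[n]}) (t : n.-tuple {mpoly K[m]}).

(** The defect [D] of the chain rule satisfies a Leibniz rule and vanishes on constants and
    variables, hence on every polynomial. *)
Lemma mderiv_comp t g k :
  (g \mPo t)^`M(k) = \sum_(j < n) (g^`M(j) \mPo t) * (tnth t j)^`M(k).
Proof.
pose D g := (g \mPo t)^`M(k) - \sum_(j < n) (g^`M(j) \mPo t) * (tnth t j)^`M(k).
suff D0 : D g = 0 by apply: subr0_eq D0.
have DD p q : D (p + q) = D p + D q.
  rewrite /D comp_mpolyD mderivD.
  rewrite (eq_bigr (fun j => (p^`M(j) \mPo t) * (tnth t j)^`M(k) +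
    (q^`M(j) \mPo t) * (tnth t j)^`M(k))).
    by rewrite big_split /=; ring.
  by move=> j _; rewrite mderivD comp_mpolyD mulrDl.
have DM p q : D (p * q) = D p * (q \mPo t) + (p \mPo t) * D q.
  rewrite /D rmorphM mderivM /=.
  rewrite (eq_bigr (fun j => (p^`M(j) \mPo t) * (tnth t j)^`M(k) * (q \mPo t) +
    (p \mPo t) * ((q^`M(j) \mPo t) * (tnth t j)^`M(k)))).
    by rewrite big_split /= -mulr_suml -mulr_sumr; ring.
  by move=> j _; rewrite mderivM comp_mpolyD !rmorphM /=; ring.
have DC c : D c%:MP = 0.
  rewrite /D comp_mpolyC mderivC big1 ?subr0 // => j _.
  by rewrite mderivC comp_mpoly0 mul0r.
have DX i : D 'X_i = 0.
  rewrite /D comp_mpolyXU -tnth_nth (bigD1 i) //= mderivXi eqxx rmorph1 mul1r.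
  rewrite big1 ?addr0 ?subrr // => j ne.
  by rewrite mderivXi (negPf ne) rmorph0 mul0r.
clearbody D.
have DXn i e : D ('X_i ^+ e) = 0.
  elim: e => [|e IH]; first by rewrite expr0 -mpolyC1 DC.
  by rewrite exprS DM DX IH mul0r mulr0 addr0.
elim/mpolyind: g => [|c p q _ _ IH]; first by rewrite -mpolyC0 DC.
rewrite DD IH addr0 -mul_mpolyC DM DC mul0r add0r mpolyXE_id.
suff -> : D (\prod_(i < n) 'X_i ^+ p i) = 0 by rewrite mulr0.
elim/big_ind: _ => [|u v Du Dv|//]; first by rewrite -mpolyC1 DC.
by rewrite DM Du Dv mul0r mulr0 addr0.
Qed.

End ChainRule.

Section Coordinates.
Variable K : fieldType.
Implicit Types (p : P2 K) (v w : 'I_3 -> K) (g h : {mpoly K[3]}).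

Definition crd p : 'I_3 -> K := fun i => rep p 0 i.
Definition rowv v : 'rV[K]_3 := \row_i v i.
Definition grad g v : 'I_3 -> K := fun i => g^`M(i).@[v].
Definition nonzero v : bool := [exists i, v i != 0].
Definition independent v w : bool := nonzero (cross v w).

Lemma on_curveE g p : on_curve g p = (g.@[crd p] == 0). Proof. by []. Qed.

Lemma rep_neq0 p : rep p != 0.
Proof. by rewrite vpick0 -dimv_eq0 (eqP (svalP p)). Qed.

Lemma nonzeroE v : nonzero v = (rowv v != 0).
Proof.
apply/idP/idP => [/existsP[i nz]|].
  by apply: contraNneq nz => /rowP/(_ i); rewrite !mxE => ->.
rewrite /nonzero => nz; apply: contraNT nz; rewrite negb_exists => /forallP z.
by apply/eqP/rowP => i; rewrite !mxE; apply/eqP/negPn.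
Qed.

Lemma rowv_crd p : rowv (crd p) = rep p.
Proof. by apply/rowP => i; rewrite mxE. Qed.

Lemma nonzero_crd p : nonzero (crd p).
Proof. by rewrite nonzeroE rowv_crd rep_neq0. Qed.

Lemma P2_vline p u : u != 0 -> u \in sval p -> sval p = <[u]>%VS.
Proof.
move=> nz u_in; apply/esym/eqP.
by rewrite eqEdim -memvE u_in (eqP (svalP p)) dim_vline nz.
Qed.

Fact point_subproof v : \dim <[if nonzero v then rowv v else const_mx 1]> == 1%N.
Proof.
rewrite dim_vline nonzeroE; case: ifP => [->|_] //.
suff -> : (const_mx 1 : 'rV[K]_3) != 0 by [].
by apply/eqP => /rowP/(_ i0) /eqP; rewrite !mxE oner_eq0.
Qed.

(* Junk value (1 : 1 : 1) when v = 0. *)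
Definition point v : P2 K := 
  exist (fun U : {vspace 'rV[K]_3} => \dim U == 1%N) _ (point_subproof v).

Lemma point_crd v : nonzero v -> exists2 c, c != 0 & crd (point v) =1 (fun i => c * v i).
Proof.
move=> nz; have e0 : sval (point v) = <[rowv v]>%VS by rewrite /= nz.
have /vlineP[c e] : rep (point v) \in <[rowv v]>%VS by rewrite -e0 memv_pick.
exists c => [|i]; last by rewrite /crd e !mxE.
by apply: contraNneq (rep_neq0 (point v)) => c0; rewrite e c0 scale0r.
Qed.

Lemma eq_point p v c : nonzero v -> (forall i, v i = c * crd p i) -> p = point v.
Proof.
move=> nz e; apply: val_inj; rewrite /= nz; apply: P2_vline; first by rewrite -nonzeroE.
have -> : rowv v = c *: rep p by apply/rowP => i; rewrite !mxE e.
by rewrite memvZ ?memv_pick.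
Qed.

Lemma point_eq v w : nonzero v -> nonzero w -> point v = point w ->
  exists c, forall i, v i = c * w i.
Proof.
move=> nzv nzw e; have [c c0 ev] := point_crd nzv; have [d d0 ew] := point_crd nzw.
exists (c^-1 * d) => i; rewrite -mulrA -ew -e ev mulrA mulVf ?mul1r //.
Qed.

Lemma cross_proportional v w : nonzero v -> cross v w =1 (fun=> 0) ->
  exists c, forall i, w i = c * v i.
Proof.
move=> /existsP[i nz] e; exists ((v i)^-1 * w i) => j.
suff {nz} : w j * v i = w i * v j.
  by move=> ee; rewrite -mulrA -ee mulrC mulfK.
have := (e i0, e i1, e i2); rewrite /cross /vec3 /= => -[[/subr0_eq e0 /subr0_eq e1] /subr0_eq e2].
by elim/ord3P: i; elim/ord3P: j => //; rewrite mulrC [RHS]mulrC;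
  first [exact: e0 | exact: e1 | exact: e2 | exact: esym].
Qed.

End Coordinates.

Section OrdinaryPoints.
Variable K : numFieldType.
Local Notation S := {mpoly K[3]}.
Implicit Types (p : P2 K) (v w : 'I_3 -> K) (g h : S) (A : seq S).

(** Taken at a vector instead of a point, so that it can be computed at explicit coordinates;
    rescaling the vector does not matter for homogeneous members. *)
Definition branches A v : seq S := [seq g <- A | g.@[v] == 0].
Definition smooth_branches A v : bool := all (fun g => nonzero (grad g v)) (branches A v).
Definition transversal A v : bool :=
  pairwise (fun g h => independent (grad g v) (grad h v)) (branches A v).

Lemma mult_at_branches A p : mult_at A p = size (branches A (crd p)).
Proof. by rewrite size_filter. Qed.

Lemma grad_prod_branch g h v i : g.@[v] = 0 -> grad (g * h) v i = grad g v i * h.@[v].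
Proof. by move=> gv; rewrite /grad mderivM mevalD !mevalM gv mul0r addr0. Qed.

Lemma defpoly_split A1 g A2 : defpoly (A1 ++ g :: A2) = g * defpoly (A1 ++ A2).
Proof. by rewrite /defpoly !big_cat big_cons /= mulrCA. Qed.

Lemma branches_split A v g : g \in A -> g.@[v] = 0 ->
  exists A', [/\ defpoly A = g * defpoly A' & perm_eq (branches A v) (g :: branches A' v)].
Proof.
case/splitPr => A1 A2 gv; exists (A1 ++ A2); split; first exact: defpoly_split.
rewrite /branches !filter_cat /= gv eqxx perm_sym -cat1s perm_catCA.
exact: perm_refl.
Qed.

Lemma defpoly_eq0 A v : ((defpoly A).@[v] == 0) = (0 < size (branches A v))%N.
Proof.
rewrite rmorph_prod prodf_seq_eq0 /branches size_filter -has_count.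
by apply: eq_has => g.
Qed.

(** Let g be a member through [p] and h the product of the others. At [p] the gradient of gh is h(p)
    grad g, and grad g is nonzero there, so [p] is singular exactly when another member passes
    through it. *)
Lemma singular_defpoly A p : smooth_branches A (crd p) ->
  singular (defpoly A) p = (2 <= mult_at A p)%N.
Proof.
move=> sm; rewrite /singular on_curveE defpoly_eq0 mult_at_branches.
case: posnP => [->//|sz_gt0] /=.
have [g g_in] : exists g, g \in branches A (crd p).
  by case: (branches _ _) sz_gt0 => // g s _; exists g; rewrite mem_head.
have := g_in; rewrite mem_filter => /andP[/eqP gv gA].
have [A' [eA pA]] := branches_split gA gv.
rewrite eA (perm_size pA) /= ltnS -defpoly_eq0.
apply/forallP/idP => [sing|/eqP z i]; last first.
  by rewrite on_curveE -[_.@[_]]/(grad _ _ _) grad_prod_branch // z mulr0.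
have /existsP[i nz] := allP sm _ g_in.
have := sing i; rewrite on_curveE -[_.@[_]]/(grad _ _ _) grad_prod_branch //.
by rewrite mulf_eq0 (negPf nz).
Qed.

Lemma nonzeroZ c v : c != 0 -> nonzero (fun i => c * v i) = nonzero v.
Proof. by move=> c0; apply: eq_existsb => i; rewrite mulf_eq0 negb_or c0. Qed.

Lemma eq_nonzero v w : v =1 w -> nonzero v = nonzero w.
Proof. by move=> e; apply: eq_existsb => i; rewrite e. Qed.

Lemma independentZ a b v w : a != 0 -> b != 0 ->
  independent (fun i => a * v i) (fun i => b * w i) = independent v w.
Proof.
move=> a0 b0; rewrite -[RHS](@nonzeroZ (a * b)) ?mulf_neq0 //; apply: eq_nonzero => i.
by elim/ord3P: i; rewrite /cross /vec3 /=; ring.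
Qed.

Lemma eq_independent v v' w w' : v =1 v' -> w =1 w' -> independent v w = independent v' w'.
Proof. by move=> e e'; apply: eq_nonzero => i; rewrite /cross !e !e'. Qed.

Lemma dim_tangent g p : nonzero (grad g (crd p)) -> \dim (tangent g p) = 2%N.
Proof.
move=> /existsP[i nz]; rewrite /tangent; set F := linfun _.
have := limg_ker_dim F fullv; rewrite capfv dimvf dim_matrix => e.
suff e1 : \dim (limg F) = 1%N by move: e; rewrite e1 addn1 => -[->].
apply/eqP; rewrite eqn_leq; apply/andP; split.
  by have := dimvS (subvf (limg F)); rewrite dimvf dim_matrix.
rewrite lt0n dimv_eq0; apply: contraTneq (memv_img F (memvf (delta_mx 0 i))) => ->.
rewrite memv0 lfunE /=; apply: contraNN nz => /eqP/rowP/(_ 0).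
by rewrite -rowE !mxE => e'; apply/eqP.
Qed.

Lemma mem_tangent g p (u : 'rV[K]_3) :
  (u \in tangent g p) = (dot (u 0) (grad g (crd p)) == 0).
Proof.
rewrite memv_ker lfunE /=; apply/eqP/eqP => [/rowP/(_ 0)|e].
  by rewrite !mxE => <-; apply: eq_bigr => j _; rewrite !mxE.
apply/rowP => j; rewrite ord1 !mxE -[RHS]e.
by apply: eq_bigr => l _; rewrite !mxE.
Qed.

Lemma tangent_neq g h p : independent (grad g (crd p)) (grad h (crd p)) ->
  tangent g p != tangent h p.
Proof.
move=> /existsP[i nz]; apply: contraNneq nz => e.
(* The vector e_i x grad g is tangent to g, and its scalar product with grad h is the i-th
   coordinate of grad g x grad h. *)
pose ei : 'I_3 -> K := fun j => (i == j)%:R.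
pose u : 'rV[K]_3 := rowv (cross ei (grad g (crd p))).
have : u \in tangent g p.
  rewrite mem_tangent dotE /u !mxE; apply/eqP.
  by rewrite /cross /vec3 /=; ring.
rewrite e mem_tangent => /eqP <-; apply/eqP.
rewrite dotE /u !mxE /cross /vec3 /ei.
by elim/ord3P: i {ei u e} => /=; ring.
Qed.

Lemma ordinary_of_transversal A p :
  smooth_branches A (crd p) -> transversal A (crd p) -> ordinary_at A p.
Proof.
move=> sm tr; apply/andP; split.
  rewrite all_map; apply: sub_all sm => g /= nz.
  by rewrite dim_tangent.
rewrite uniq_pairwise pairwise_map; apply: sub_pairwise tr => g h /=.
exact: tangent_neq.
Qed.

(* Since both vectors are orthogonal to w, their cross product is a multiple of w. *)
Lemma independent_coord u v w i : w i != 0 -> dot w u = 0 -> dot w v = 0 ->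
  independent u v = (cross u v i != 0).
Proof.
move=> nz; rewrite !dotE => eu ev.
apply/existsP/idP => [[j]|]; last by exists i.
apply: contraNN => /eqP ci; apply/eqP/(mulIf nz); rewrite mul0r.
have -> : cross u v j * w i = cross u v i * w j; last by rewrite ci mul0r.
have euv l : v l * (w i0 * u i0 + w i1 * u i1 + w i2 * u i2) -
    u l * (w i0 * v i0 + w i1 * v i1 + w i2 * v i2) = 0 by rewrite eu ev !mulr0 subrr.
have := (euv i0, euv i1, euv i2) => -[[e0 e1] e2] {euv ci nz eu ev}.
by elim/ord3P: i; elim/ord3P: j => //; rewrite /cross /vec3 /=; apply/eqP;
  rewrite -subr_eq0; apply/eqP; first
  [rewrite -[RHS]e0; ring | rewrite -[RHS]e1; ring | rewrite -[RHS]e2; ring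
  |rewrite -[RHS]oppr0 -[in RHS]e0; ring | rewrite -[RHS]oppr0 -[in RHS]e1; ring
  |rewrite -[RHS]oppr0 -[in RHS]e2; ring].
Qed.

End OrdinaryPoints.

(** * Tjurina numbers at ordinary points of an arrangement *)

Section OrdinaryTjurina.
Variable K : numFieldType.
Local Notation S := {mpoly K[3]}.
Variables (A : seq S) (p : P2 K).
Hypothesis A_homog : forall g, g \in A -> exists d, g \is d.+1.-homog.
Implicit Types (g h : S).

Local Notation a := (crd p).
Let i := odflt ord0 [pick i : 'I_3 | rep p 0 i != 0].
Let b : 'I_3 -> K := fun j => (a i)^-1 * a j.
Let t : 3.-tuple {mpoly K[2]} :=
  [tuple (if unlift i j is Some k then (rep p 0 j / rep p 0 i)%:MP + 'X_k else 1) | j < 3].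
Local Notation L g := (g \mPo t).

Lemma local_equationE g : local_equation g p = L g. Proof. by []. Qed.

Lemma chart_neq0 : a i != 0.
Proof.
rewrite /i; case: pickP => // z; have /existsP[j] := nonzero_crd p.
by rewrite /crd z.
Qed.

Lemma local_meval g : (L g).@[fun=> 0] = g.@[b].
Proof.
rewrite comp_mpoly_meval; apply: meval_eq => j; rewrite tnth_mktuple.
case: unliftP => [k ->|->]; first by rewrite mevalD mevalC mevalXU addr0 /b mulrC.
by rewrite meval1 /b mulVf ?chart_neq0.
Qed.

Lemma local_mderiv g k : (L g)^`M(k).@[fun=> 0] = grad g b (lift i k).
Proof.
rewrite mderiv_comp rmorph_sum (bigD1 (lift i k)) //= big1 => [|j ne].
  rewrite mevalM local_meval tnth_mktuple liftK mderivD mderivC mderivXi eqxx.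
  by rewrite add0r meval1 mulr1 addr0.
rewrite mevalM tnth_mktuple; case: unliftP ne => [l ->|-> _].
  rewrite mderivD mderivC mderivXi add0r (inj_eq (@lift_inj _ _)) => ne.
  by rewrite eq_sym (negPf ne) meval0 mulr0.
by rewrite -mpolyC1 mderivC meval0 mulr0.
Qed.

(** The gradient without the coordinate of the chart: for a branch, the coefficients of the linear
    part of its local equation. *)
Let tau g : K * K := (grad g b (lift i j0), grad g b (lift i j1)).

Lemma local_linear_part g : g.@[b] = 0 -> in_mpow 2 (L g - lf (tau g)).
Proof.
move=> gb m; rewrite ltnS leq_eqVlt ltnS leqn0 => /orP[/mdeg1P[k /eqP ->]|].
  have e : (L g)@_U_(k) = grad g b (lift i k).
    by rewrite -local_mderiv meval_mcoeff0 mcoeff_deriv mnm0E add0m.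
  rewrite mcoeffB e /lf mcoeffD !mcoeffZ !mcoeffXU.
  by elim/ord2P: k {e} => /=; rewrite mulr1 mulr0 ?addr0 ?add0r subrr.
rewrite mdeg_eq0 => /eqP ->; rewrite mcoeffB -meval_mcoeff0 local_meval gb sub0r.
rewrite (@mpow_homog _ _ 1 (lf (tau g))) ?oppr0 ?mdeg0 //; exact: lf_homog.
Qed.

(** Each branch contributes its linear part to the initial form, and each other member its nonzero
    value at [b]; these values are collected in [c]. *)
Lemma local_initial_form s : exists2 c, c != 0 &
  in_mpow (size (branches s b)).+1
    (L (defpoly s) - line_prod c (map tau (branches s b))).
Proof.
elim: s => [|g s [c c0 IH]].
  exists 1; first exact: oner_neq0.
  by rewrite /defpoly /line_prod !big_nil rmorph1 scale1r subrr => m _; rewrite mcoeff0.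
rewrite [defpoly _]big_cons -/(defpoly s) rmorphM /=.
set Q := L (defpoly s) in IH *; set B := map tau _ in IH *.
have hP : in_mpow (size (branches s b)) (line_prod c B).
  by rewrite -[size (branches s b)](size_map tau); apply/mpow_homog/line_prod_homog.
have hQ : in_mpow (size (branches s b)) Q.
  by rewrite -[Q](subrK (line_prod c B)); apply: mpowD => //; apply: mpow_le IH.
case: (eqVneq g.@[b] 0) => [gb|gb].
  rewrite /branches /= ?gb ?eqxx -/(branches s b) /=.
  exists c => //; have -> : L g * Q - line_prod c (tau g :: B) =
      (L g - lf (tau g)) * Q + lf (tau g) * (Q - line_prod c B).
    by rewrite /line_prod big_cons -!mul_mpolyC; ring.
  apply: mpowD.
    by apply: (@mpowM _ _ 2 (size (branches s b))); first exact: local_linear_part.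
  apply: (@mpowM _ _ 1 (size (branches s b)).+1) => //.
  by apply: mpow_homog; apply: lf_homog.
rewrite /branches /= ?(negPf gb) -/(branches s b).
exists (g.@[b] * c); first by rewrite mulf_neq0.
have -> : L g * Q - line_prod (g.@[b] * c) B =
    (L g - (g.@[b])%:MP) * Q + (g.@[b])%:MP * (Q - line_prod c B).
  by rewrite /line_prod -scalerA -!mul_mpolyC; ring.
apply: mpowD; last by apply: mpowMl.
apply: (@mpowM _ _ 1 (size (branches s b))) => //; apply: mpow1.
by rewrite mevalB mevalC local_meval subrr.
Qed.

Lemma meval_chart g : g \in A -> (g.@[b] == 0) = (g.@[a] == 0).
Proof.
move/A_homog => [d hg]; rewrite (meval_homog _ _ hg) mulf_eq0 expf_eq0.
by rewrite invr_eq0 (negPf chart_neq0) andbF.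
Qed.

Lemma branches_chart : branches A b = branches A a.
Proof. by apply: eq_in_filter => g /meval_chart. Qed.

Lemma grad_chart g : g \in A -> exists2 c, c != 0 & grad g b =1 (fun j => c * grad g a j).
Proof.
move=> /A_homog[d hg]; exists ((a i)^-1 ^+ d).
  by rewrite expf_neq0 // invr_neq0 // chart_neq0.
by move=> j; rewrite /grad (meval_homog _ _ (mderiv_homog j hg)).
Qed.

Lemma dot_grad_chart g : g \in branches A b -> dot b (grad g b) = 0.
Proof.
rewrite mem_filter => /andP[/eqP gb /A_homog[d hg]].
transitivity (d.+1%:R * g.@[b]); last by rewrite gb mulr0.
rewrite -mevalZ -(euler_homog hg) rmorph_sum.
by apply: eq_bigr => j _; rewrite /= mevalM mevalXU.
Qed.

(** By Euler's formula both gradients are orthogonal to [b], so their cross product is a multiple of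
    [b]. As the chart coordinate of [b] is nonzero, the minor that omits it detects independence. *)
Lemma det2_tau g h : g \in branches A b -> h \in branches A b ->
  independent (grad g a) (grad h a) -> det2 (tau g) (tau h) != 0.
Proof.
move=> g_in h_in.
have gA : g \in A by move: g_in; rewrite mem_filter => /andP[].
have hA : h \in A by move: h_in; rewrite mem_filter => /andP[].
have [c c0 ec] := grad_chart gA; have [d d0 ed] := grad_chart hA.
rewrite -(independentZ _ _ c0 d0) -(eq_independent ec ed).
have bi : b i != 0 by rewrite /b mulVf ?oner_eq0 // chart_neq0.
rewrite (independent_coord bi (dot_grad_chart g_in) (dot_grad_chart h_in)).
rewrite /tau /det2 /=; elim/ord3P: (i).
- by rewrite (_ : lift i0 j0 = i1) 1?(_ : lift i0 j1 = i2) //; apply: val_inj.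
- rewrite (_ : lift i1 j0 = i0) 1?(_ : lift i1 j1 = i2); try exact: val_inj.
  by rewrite /cross /vec3 /= -oppr_eq0 opprB.
by rewrite (_ : lift i2 j0 = i0) 1?(_ : lift i2 j1 = i1) //; apply: val_inj.
Qed.

Theorem tjurina_ordinary : transversal A a ->
  (2 <= mult_at A p <= 4)%N -> tjurina_at (defpoly A) p ((mult_at A p).-1 ^ 2).
Proof.
move=> tr; rewrite mult_at_branches -branches_chart.
have [c c0 hc] := local_initial_form A; set B := map tau _ in hc.
have sz_B : size B = size (branches A b) by rewrite size_map.
move=> /andP[ge2 le4]; have [k ek] : exists k, size (branches A b) = k.+2.
  by exists (size (branches A b)).-2; case: (size _) ge2 => [|[]].
rewrite /tjurina_at local_equationE ek /=.
set G := L _ in hc *; rewrite -[G](subrK (line_prod c B)) addrC.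
have hB := line_prod_homog c B; rewrite sz_B ek in hB.
rewrite ek in hc le4.
apply: local_colength_homog => // u v hu hv; apply: (sylvester_inj c0 _ _ hu hv).
  by rewrite sz_B ek.
rewrite pairwise_map /B; move: tr; rewrite /transversal -branches_chart.
move: (branches A b) (fun g => @det2_tau g) => s.
elim: s => //= g s IH det /andP[tr1 tr2]; apply/andP; split.
  apply/allP => h h_in /=; apply: det; rewrite ?mem_head ?in_cons ?h_in ?orbT //.
  exact: (allP tr1).
by apply: IH => // g' h' g'_in h'_in; apply: det; rewrite in_cons ?g'_in ?h'_in orbT.
Qed.

End OrdinaryTjurina.

(** * Arrangements whose multiple points are listed explicitly *)

Section EnumeratedPoints.
Variable K : numFieldType.
Local Notation S := {mpoly K[3]}.
Variables (A : seq S) (T : eqType) (emb : T -> 'I_3 -> K) (pts : seq T).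
Implicit Types (p : P2 K) (g h : S) (v w : 'I_3 -> K).
Hypothesis A_members : forall g, g \in A -> is_line g \/ is_smooth_conic g.
Hypothesis pts_nonzero : forall x, x \in pts -> nonzero (emb x).
Hypothesis pts_independent : pairwise (fun x y => independent (emb x) (emb y)) pts.
Hypothesis pts_transversal : forall x, x \in pts -> transversal A (emb x).
(** The list has to contain all multiple points but may also contain simple ones; thus one list
    serves both arrangements, and the multiplicities are filtered afterwards. *)
Hypothesis pts_cover : forall p, (2 <= mult_at A p)%N ->
  exists2 x, x \in pts & p = point (emb x).

Local Notation mult x := (size (branches A (emb x))).
Local Notation P x := (point (emb x)).

Lemma member_homog g : g \in A -> exists d, g \is d.+1.-homog.
Proof. by case/A_members => -[_ hg]; [exists 0%N | exists 1%N]. Qed.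

Lemma member_smooth g p : g \in A -> g.@[crd p] = 0 -> nonzero (grad g (crd p)).
Proof.
case/A_members => [[g0 hg] gp|[_ _ /(_ p)]].
  apply: contraNT g0; rewrite negb_exists => /forallP z.
  have hd i : g^`M(i) = 0.
    have h0 : g^`M(i) \is 0.-homog by apply: mderiv_homog.
    have e : g^`M(i) = (g^`M(i)@_0%MM)%:MP.
      apply/mpolyP => m; rewrite mcoeffC; case: (eqVneq m 0%MM) => [->|nz].
        by rewrite mulr1.
      by rewrite mulr0; apply: (dhomog_nemf_coeff h0); rewrite /= mdeg_eq0.
    have := negPn (z i); rewrite /grad e mevalC => /eqP ->.
    by rewrite mpolyC0.
  have := euler_homog hg; rewrite scale1r => <-.
  by rewrite big1 // => i _; rewrite hd mulr0.
by rewrite /singular on_curveE => + gp; rewrite gp eqxx negb_forall.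
Qed.

Lemma all_smooth p : smooth_branches A (crd p).
Proof. by apply/allP => g; rewrite mem_filter => /andP[/eqP gp /member_smooth ->]. Qed.

Lemma branches_point v : nonzero v -> branches A (crd (point v)) = branches A v.
Proof.
move=> nz; have [c c0 ev] := point_crd nz; apply: eq_in_filter => g /member_homog[d hg].
by rewrite (meval_eq _ ev) (meval_homog _ _ hg) mulf_eq0 expf_eq0 (negPf c0) andbF.
Qed.

Lemma transversal_point v : nonzero v -> transversal A v -> transversal A (crd (point v)).
Proof.
move=> nz; have [c c0 ev] := point_crd nz; rewrite /transversal branches_point //.
have eg g : g \in branches A v -> exists2 k, k != 0 &
    grad g (crd (point v)) =1 (fun j => k * grad g v j).
  rewrite mem_filter => /andP[_ /member_homog[d hg]]; exists (c ^+ d).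
    by rewrite expf_neq0.
  by move=> j; rewrite /grad (meval_eq _ ev) (meval_homog _ _ (mderiv_homog j hg)).
elim: (branches A v) eg => //= g s IH eg /andP[tr1 tr2]; apply/andP; split.
  apply/allP => h h_in /=.
  have [k k0 ek] := eg g (mem_head _ _).
  have [l l0 el] : exists2 l, l != 0 & grad h (crd (point v)) =1 (fun j => l * grad h v j).
    by apply: eg; rewrite in_cons h_in orbT.
  by rewrite (eq_independent ek el) independentZ //; apply: (allP tr1).
by apply: IH => // h h_in; apply: eg; rewrite in_cons h_in orbT.
Qed.

Lemma mult_point x : x \in pts -> mult_at A (P x) = mult x.
Proof. by move=> x_in; rewrite mult_at_branches branches_point ?pts_nonzero. Qed.

Lemma uniq_points s : subseq s pts -> uniq [seq P x | x <- s].
Proof.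
move=> sub; rewrite uniq_pairwise pairwise_map.
have nz x : x \in s -> nonzero (emb x) by move/(mem_subseq sub)/pts_nonzero.
have : pairwise (fun x y => independent (emb x) (emb y)) s.
  exact: subseq_pairwise sub pts_independent.
elim: s nz {sub} => //= x s IH nz /andP[ind1 ind2]; apply/andP; split; last first.
  by apply: IH => // y y_in; apply: nz; rewrite in_cons y_in orbT.
apply/allP => y y_in; apply: contraTneq (allP ind1 y y_in) => e.
have nzy : nonzero (emb y) by apply: nz; rewrite in_cons y_in orbT.
have [c ec] := point_eq (nz x (mem_head _ _)) nzy e.
rewrite negb_exists; apply/forallP => i; rewrite negbK /cross.
by apply/eqP; elim/ord3P: i; rewrite /vec3 /= !ec; ring.
Qed.

Lemma mem_points (a : pred nat) p : (forall r, a r -> 2 <= r)%N ->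
  (p \in [seq P x | x <- pts & a (mult x)]) = a (mult_at A p).
Proof.
move=> a_ge2; apply/mapP/idP => [[x]|ap].
  by rewrite mem_filter => /andP[ax x_in] ->; rewrite mult_point.
have [x x_in ep] := pts_cover (a_ge2 _ ap); exists x => //.
by rewrite mem_filter x_in andbT -mult_point // -ep.
Qed.

Lemma n_points_count r : (2 <= r)%N -> n_points A r (count (fun x => mult x == r) pts).
Proof.
move=> r_ge2; exists [seq P x | x <- pts & mult x == r]; split.
- by apply: uniq_points; apply: filter_subseq.
- by rewrite size_map size_filter.
by move=> p; rewrite (@mem_points (pred1 r)) // => k /eqP ->.
Qed.

Lemma mult_le k : (1 <= k)%N -> all (fun x => mult x <= k)%N pts ->
  forall p, (mult_at A p <= k)%N.
Proof.
move=> k_gt0 /allP le_k p; case: (leqP (mult_at A p) 1) => [le1|ge2].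
  exact: leq_trans le1 k_gt0.
have [x x_in ep] := pts_cover ge2.
by rewrite ep mult_point //; apply: le_k.
Qed.

Lemma ordinary_point x : x \in pts -> ordinary_at A (P x).
Proof.
move=> x_in; apply: ordinary_of_transversal; first exact: all_smooth.
by apply: transversal_point; [exact: pts_nonzero | exact: pts_transversal].
Qed.

Lemma singular_mult p : singular (defpoly A) p = (2 <= mult_at A p)%N.
Proof. exact/singular_defpoly/all_smooth. Qed.

Lemma ordinary_mult_le_of k : (1 <= k)%N -> all (fun x => mult x <= k)%N pts ->
  ordinary_mult_le A k.
Proof.
move=> k_gt0 le_k p; rewrite singular_mult => ge2; split; last exact: mult_le.
by have [x x_in ->] := pts_cover ge2; apply: ordinary_point.
Qed.

Lemma total_tjurina_sum : all (fun x => mult x <= 4)%N pts ->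
  total_tjurina (defpoly A)
    (sumn [seq ((mult x).-1 ^ 2)%N | x <- pts & (2 <= mult x)%N]).
Proof.
move=> /allP le4; exists [seq P x | x <- pts & (2 <= mult x)%N].
exists (fun p => ((mult_at A p).-1 ^ 2)%N); split.
- by apply: uniq_points; apply: filter_subseq.
- by move=> p; rewrite singular_mult; apply: (@mem_points (leq 2)).
- move=> p /mapP[x]; rewrite mem_filter => /andP[ge2 x_in] ->.
  apply: tjurina_ordinary; first exact: member_homog.
    by apply: transversal_point; [exact: pts_nonzero | exact: pts_transversal].
  by rewrite mult_point // ge2 le4.
rewrite sumnE !big_map big_seq [RHS]big_seq; apply: eq_bigr => x.
by rewrite mem_filter => /andP[_ x_in]; rewrite mult_point.
Qed.

End EnumeratedPoints.

Section LineConicIntersection.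
Variable K : numFieldType.
Implicit Types (u v w x : 'I_3 -> K).

Lemma line_line_meet u v w x : independent u v -> nonzero w ->
  cross (cross u v) w =1 (fun=> 0) -> dot u x = 0 -> dot v x = 0 ->
  exists c, forall i, x i = c * w i.
Proof.
move=> ind nzw cw ux vx.
have cx : cross (cross u v) x =1 (fun=> 0).
  move=> i; transitivity (v i * dot u x - u i * dot v x); last by rewrite ux vx !mulr0 subrr.
  by rewrite !dotE /cross; elim/ord3P: i; rewrite /vec3 /=; ring.
have [c ec] := cross_proportional ind cw; have [d ed] := cross_proportional ind cx.
have c0 : c != 0.
  have /existsP[i nz] := nzw; by move: nz; rewrite ec mulf_eq0 negb_or => /andP[].
by exists (d / c); move=> i; rewrite ed ec mulrA divfK.
Qed.

Lemma coplanar_dot u w1 w2 x : nonzero u -> dot u w1 = 0 -> dot u w2 = 0 -> dot u x = 0 ->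
  dot x (cross w1 w2) = 0.
Proof.
move=> /existsP[j nz] e1 e2 ex; apply: (mulIf nz); rewrite mul0r.
transitivity (dot u x * cross w1 w2 j + dot u w1 * cross w2 x j + dot u w2 * cross x w1 j).
  by rewrite !dotE /cross; elim/ord3P: j {nz}; rewrite /vec3 /=; ring.
by rewrite e1 e2 ex !mul0r !addr0.
Qed.

(** For w1 and w2 on the conic, q(a w1 + b w2) = a b q(w1 + w2). Since q(w1 + w2) is nonzero, a
    point of their line on the conic has a = 0 or b = 0. *)
Lemma line_conic_meet u w1 w2 x (q := fun v => (conic4 K).@[v]) :
  nonzero u -> independent w1 w2 -> q (fun i => w1 i + w2 i) != 0 ->
  dot u w1 = 0 -> dot u w2 = 0 -> dot u x = 0 -> q w1 = 0 -> q w2 = 0 -> q x = 0 ->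
  exists c, (forall i, x i = c * w1 i) \/ (forall i, x i = c * w2 i).
Proof.
move=> nzu /existsP[l nzl] q12 e1 e2 ex q1 q2 qx.
pose n i : K := (i == l)%:R.
have nE : dot n (cross w1 w2) = cross w1 w2 l.
  by rewrite dotE /n; elim/ord3P: (l) => /=; ring.
pose a := dot n (cross x w2); pose b := dot n (cross w1 x); set k := cross w1 w2 l in nzl nE.
have xE i : k * x i = a * w1 i + b * w2 i.
  by rewrite -nE cramer3 (coplanar_dot nzu e1 e2 ex) mul0r add0r.
have qE v : q v = - v i0 ^+ 2 + v i0 * v i1 - v i1 ^+ 2 + v i2 ^+ 2.
  rewrite /q /conic4; do !rewrite ?mevalD ?mevalN ?mevalM ?mevalXU ?rmorphXn /=.
  by [].
have : a * b * q (fun i => w1 i + w2 i) = 0.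
  transitivity (k ^+ 2 * q x - (a ^+ 2 - a * b) * q w1 - (b ^+ 2 - a * b) * q w2).
    have -> : k ^+ 2 * q x = q (fun i => a * w1 i + b * w2 i).
      by rewrite !qE -!xE; ring.
    by rewrite !qE; ring.
  by rewrite qx q1 q2 !mulr0 !subr0.
move/eqP; rewrite mulf_eq0 (negPf q12) orbF mulf_eq0 => /orP[] /eqP z.
  exists (k^-1 * b); right; move=> i; apply: (mulfI nzl); rewrite xE z mul0r add0r.
  by rewrite !mulrA divff // mul1r.
exists (k^-1 * a); left; move=> i; apply: (mulfI nzl); rewrite xE z mul0r addr0.
by rewrite !mulrA divff // mul1r.
Qed.

End LineConicIntersection.

(** * Coordinates in Z[sqrt 3, i] *)

(* (a, b, c, d) stands for a + b sqrt 3 + (c + d sqrt 3) i. *)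
Definition z4 : Type := Z * Z * Z * Z.

Definition z4add (x y : z4) : z4 :=
  let: (a, b, c, d) := x in let: (a', b', c', d') := y in
  (a + a', b + b', c + c', d + d')%BZ.

Definition z4mul (x y : z4) : z4 :=
  let: (a, b, c, d) := x in let: (a', b', c', d') := y in
  (a * a' + 3 * (b * b') - (c * c' + 3 * (d * d')),
   a * b' + b * a' - (c * d' + d * c'),
   a * c' + 3 * (b * d') + (c * a' + 3 * (d * b')),
   a * d' + b * c' + (c * b' + d * a'))%BZ.

Definition z4int (a : Z) : z4 := (a, 0, 0, 0)%BZ.
Definition z4sub (x y : z4) : z4 := z4add x (z4mul (z4int (-1)%BZ) y).
Definition z4is0 (x : z4) : bool :=
  let: (a, b, c, d) := x in [&& Z.eqb a 0, Z.eqb b 0, Z.eqb c 0 & Z.eqb d 0].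

Definition z4vec : Type := z4 * z4 * z4.

Definition z4cross (u v : z4vec) : z4vec :=
  let: (a, b, c) := u in let: (a', b', c') := v in
  (z4sub (z4mul b c') (z4mul c b'), z4sub (z4mul c a') (z4mul a c'),
   z4sub (z4mul a b') (z4mul b a')).

Definition z4vec_add (u v : z4vec) : z4vec :=
  (z4add u.1.1 v.1.1, z4add u.1.2 v.1.2, z4add u.2 v.2).

Definition z4vec_is0 (u : z4vec) : bool :=
  [&& z4is0 u.1.1, z4is0 u.1.2 & z4is0 u.2].

Definition z4pow (x : z4) (n : nat) : z4 := iter n (z4mul x) (z4int 1%BZ).

Definition z4eval (v : z4vec) (p : zpoly) : z4 :=
  foldr (fun t acc => let: (a, b, c) := t.1 in
    z4add (z4mul (z4int t.2) (z4mul (z4mul (z4pow v.1.1 a) (z4pow v.1.2 b)) (z4pow v.2 c)))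
      acc) (z4int 0%BZ) p.

Definition z4grad (v : z4vec) (p : zpoly) : z4vec :=
  (z4eval v (zder 0 p), z4eval v (zder 1 p), z4eval v (zder 2 p)).

(** The 3-adic valuation is even on the left and odd on the right. This is the irrationality of sqrt
    3, which makes the zero test on quadruples exact. *)
Lemma sqr_eq_3sqr (a b : nat) : (a * a = 3 * (b * b))%N -> b = 0%N.
Proof.
move=> e; case: (posnP b) => // b_gt0; case: (posnP a) => [a0|a_gt0].
  by move: e; rewrite a0; lia.
have := congr1 (logn 3) e; rewrite !lognM // ?muln_gt0 ?b_gt0 //.
by rewrite (_ : logn 3 3 = 1%N) //; lia.
Qed.

#[local] Arguments Z.mul : simpl never.

Section RealEmbedding.
Variable R : realType.
Local Notation C := R[i].
Definition sqrt3 : R := Num.sqrt 3.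
Local Notation s := sqrt3.

Definition ev4 (x : z4) : C :=
  let: (a, b, c, d) := x in Complex (zr R a + zr R b * s) (zr R c + zr R d * s).

Lemma sqrt3K : s * s = 3.
Proof. by rewrite -expr2 /sqrt3 sqr_sqrtr ?ler0n. Qed.

Lemma zr3 : zr R 3 = 3.
Proof. by []. Qed.

Lemma ev4D x y : ev4 (z4add x y) = ev4 x + ev4 y.
Proof.
case: x y => [[[a b] c] d] [[[a' b'] c'] d'] /=.
by apply/eqP; rewrite eq_complex /= !zrD; apply/andP; split; apply/eqP; ring.
Qed.

Lemma ev4M x y : ev4 (z4mul x y) = ev4 x * ev4 y.
Proof.
case: x y => [[[a b] c] d] [[[a' b'] c'] d'] /=.
have e (x y x' y' : R) : (x + y * s) * (x' + y' * s) =
    x * x' + 3 * (y * y') + (x * y' + y * x') * s.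
  by rewrite -{1}sqrt3K; ring.
apply/eqP; rewrite eq_complex /= !(zrD, zrB, zrM) !e zr3.
by apply/andP; split; apply/eqP; ring.
Qed.

Lemma ev4_int a : ev4 (z4int a) = zr C a.
Proof.
rewrite /= zr0 !mul0r !addr0 -[RHS](rmorph_int (real_complex R)).
by [].
Qed.

Lemma ev4_sub x y : ev4 (z4sub x y) = ev4 x - ev4 y.
Proof. by rewrite ev4D ev4M ev4_int mulN1r. Qed.

Lemma ev4_pow x n : ev4 (z4pow x n) = ev4 x ^+ n.
Proof. by elim: n => [|n IH]; rewrite ?ev4_int // exprS -IH -ev4M. Qed.

Lemma zr_sqrt3_eq0 (a b : Z) : zr R a + zr R b * s = 0 -> a = 0%BZ /\ b = 0%BZ.
Proof.
move=> e; have e2 : zr R (a * a - 3 * (b * b))%BZ = 0.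
  have ea : zr R a = - (zr R b * s) by apply/eqP; rewrite -addr_eq0 e.
  by rewrite !(zrD, zrB, zrM) ea zr3 -sqrt3K; ring.
move/eqP: e2; rewrite zr_eq0 => /Z.eqb_spec e2.
have b0 : b = 0%BZ.
  have h : (Z.abs_nat a * Z.abs_nat a = 3 * (Z.abs_nat b * Z.abs_nat b))%N by nia.
  by have := sqr_eq_3sqr h; lia.
by split=> //; rewrite b0 in e2; lia.
Qed.

(** Both directions are used: incidences need vanishing, while independence and the exact
    multiplicities need nonvanishing. *)
Lemma ev4_eq0 x : (ev4 x == 0) = z4is0 x.
Proof.
case: x => [[[a b] c] d] /=; rewrite eq_complex /=.
apply/andP/and4P => [[/eqP/zr_sqrt3_eq0[-> ->] /eqP/zr_sqrt3_eq0[-> ->]]|] //.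
by case=> /Z.eqb_spec-> /Z.eqb_spec-> /Z.eqb_spec-> /Z.eqb_spec->; rewrite !zr0 !mul0r !addr0.
Qed.

#[local] Arguments ev4 : simpl never.
#[local] Arguments z4int : simpl never.
#[local] Arguments z4add : simpl never.
#[local] Arguments z4mul : simpl never.

Definition emb4 (v : z4vec) : 'I_3 -> C := vec3 (ev4 v.1.1) (ev4 v.1.2) (ev4 v.2).

Lemma ev4_eval v p : ev4 (z4eval v p) = (zmp C p).@[emb4 v].
Proof.
rewrite /zmp rmorph_zev (@eq_zev _ _ (emb4 v)) => [|i]; last by rewrite /= mevalXU.
elim: p => [|[[[a b] c] k] p IH] /=; first by rewrite zev_nil ev4_int zr0.
by rewrite ev4D !ev4M ev4_int !ev4_pow IH zev_cons.
Qed.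

Lemma emb4_grad v p : emb4 (z4grad v p) =1 grad (zmp C p) (emb4 v).
Proof. by apply: ord3P; rewrite /emb4 /vec3 /= ev4_eval /grad -zmp_der. Qed.

Lemma emb4_cross u v : emb4 (z4cross u v) =1 cross (emb4 u) (emb4 v).
Proof.
case: u v => [[a b] c] [[a' b'] c'].
by apply: ord3P; rewrite /emb4 /cross /vec3 /= ev4_sub !ev4M.
Qed.

Lemma emb4_add u v : emb4 (z4vec_add u v) =1 (fun i => emb4 u i + emb4 v i).
Proof. by apply: ord3P; rewrite /emb4 /vec3 /= ev4D. Qed.

Lemma emb4_nonzero v : nonzero (emb4 v) = ~~ z4vec_is0 v.
Proof.
apply/existsP/idP => [[j nz]|].
  apply: contraNN nz => /and3P[e0 e1 e2]; rewrite /emb4 /vec3.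
  by elim/ord3P: j; rewrite /= ev4_eq0.
rewrite /z4vec_is0 !negb_and -!ev4_eq0 => /or3P[nz|nz|nz].
- by exists i0.
- by exists i1.
by exists i2.
Qed.

Lemma emb4_is0 v i : z4vec_is0 v -> emb4 v i = 0.
Proof.
move=> /and3P[e0 e1 e2]; apply/eqP; rewrite /emb4 /vec3.
by elim/ord3P: i; rewrite /= ev4_eq0.
Qed.

End RealEmbedding.


(** * Certificates for the two arrangements *)

Definition tm (a b c : nat) (z : Z) : zmon * Z := ((a, b, c), z).

Definition zline (l : Z * Z * Z) : zpoly := [:: tm 1 0 0 l.1.1; tm 0 1 0 l.1.2; tm 0 0 1 l.2].

Definition line_coefs : seq (Z * Z * Z) :=
  [:: (1, 0, 0); (0, 1, 0); (0, 0, 1); (1, 0, -1); (1, 0, 1); (0, 1, 1); (0, 1, -1);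
      (-1, 1, -1); (-1, 1, 1); (-1, 1, 0); (1, 1, 0)]%BZ.

Definition zlines : seq zpoly := [seq zline l | l <- line_coefs].
Definition zconic : zpoly := [:: tm 2 0 0 (-1); tm 1 1 0 1; tm 0 2 0 (-1); tm 0 0 2 1].
Definition zCL4 : seq zpoly := rcons zlines zconic.

(* The last four points lie on the conic and on one of the lines x + y = 0, z = 0;
   the other ones are the multiple points of the line arrangement. *)
Definition z4pts : seq z4vec :=
  [seq (z4int p.1.1, z4int p.1.2, z4int p.2) | p <-
    [:: (0, 0, 1); (0, 1, -1); (0, 1, 0); (0, 1, 1); (1, -1, -2); (1, -1, -1); (1, -1, 0);
        (1, -1, 1); (1, -1, 2); (1, 0, -1); (1, 0, 0); (1, 0, 1); (1, 1, -1); (1, 1, 0);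
        (1, 1, 1); (1, 2, -1); (1, 2, 1); (2, 1, -1); (2, 1, 1)]%BZ] ++
  [:: (z4int 1, z4int (-1), (0, 1, 0, 0)); (z4int 1, z4int (-1), (0, -1, 0, 0));
      (z4int 2, (1, 0, 0, 1), z4int 0); (z4int 2, (1, 0, 0, -1), z4int 0)]%BZ.

(* r1 and r2 are a basis of the Jacobian syzygies. The scalar products of w0 and w1
   with the gradient, restricted to the line z = 4x - 2y, are n0 x^M and n1 y^M, with
   the constants and the exponent M of free_check_CL4 and free_check_lines below; they
   were obtained by solving linear systems over Q. *)
Definition r1_CL4 : seq zpoly :=
  [::
   [:: tm 5 0 0 4; tm 4 1 0 (-7); tm 3 2 0 (-2); tm 3 0 2 (-12); tm 2 3 0 6;
      tm 2 1 2 9; tm 1 4 0 (-9); tm 1 2 2 27];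
   [:: tm 4 1 0 (-9); tm 3 2 0 6; tm 2 3 0 (-2); tm 2 1 2 27; tm 1 4 0 (-7);
      tm 1 2 2 9; tm 0 5 0 4; tm 0 3 2 (-12)];
   [:: tm 4 0 1 (-9); tm 3 1 1 6; tm 2 2 1 24; tm 2 0 3 1; tm 1 3 1 6; tm 1 1 3 (-4);
      tm 0 4 1 (-9); tm 0 2 3 1]].

Definition r2_CL4 : seq zpoly :=
  [::
   [:: tm 7 0 0 5064; tm 6 1 0 (-7014); tm 5 2 0 (-5235); tm 5 0 2 (-15129);
      tm 4 3 0 5742; tm 4 1 2 5734; tm 3 4 0 (-8883); tm 3 2 2 36699; tm 3 0 4 (-182);
      tm 2 5 0 (-3366); tm 2 3 2 13806; tm 2 1 4 132; tm 1 6 0 (-1188); tm 1 4 2 3393;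
      tm 1 2 4 468; tm 1 0 6 (-9)];
   [:: tm 6 1 0 (-11394); tm 5 2 0 3438; tm 4 3 0 (-945); tm 4 1 2 34011;
      tm 3 4 0 (-9000); tm 3 2 2 24012; tm 2 5 0 1569; tm 2 3 2 (-7527); tm 2 1 4 468;
      tm 1 6 0 924; tm 1 4 2 (-4472); tm 1 2 4 132; tm 0 7 0 528; tm 0 5 2 (-1521);
      tm 0 3 4 (-182); tm 0 1 6 (-9)];
   [:: tm 6 0 1 (-11394); tm 5 1 1 3438; tm 4 2 1 31932; tm 4 0 3 1134; tm 3 3 1 19548;
      tm 3 1 3 (-4536); tm 2 4 1 (-5490); tm 1 5 1 (-3366); tm 1 1 5 (-50);
      tm 0 6 1 (-1188); tm 0 0 7 4]].

Definition w0_CL4 : seq zpoly :=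
  [::
   [:: tm 6 0 0 326530988448404488; tm 5 1 0 (-636033624600915919);
      tm 4 2 0 (-54349271400255768); tm 3 3 0 383970955059071555;
      tm 2 4 0 (-119114702854930224); tm 1 5 0 3742775367020820];
   [:: tm 6 0 0 420420000; tm 5 1 0 (-394263134708623848); tm 4 2 0 117009544104376897;
      tm 3 3 0 465643094615045320; tm 2 4 0 (-361586768440524621);
      tm 1 5 0 81686949184722024; tm 0 6 0 (-3742775367020820)];
   [:: tm 6 0 0 (-193496780191243328); tm 5 1 0 811998054192597200;
      tm 4 2 0 (-1183356258594611480); tm 3 3 0 668979062213907120;
      tm 2 4 0 (-128056753299172632)]].

Definition w1_CL4 : seq zpoly :=
  [::
   [:: tm 6 0 0 1132483288529068032; tm 5 1 0 (-2201088848605607076);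
      tm 4 2 0 (-516192010121014087); tm 3 3 0 1671023563623759965;
      tm 2 4 0 (-504645794832101156); tm 1 5 0 16987621446495180; tm 0 6 0 1681680000];
   [:: tm 5 1 0 (-1836967896559300572); tm 4 2 0 912611721535929468;
      tm 3 3 0 1613843079448515705; tm 2 4 0 (-1408701797678817919);
      tm 1 5 0 334770301948009356; tm 0 6 0 (-16987587812895180)];
   [:: tm 6 0 0 (-471271767496287792); tm 5 1 0 2535256956878493960;
      tm 4 2 0 (-4139875823986646680); tm 3 3 0 2467998064185769040;
      tm 2 4 0 (-486565368172876608)]].

Definition r1_L : seq zpoly :=
  [::
   [:: tm 5 0 0 4; tm 4 1 0 (-6); tm 3 2 0 (-4); tm 3 0 2 (-10); tm 2 3 0 5;
      tm 2 1 2 7; tm 1 4 0 (-7); tm 1 2 2 23];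
   [:: tm 4 1 0 (-7); tm 3 2 0 5; tm 2 3 0 (-4); tm 2 1 2 23; tm 1 4 0 (-6);
      tm 1 2 2 7; tm 0 5 0 4; tm 0 3 2 (-10)];
   [:: tm 4 0 1 (-7); tm 3 1 1 5; tm 2 2 1 18; tm 2 0 3 1; tm 1 3 1 5; tm 1 1 3 (-4);
      tm 0 4 1 (-7); tm 0 2 3 1]].

Definition r2_L : seq zpoly :=
  [::
   [:: tm 5 0 0 40; tm 4 1 0 (-56); tm 3 2 0 (-45); tm 3 0 2 (-99); tm 2 3 0 43;
      tm 2 1 2 67; tm 1 4 0 (-70); tm 1 2 2 253; tm 1 0 4 (-7)];
   [:: tm 4 1 0 (-70); tm 3 2 0 43; tm 2 3 0 (-45); tm 2 1 2 253; tm 1 4 0 (-56);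
      tm 1 2 2 67; tm 0 5 0 40; tm 0 3 2 (-99); tm 0 1 4 (-7)];
   [:: tm 4 0 1 (-70); tm 3 1 1 43; tm 2 2 1 208; tm 1 3 1 43; tm 1 1 3 (-32);
      tm 0 4 1 (-70); tm 0 0 5 4]].

Definition w0_L : seq zpoly :=
  [::
   [:: tm 4 0 0 12023255196; tm 3 1 0 (-14388050611); tm 2 2 0 4057234929;
      tm 1 3 0 (-111035210)];
   [:: tm 4 0 0 258720; tm 3 1 0 9921753409; tm 2 2 0 (-13608177297);
      tm 1 3 0 6145804676; tm 0 4 0 (-904107204)];
   [:: tm 4 0 0 (-23551071516); tm 3 1 0 41070047862; tm 2 2 0 (-24537874944);
      tm 1 3 0 5741296110; tm 0 4 0 (-388291332)]].

Definition w1_L : seq zpoly :=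
  [::
   [:: tm 4 0 0 (-17877802475676); tm 3 1 0 26850234986762; tm 2 2 0 (-12171743091365);
      tm 1 3 0 1390464636285; tm 0 4 0 25872000];
   [:: tm 3 1 0 (-17561971903619); tm 2 2 0 26395603167923; tm 1 3 0 (-12487554257442);
      tm 0 4 0 1845089985144];
   [:: tm 4 0 0 36565852479156; tm 3 1 0 (-73234314977934); tm 2 2 0 49868578828662;
      tm 1 3 0 (-13180789257354); tm 0 4 0 1071652297806]].

(* The line z = 4x - 2y passes through no singular point. *)
Definition zline_restr : zpoly := [:: tm 1 0 0 4; tm 0 1 0 (-2)].

Definition zdot (u v : seq zpoly) : zpoly :=
  let c i := zmul (nth [::] u i) (nth [::] v i) in zadd (zadd (c 0%N) (c 1%N)) (c 2%N).

Definition zcross (u v : seq zpoly) : seq zpoly :=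
  let m i j := zmul (nth [::] u i) (nth [::] v j) in
  [:: zsub (m 1 2) (m 2 1); zsub (m 2 0) (m 0 2); zsub (m 0 1) (m 1 0)]%N.

Definition zscale (c : Z) (p : zpoly) : zpoly := [seq (t.1, (c * t.2)%BZ) | t <- p].

Definition zeq (p q : zpoly) : bool := all (fun t => Z.eqb t.2 0) (zsub p q).

(** The hypotheses of [free_of_cross] as a computation. [c] is the factor between the cross product
    and the gradient; [n0] and [n1] are the common denominators cleared from [w0] and [w1]. *)
Definition free_check (fz : zpoly) (d1 d2 M : nat) (c n0 n1 : Z)
    (r1 r2 w0 w1 : seq zpoly) : bool :=
  let g := [:: zder 0 fz; zder 1 fz; zder 2 fz] in
  let gs := [seq zsubst zline_restr (d1 + d2) p | p <- g] in
  let x := zcross r1 r2 in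
  [&& zhomog (d1 + d2).+1 fz, all (zhomog d1) r1, all (zhomog d2) r2,
      ~~ Z.eqb c 0, ~~ Z.eqb n0 0, ~~ Z.eqb n1 0 &
  [&& zeq (nth [::] x 0) (zscale c (nth [::] g 0)),
      zeq (nth [::] x 1) (zscale c (nth [::] g 1)),
      zeq (nth [::] x 2) (zscale c (nth [::] g 2)),
      all (zdeg_le3 (d1 + d2)) g,
      zeq (zdot w0 gs) [:: tm M 0 0 n0] & zeq (zdot w1 gs) [:: tm 0 M 0 n1]]].

Lemma free_check_homog fz d1 d2 M c n0 n1 r1 r2 w0 w1 :
  free_check fz d1 d2 M c n0 n1 r1 r2 w0 w1 -> zhomog (d1 + d2).+1 fz.
Proof. by case/andP. Qed.

Section FreeCheck.
Variable K : numFieldType.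
Local Notation S := {mpoly K[3]}.
Local Notation zvec u := (fun i : 'I_3 => zmp K (nth [::] u i)).

Lemma zmp_eq p q : zeq p q -> zmp K p = zmp K q.
Proof.
move=> /allP e; apply/eqP; rewrite -subr_eq0 /zmp -zev_sub /zev.
by rewrite big_seq big1 // => t /e /Z.eqb_spec ->; rewrite zr0 mul0r.
Qed.

Lemma zr_mpolyC c : zr S c = (zr K c)%:MP.
Proof. by rewrite /zr rmorph_int. Qed.

Lemma zmp_scale c p : zmp K (zscale c p) = zr K c *: zmp K p.
Proof.
rewrite -mul_mpolyC -zr_mpolyC /zmp /zscale /zev big_map mulr_sumr.
by apply: eq_bigr => t _; rewrite zrM mulrA.
Qed.

Lemma zmp_dot u v : zmp K (zdot u v) = dot (zvec u) (zvec v).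
Proof. by rewrite dotE /zmp !zev_add !zev_mul. Qed.

Lemma zmp_cross u v (i : 'I_3) : zmp K (nth [::] (zcross u v) i) = cross (zvec u) (zvec v) i.
Proof. by elim/ord3P: i; rewrite /cross /vec3 /= /zmp zev_sub !zev_mul. Qed.

Lemma zmp_zline_restr : zmp K zline_restr = 4 *: 'X_i0 + (-2) *: 'X_i1.
Proof.
rewrite /zmp !zev_cons zev_nil /= !expr0 !expr1 !mulr1 mul1r addr0 !zr_mpolyC.
by rewrite !mul_mpolyC.
Qed.

Lemma zmp_subst d p : zdeg_le3 d p -> zmp K (zsubst zline_restr d p) =
  zmp K p \mPo [tuple 'X_i0; 'X_i1; 4 *: 'X_i0 + (-2) *: 'X_i1].
Proof.
move=> dp; rewrite /zmp zev_subst // rmorph_zev; apply: eq_zev.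
by apply: ord3P; rewrite /= comp_mpolyXU // -zmp_zline_restr.
Qed.

Lemma free_of_check fz d1 d2 M c n0 n1 r1 r2 w0 w1 : (d1 <= d2)%N ->
  free_check fz d1 d2 M c n0 n1 r1 r2 w0 w1 -> free_with_exponents (zmp K fz) d1 d2.
Proof.
move=> le_d; case/and3P=> hf /(all_nthP [::]) hr1 /and5P[/(all_nthP [::]) hr2 c0 n00 n10 ck].
case/and5P: ck => /zmp_eq x0 /zmp_eq x1 /zmp_eq x2 dg /andP[/zmp_eq ew0 /zmp_eq ew1].
have homog_nth d (r : seq zpoly) (hr : forall i, (i < size r)%N -> zhomog d (nth [::] r i))
    (i : 'I_3) : zmp K (nth [::] r i) \is d.-homog.
  case: (ltnP i (size r)) => [/hr|le_i]; first exact: zmp_homog.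
  by rewrite nth_default // /zmp zev_nil rpred0.
pose wv (n : Z) w : 'I_3 -> S := fun i => (zr K n)^-1 *: zmp K (nth [::] w i).
have sub_g (i : 'I_3) : zmp K (nth [::] [seq zsubst zline_restr (d1 + d2) p |
      p <- [:: zder 0 fz; zder 1 fz; zder 2 fz]] i) =
    (zmp K fz)^`M(i) \mPo [tuple 'X_i0; 'X_i1; 4 *: 'X_i0 + (-2) *: 'X_i1].
  rewrite (nth_map [::]) // zmp_subst; last by apply: (allP dg); rewrite mem_nth.
  by rewrite -zmp_der; elim/ord3P: i.
have wvP n w m : ~~ Z.eqb n 0 ->
    zmp K (zdot w [seq zsubst zline_restr (d1 + d2) p |
      p <- [:: zder 0 fz; zder 1 fz; zder 2 fz]]) = zmp K [:: (m, n)] ->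
    dot (wv n w) (comp_mpoly [tuple 'X_i0; 'X_i1; 4 *: 'X_i0 + (-2) *: 'X_i1] \o
      (fun i => (zmp K fz)^`M(i))) = zmev (fun i => 'X_i) m.
  have -> : zmp K [:: (m, n)] = zr K n *: zmev (fun i => 'X_i) m.
    by rewrite /zmp zev_cons zev_nil addr0 /= zr_mpolyC mul_mpolyC.
  rewrite zmp_dot => nz e.
  have nz' : zr K n != 0 by rewrite zr_eq0.
  apply: (scalerI nz'); rewrite -e !dotE /wv /= -!sub_g.
  by rewrite !scalerDr !scalerAl !scalerA divff // !scale1r.
apply: (@free_of_cross K (zmp K fz) d1 d2 (zvec r1) (zvec r2) (zr K c) _ _ _ _ _
  4 (-2) M (wv n0 w0) (wv n1 w1)) => //.
- exact: zmp_homog.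
- by rewrite zr_eq0.
- by move=> i; apply: homog_nth.
- by move=> i; apply: homog_nth.
- move=> i; rewrite -zmp_cross; elim/ord3P: i.
  + by rewrite [LHS]x0 zmp_scale -zmp_der.
  + by rewrite [LHS]x1 zmp_scale -zmp_der.
  by rewrite [LHS]x2 zmp_scale -zmp_der.
- by rewrite (wvP _ _ _ n00 ew0) /zmev !expr0 !mulr1.
by rewrite (wvP _ _ _ n10 ew1) /zmev !expr0 mul1r mulr1.
Qed.

End FreeCheck.

Definition zbranches (zA : seq zpoly) (v : z4vec) : seq zpoly :=
  [seq q <- zA | z4is0 (z4eval v q)].

Definition zindependent (u v : z4vec) : bool := ~~ z4vec_is0 (z4cross u v).

Definition ztransversal (zA : seq zpoly) (v : z4vec) : bool :=
  pairwise zindependent [seq z4grad v q | q <- zbranches zA v].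

(** A listed point on p and off q shows that a nonzero p is no scalar multiple of q. *)
Definition zseparated (p q : zpoly) : bool :=
  has (fun v => z4is0 (z4eval v p) && ~~ z4is0 (z4eval v q)) z4pts.

Definition z4line (l : Z * Z * Z) : z4vec := (z4int l.1.1, z4int l.1.2, z4int l.2).

Definition line_line_check (l l' : Z * Z * Z) : bool :=
  let c := z4cross (z4line l) (z4line l') in
  ~~ z4vec_is0 c && has (fun v => z4vec_is0 (z4cross c v)) z4pts.

(** No line of the arrangement is tangent to the conic, so each carries two listed points of it, and
    [line_conic_meet] excludes further ones. *)
Definition line_conic_check (l : Z * Z * Z) : bool :=
  let s := [seq v <- z4pts | z4is0 (z4eval v (zline l)) && z4is0 (z4eval v zconic)] in
  has (fun v => has (fun w => zindependent v w &&
    ~~ z4is0 (z4eval (z4vec_add v w) zconic)) s) s.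

Definition zmult (zA : seq zpoly) (v : z4vec) : nat := size (zbranches zA v).

Lemma z4pts_nonzero : all (fun v => ~~ z4vec_is0 v) z4pts.
Proof. by vm_compute. Qed.

Lemma z4pts_independent : pairwise zindependent z4pts.
Proof. by vm_compute. Qed.

Lemma zCL4_transversal : all (ztransversal zCL4) z4pts.
Proof. by vm_compute. Qed.

Lemma zlines_transversal : all (ztransversal zlines) z4pts.
Proof. by vm_compute. Qed.

Lemma line_line_checks : pairwise line_line_check line_coefs.
Proof. by vm_compute. Qed.

Lemma line_conic_checks : all line_conic_check line_coefs.
Proof. by vm_compute. Qed.

Lemma zCL4_nonzero : all (fun q => has (fun v => ~~ z4is0 (z4eval v q)) z4pts) zCL4.
Proof. by vm_compute. Qed.

Lemma zlines_homog : all (zhomog 1) zlines.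
Proof. by vm_compute. Qed.

Lemma zCL4_separated : all (fun p => all (fun q => (p == q) || zseparated p q) zCL4) zCL4.
Proof. by vm_compute. Qed.

Lemma zCL4_pairwise_separated : pairwise zseparated zCL4.
Proof. by vm_compute. Qed.

Lemma zmult_CL4 : [seq zmult zCL4 v | v <- z4pts] =
  [:: 4; 4; 4; 4; 2; 3; 2; 3; 2; 4; 4; 4; 4; 4; 4; 2; 2; 2; 2; 2; 2; 2; 2]%N.
Proof. by vm_compute. Qed.

(** The final ones are the four points on the conic, which become simple once it is deleted. *)
Lemma zmult_lines : [seq zmult zlines v | v <- z4pts] =
  [:: 4; 3; 4; 3; 2; 3; 2; 3; 2; 3; 4; 3; 3; 4; 3; 2; 2; 2; 2; 1; 1; 1; 1]%N.
Proof. by vm_compute. Qed.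

(** The exponent 18 = 12 + 6 adds the degree of the partials to that of [w0_CL4] and [w1_CL4]; for
    the lines it is 14 = 10 + 4. *)
Lemma free_check_CL4 : free_check (zprod zCL4) 5 7 18 39 90810720000000 363242880000
  r1_CL4 r2_CL4 w0_CL4 w1_CL4.
Proof. by vm_compute. Qed.

Lemma free_check_lines : free_check (zprod zlines) 5 5 14 33 3725568000 1862784000
  r1_L r2_L w0_L w1_L.
Proof. by vm_compute. Qed.

#[local] Arguments ev4 : simpl never.
#[local] Arguments z4int : simpl never.

(** * Transfer of the computed incidences to complex coordinates *)

Section Arrangement.
Variable R : realType.
Local Notation C := R[i].
Local Notation emb := (@emb4 R).

Lemma zlinesE : [seq zmp C p | p <- zlines] = lines4 C.
Proof.
rewrite /zlines -map_comp /=; do !congr (_ :: _);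
  rewrite /zmp !zev_cons zev_nil /= /zr /= ?mulr1z ?mulr0z ?mulrN1z;
  rewrite ?expr0 ?expr1; ring.
Qed.

Lemma zconicE : zmp C zconic = conic4 C.
Proof.
rewrite /zmp !zev_cons zev_nil /= /zr /= ?mulr1z ?mulr0z ?mulrN1z.
by rewrite /conic4; ring.
Qed.

Lemma zCL4E : [seq zmp C p | p <- zCL4] = CL4 C.
Proof. by rewrite map_rcons zlinesE zconicE. Qed.

Lemma branches_zmp zA v :
  branches [seq zmp C p | p <- zA] (emb v) = [seq zmp C p | p <- zbranches zA v].
Proof.
rewrite /branches filter_map; congr map; apply: eq_filter => p /=.
by rewrite -ev4_eval ev4_eq0.
Qed.

Lemma size_branches_zmp zA v : size (branches [seq zmp C p | p <- zA] (emb v)) = zmult zA v.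
Proof. by rewrite branches_zmp size_map. Qed.

Lemma zindependentP u v : zindependent u v = independent (emb u) (emb v).
Proof. by rewrite /independent -(eq_nonzero (emb4_cross _ _ _)) emb4_nonzero. Qed.

Lemma transversal_zmp zA v : ztransversal zA v -> transversal [seq zmp C p | p <- zA] (emb v).
Proof.
rewrite /transversal branches_zmp /ztransversal !pairwise_map.
apply: sub_pairwise => p q /=; rewrite zindependentP => ind.
by rewrite -(eq_independent (emb4_grad _ _ _) (emb4_grad _ _ _)).
Qed.

Lemma meval_zline l (x : 'I_3 -> C) : (zmp C (zline l)).@[x] = dot (emb (z4line l)) x.
Proof.
rewrite /zmp rmorph_zev dotE /emb4 /vec3 /= !ev4_int !zev_cons zev_nil /=.
by rewrite !mevalXU !expr0 !expr1 !(mulr1, mul1r) addr0 addrA.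
Qed.

Lemma pts_coverP (x : 'I_3 -> C) v c : nonzero x -> (forall i, x i = c * emb v i) ->
  nonzero (emb v) -> exists c', forall i, emb v i = c' * x i.
Proof.
move=> /existsP[j nz] e nzv; exists c^-1 => i; rewrite e mulrA mulVf ?mul1r //.
by apply: contraNneq nz => c0; rewrite e c0 mul0r.
Qed.

Lemma pairwise_count_ge2 (T : eqType) (r : rel T) (a : pred T) s :
  pairwise r s -> (2 <= count a s)%N -> exists x y, [/\ r x y, a x & a y].
Proof.
move/(subseq_pairwise (filter_subseq a s)); rewrite -size_filter.
have := filter_all a s; case: (filter a s) => [|x [|y t]] //=.
by move=> /and3P[ax ay _] /andP[/andP[rxy _] _] _; exists x, y.
Qed.

Lemma mult_at_lines p : mult_at (lines4 C) p =
  count (fun l => dot (emb (z4line l)) (crd p) == 0) line_coefs.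
Proof.
rewrite /mult_at -zlinesE !count_map; apply: eq_count => l /=.
by rewrite on_curveE meval_zline.
Qed.

Lemma point_of_proportional p v c : v \in z4pts -> (forall i, crd p i = c * emb v i) ->
  exists2 v, v \in z4pts & p = point (emb v).
Proof.
move=> v_in e; exists v => //.
have nzv : nonzero (emb v) by rewrite emb4_nonzero; apply: (allP z4pts_nonzero).
have [c' e'] := pts_coverP (nonzero_crd p) e nzv.
exact: eq_point nzv e'.
Qed.

Lemma lines_cover p : (2 <= mult_at (lines4 C) p)%N ->
  exists2 v, v \in z4pts & p = point (emb v).
Proof.
rewrite mult_at_lines => /(pairwise_count_ge2 line_line_checks)[l [l' [/andP[ind]]]].
case/hasP => v v_in cv /eqP el /eqP el'.
have [||w|c ec] := @line_line_meet _ _ _ (emb v) (crd p) _ _ _ el el'.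
- by rewrite -zindependentP.
- by rewrite emb4_nonzero; apply: (allP z4pts_nonzero).
- by rewrite -(emb4_is0 R w cv) emb4_cross /cross !emb4_cross.
exact: point_of_proportional v_in ec.
Qed.

Lemma mult_at_rcons (A : seq {mpoly C[3]}) g p :
  mult_at (rcons A g) p = (mult_at A p + on_curve g p)%N.
Proof. by rewrite /mult_at -cats1 count_cat /= addn0. Qed.

Lemma CL4_cover p : (2 <= mult_at (CL4 C) p)%N ->
  exists2 v, v \in z4pts & p = point (emb v).
Proof.
rewrite mult_at_rcons.
case: (leqP 2 (mult_at (lines4 C) p)) => [/lines_cover //|lt2].
case: (boolP (on_curve (conic4 C) p)) => [/eqP qp|_]; last first.
  by rewrite addn0 ltnNge -ltnS lt2.
(* At most one line passes through [p] here, so [p] is a point of one line and the conic. *)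
rewrite addn1 ltnS mult_at_lines -has_count => /hasP[l l_in /eqP el].
have : line_conic_check l by apply: (allP line_conic_checks).
rewrite /line_conic_check; set s := filter _ _.
case/hasP=> v v_s /hasP[w w_s /andP[ind q12]]; move: v_s w_s.
rewrite !mem_filter => /andP[/andP[lv qv] v_in] /andP[/andP[lw qw] w_in].
have lineE u : z4is0 (z4eval u (zline l)) -> dot (emb (z4line l)) (emb u) = 0.
  by rewrite -(ev4_eq0 R) ev4_eval meval_zline => /eqP.
have conicE u : z4is0 (z4eval u zconic) = ((conic4 C).@[emb u] == 0).
  by rewrite -(ev4_eq0 R) ev4_eval zconicE.
have nzl : nonzero (emb (z4line l)).
  rewrite emb4_nonzero.
  by apply: (allP (_ : all (fun l => ~~ z4vec_is0 (z4line l)) line_coefs)).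
have [|||||c [ec|ec]] := @line_conic_meet _ _ (emb v) (emb w) (crd p) nzl _ _
    (lineE v lv) (lineE w lw) el.
- by rewrite -zindependentP.
- by rewrite -(meval_eq _ (emb4_add _ _ _)) -conicE.
- by apply/eqP; rewrite -conicE.
- by apply/eqP; rewrite -conicE.
- exact: qp.
- exact: point_of_proportional v_in ec.
exact: point_of_proportional w_in ec.
Qed.

End Arrangement.

(** * The conic-line arrangement and its deletion *)

Section CL4.
Variable R : realType.
Local Notation C := R[i].
Local Notation emb := (@emb4 R).

Lemma zpoly_neq0 q v : ~~ z4is0 (z4eval v q) -> zmp C q != 0.
Proof.
rewrite -(ev4_eq0 R) ev4_eval; apply: contraNneq => ->.
by rewrite meval0.
Qed.

Lemma zCL4_neq0 q : q \in zCL4 -> zmp C q != 0.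
Proof.
move=> q_in; have /hasP[v _] := allP zCL4_nonzero q q_in.
exact: zpoly_neq0.
Qed.

Lemma zseparated_neq p q (c : C) : zmp C p != 0 -> zseparated p q ->
  zmp C p <> c *: zmp C q.
Proof.
move=> p0 /hasP[v _]; rewrite -!(ev4_eq0 R) !ev4_eval => /andP[/eqP pv qv] e.
move/eqP: pv; rewrite e mevalZ mulf_eq0 (negPf qv) orbF => /eqP c0.
by rewrite e c0 scale0r eqxx in p0.
Qed.

Lemma CL4_line g : g \in lines4 C -> is_line g.
Proof.
rewrite -zlinesE => /mapP[q q_in ->]; split.
  by apply: zCL4_neq0; rewrite mem_rcons in_cons q_in orbT.
by apply: zmp_homog; apply: (allP zlines_homog).
Qed.

(** The partials -2x + y, x - 2y and 2z form a linear system of determinant 6, which has no nonzero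
    solution. *)
Lemma conic4_smooth : is_smooth_conic (conic4 C).
Proof.
split; first by rewrite -zconicE; apply: zCL4_neq0; rewrite mem_rcons mem_head.
  by rewrite -zconicE; apply: zmp_homog.
move=> p; apply/negP => /andP[_ /forallP sing].
have e (k : 'I_3) : zev (crd p) (zder k zconic) = 0.
  transitivity ((zmp C (zder k zconic)).@[crd p]); last first.
    by apply/eqP; have := sing k; rewrite on_curveE -zconicE -zmp_der.
  by rewrite /zmp rmorph_zev; apply: eq_zev => j; rewrite /= mevalXU.
have := (e i0, e i1, e i2).
rewrite !zev_cons !zev_nil /= /zr /= !expr0 !expr1 !(mulr1, mul1r, addr0).
move: (nonzero_crd p); set a := crd p => nz [[e0 e1] e2].
have {}e0 : - 2 * a i0 + a i1 = 0 := e0.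
have {}e1 : a i0 + - 2 * a i1 = 0 := e1.
have {}e2 : 2 * a i2 = 0 := e2.
have x1 : a i1 = 2 * a i0.
  by apply/eqP; rewrite -subr_eq0 -[X in _ == X]e0; apply/eqP; ring.
have x0 : 3 * a i0 = 0.
  by transitivity (- (a i0 + - 2 * a i1)); [rewrite x1; ring | rewrite e1 oppr0].
have a0 : a i0 = 0 by apply/eqP; move/eqP: x0; rewrite mulf_eq0 pnatr_eq0.
have a2 : a i2 = 0 by apply/eqP; move/eqP: e2; rewrite mulf_eq0 pnatr_eq0.
by case/existsP: nz => j; elim/ord3P: j; rewrite ?x1 ?a0 ?a2 ?mulr0 eqxx.
Qed.

Lemma CL4_members g : g \in CL4 C -> is_line g \/ is_smooth_conic g.
Proof.
rewrite mem_rcons in_cons => /orP[/eqP ->|/CL4_line]; last by left.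
by right; apply: conic4_smooth.
Qed.

Lemma lines4_members g : g \in lines4 C -> is_line g \/ is_smooth_conic g.
Proof. by move/CL4_line; left. Qed.

Lemma CL4_uniq : uniq (CL4 C).
Proof.
rewrite -zCL4E uniq_pairwise pairwise_map.
suff sep s : {subset s <= zCL4} -> pairwise zseparated s ->
    pairwise (fun p q => zmp C p != zmp C q) s by apply: sep zCL4_pairwise_separated.
elim: s => //= p s IH sub /andP[sp ps]; apply/andP; split.
  apply/allP => q q_in; apply/eqP; rewrite -[zmp C q]scale1r.
  by apply: zseparated_neq; [apply/zCL4_neq0/sub/mem_head | apply: (allP sp)].
by apply: IH => // q q_in; apply: sub; rewrite in_cons q_in orbT.
Qed.

Lemma CL4_arrangement : conic_line_arrangement (CL4 C).
Proof.
split; [exact: CL4_uniq | exact: CL4_members|].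
move=> g h; rewrite -zCL4E => /mapP[p p_in ->] /mapP[q q_in ->] neq c.
apply: zseparated_neq; first exact: zCL4_neq0.
have /orP[/eqP e|//] := allP (allP zCL4_separated p p_in) q q_in.
by rewrite e in neq.
Qed.

Lemma f4E : f4 C = defpoly (CL4 C).
Proof. by rewrite /defpoly /CL4 !big_cons big_nil mulr1 /f4 !mulrA. Qed.

Lemma rem_conic4 : rem (conic4 C) (CL4 C) = lines4 C.
Proof.
have : conic4 C \notin lines4 C by have := CL4_uniq; rewrite /CL4 rcons_uniq => /andP[].
rewrite /CL4; elim: (lines4 C) => [|g s IH] /=; first by rewrite eqxx.
by rewrite in_cons negb_or eq_sym => /andP[/negPf -> /IH ->].
Qed.

Lemma pts_nonzero v : v \in z4pts -> nonzero (emb v).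
Proof. by move=> v_in; rewrite emb4_nonzero; apply: (allP z4pts_nonzero). Qed.

Lemma pts_independent : pairwise (fun u v => independent (emb u) (emb v)) z4pts.
Proof. by apply: sub_pairwise z4pts_independent => u v; rewrite (zindependentP R). Qed.

Lemma CL4_transversal v : v \in z4pts -> transversal (CL4 C) (emb v).
Proof.
by move=> v_in; rewrite -zCL4E; apply/transversal_zmp/(allP zCL4_transversal).
Qed.

Lemma lines4_transversal v : v \in z4pts -> transversal (lines4 C) (emb v).
Proof.
by move=> v_in; rewrite -zlinesE; apply/transversal_zmp/(allP zlines_transversal).
Qed.

Lemma size_branches_CL4 v : size (branches (CL4 C) (emb v)) = zmult zCL4 v.
Proof. by rewrite -zCL4E size_branches_zmp. Qed.

Lemma size_branches_lines4 v : size (branches (lines4 C) (emb v)) = zmult zlines v.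
Proof. by rewrite -zlinesE size_branches_zmp. Qed.

Lemma n_points_CL4 r : (2 <= r)%N ->
  n_points (CL4 C) r (count_mem r [seq zmult zCL4 v | v <- z4pts]).
Proof.
move=> r_ge2; rewrite count_map.
rewrite -(eq_count (a1 := fun v => size (branches (CL4 C) (emb v)) == r)).
  exact: (n_points_count CL4_members pts_nonzero pts_independent (@CL4_cover R)).
by move=> v; apply: (congr1 (fun n => n == r) (size_branches_CL4 v)).
Qed.

Lemma n_points_lines4 r : (2 <= r)%N ->
  n_points (lines4 C) r (count_mem r [seq zmult zlines v | v <- z4pts]).
Proof.
move=> r_ge2; rewrite count_map.
rewrite -(eq_count (a1 := fun v => size (branches (lines4 C) (emb v)) == r)).
  exact: (n_points_count lines4_members pts_nonzero pts_independent (@lines_cover R)).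
by move=> v; apply: (congr1 (fun n => n == r) (size_branches_lines4 v)).
Qed.

Lemma CL4_mult_le4 : all (fun v => size (branches (CL4 C) (emb v)) <= 4)%N z4pts.
Proof.
rewrite (eq_all (a2 := preim (zmult zCL4) (fun n => n <= 4)%N)) -?all_map ?zmult_CL4 //.
by move=> v; apply: (congr1 (fun n => n <= 4)%N (size_branches_CL4 v)).
Qed.

Lemma lines4_mult_le4 : all (fun v => size (branches (lines4 C) (emb v)) <= 4)%N z4pts.
Proof.
rewrite (eq_all (a2 := preim (zmult zlines) (fun n => n <= 4)%N)) -?all_map ?zmult_lines //.
by move=> v; apply: (congr1 (fun n => n <= 4)%N (size_branches_lines4 v)).
Qed.

(** The sum is made to depend on the list of multiplicities only, so that the tabulated lists can be
    substituted. *)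
Lemma tjurina_sum (m : z4vec -> nat) s :
  sumn [seq ((m v).-1 ^ 2)%N | v <- s & (2 <= m v)%N] =
  sumn [seq (n.-1 ^ 2)%N | n <- [seq m v | v <- s] & (2 <= n)%N].
Proof. by rewrite filter_map -map_comp. Qed.

Lemma CL4_tjurina : total_tjurina (defpoly (CL4 C)) 109.
Proof.
have := total_tjurina_sum CL4_members pts_nonzero pts_independent CL4_transversal
  (@CL4_cover R) CL4_mult_le4.
rewrite (tjurina_sum (fun v => size (branches (CL4 C) (emb v)))).
by rewrite (eq_map size_branches_CL4) zmult_CL4.
Qed.

Lemma lines4_tjurina : total_tjurina (defpoly (lines4 C)) 75.
Proof.
have := total_tjurina_sum lines4_members pts_nonzero pts_independent lines4_transversal
  (@lines_cover R) lines4_mult_le4.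
rewrite (tjurina_sum (fun v => size (branches (lines4 C) (emb v)))).
by rewrite (eq_map size_branches_lines4) zmult_lines.
Qed.

Lemma zmp_prod zA : zmp C (zprod zA) = defpoly [seq zmp C q | q <- zA].
Proof. by rewrite /zmp zev_prod /defpoly big_map. Qed.

Lemma CL4_free : free_with_exponents (defpoly (CL4 C)) 5 7.
Proof. rewrite -zCL4E -zmp_prod.
exact: (@free_of_check C (zprod zCL4) 5 7 _ _ _ _ _ _ _ _ isT free_check_CL4). Qed.

Lemma lines4_free : free_with_exponents (defpoly (lines4 C)) 5 5.
Proof. rewrite -zlinesE -zmp_prod.
exact: (@free_of_check C (zprod zlines) 5 5 _ _ _ _ _ _ _ _ isT free_check_lines). Qed.

Lemma CL4_homog : defpoly (CL4 C) \is 13.-homog.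
Proof.
rewrite -zCL4E -zmp_prod; apply: zmp_homog; exact: free_check_homog free_check_CL4.
Qed.

Lemma CL4_deg : deg (defpoly (CL4 C)) = 13%N.
Proof.
have nz : defpoly (CL4 C) != 0.
  rewrite prodf_seq_neq0; apply/allP => g; rewrite -zCL4E => /mapP[q q_in ->].
  exact: zCL4_neq0.
exact: homog_neq0_deg nz CL4_homog.
Qed.

Lemma CL4_M : M_arrangement (CL4 C).
Proof.
rewrite /M_arrangement CL4_deg; split=> //.
- exact: (ordinary_mult_le_of CL4_members pts_nonzero CL4_transversal (@CL4_cover R)
    (k := 4) isT CL4_mult_le4).
- exists (point (emb (head (z4int 0, z4int 0, z4int 0) z4pts))); split.
    exact: (ordinary_point CL4_members pts_nonzero CL4_transversal).
  rewrite (mult_point CL4_members pts_nonzero) // size_branches_CL4.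
  by have := congr1 (head 0%N) zmult_CL4.
(* 13 = 2 * 6 + 1, and 3 * 6^2 + 1 = 109 = 12^2 - 5 * 7. *)
exists 6%N; right; split=> //.
exact: (@deg_jacobian_free _ _ 5 7 CL4_homog CL4_free).
Qed.

Lemma lines4_poincare :
  is_poincare (lines4 C) (25%:Z *: 'X^2 + 10%:Z *: 'X + 1).
Proof.
exists (fun r => count_mem r [seq zmult zlines v | v <- z4pts]); split.
  by move=> r /andP[r_ge2 _]; apply: n_points_lines4.
(* 35 = 7 * 1 + 8 * 2 + 4 * 3, whence the leading coefficient 35 - 11 + 1 = 25; [unlock] lets the
   sum be evaluated. *)
rewrite zmult_lines (_ : \sum_(_ <= _ < _) _ = 35); last by rewrite unlock.
transitivity (1 + 10%:Z *: 'X + 25%:Z *: 'X^2 : {poly int}); last by [].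
by rewrite -addrA [LHS]addrC [_ *: 'X + 1]addrC.
Qed.

End CL4.

Theorem mainTheorem5 (R : realType) :
  let C : fieldType := R[i] in
  let L : seq {mpoly C[3]} := rem (conic4 C) (CL4 C) in
  (* CL4 consists of 11 lines and one smooth conic, with equation f *)
  [/\ conic_line_arrangement (CL4 C),
      size (lines4 C) = 11%N,
      (forall g, g \in lines4 C -> is_line g),
      is_smooth_conic (conic4 C)
    & f4 C = defpoly (CL4 C)] /\
  [/\ ordinary_mult_le (CL4 C) 4,
      [/\ n_points (CL4 C) 2 11, n_points (CL4 C) 3 2
        & n_points (CL4 C) 4 10],
      total_tjurina (f4 C) 109,
      is_mdr (f4 C) 5
    & M_arrangement (CL4 C) /\ free_with_exponents (f4 C) 5 7] /\
  (* L is CL4 with the conic deleted *)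
  [/\ [/\ n_points L 2 7, n_points L 3 8, n_points L 4 4
        & forall p, (mult_at L p <= 4)%N],
      total_tjurina (defpoly L) 75 /\ is_mdr (defpoly L) 5,
      is_poincare L (25%:Z *: 'X^2 + 10%:Z *: 'X + 1),
      25%:Z *: 'X^2 + 10%:Z *: 'X + 1 = (1 + 5%:Z *: 'X) ^+ 2 :> {poly int}
    & free_with_exponents (defpoly L) 5 5].
Proof.
move=> C L.
have -> : L = lines4 C by exact: rem_conic4.
have nC r (r2 : (2 <= r)%N) := n_points_CL4 R r2; rewrite zmult_CL4 in nC.
have nL r (r2 : (2 <= r)%N) := n_points_lines4 R r2; rewrite zmult_lines in nL.
have M := CL4_M R; have frC := CL4_free R; have frL := lines4_free R.
split; [|split].
- split=> //; first exact: CL4_arrangement.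
  + exact: CL4_line.
  + exact: conic4_smooth.
  exact: f4E.
- have -> : f4 C = defpoly (CL4 C) by exact: f4E.
  split; [by case: M | | exact: CL4_tjurina | by case: frC | by split].
  by split; [exact: (nC 2%N)|exact: (nC 3)|exact: (nC 4)].
split.
- split; [exact: (nL 2%N)|exact: (nL 3)|exact: (nL 4)|].
  exact: (mult_le (@lines4_members R) (@pts_nonzero R) (@lines_cover R) (k := 4) isT
    (lines4_mult_le4 R)).
- by split; [exact: lines4_tjurina | case: frL].
- exact: lines4_poincare.
- by rewrite -!mul_polyC; ring.
exact: frL.
Qed.
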